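(* Let $H>0$, $L>0$ and $0\le|a|<1$, and let $u=(u_1,u_2)\in\mathcal{A}^0$. Then: 1. For any sequence $u_\varepsilon\in\mathcal{A}^1(a)$ satisfying $u_\varepsilon\stackrel{\wedge}{\rightharpoonup}u$ as $\varepsilon\to0$, we have $$\liminf_{\varepsilon\to0}E^{1D}_\varepsilon(u_\varepsilon)\ge E^{1D}_0(u).$$ 2. There exists a sequence $w_\varepsilon\in\mathcal{A}^1(a)$ with $w_\varepsilon\stackrel{\wedge}{\rightharpoonup}u$ as $\varepsilon\to0$ and $$\lim_{\varepsilon\to0}E^{1D}_\varepsilon(w_\varepsilon)=E^{1D}_0(u).$$
   Context: $$\mathcal{A}^1(a)=\{u=u(y)\in H^1((-H,H);\mathbb{R}^2):\ u(\pm H)=(\pm\sqrt{1-a^2},a)\},$$ $$\mathcal{A}^0=\{u=(u_1,u_2):\ u_1^3\in BV((-H,H)),\ u_2\in H^1((-H,H)),\ u_2(\pm H)=a,\ |u|=1\ \text{a.e.}\}.$$ For $u\in\mathcal{A}^1(a)$ and $\varepsilon>0$, $$E^{1D}_\varepsilon(u)=\frac12\int_{-H}^H\Big\{\varepsilon|u'|^2+\frac1\varepsilon(|u|^2-1)^2+L(u_2')^2\Big\}\,dy,$$ and for $u\in\mathcal{A}^0$, $$E^{1D}_0(u)=\frac L2\int_{-H}^H(u_2')^2\,dy+\frac43\sum_{y_j\in J_{u_1}}\big(1-u_2^2(y_j)\big)^{3/2}+\frac16\big|u_1(-H)+\sqrt{1-a^2}\big|^3+\frac16\big|u_1(H)-\sqrt{1-a^2}\big|^3,$$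 where $J_{u_1}\subset(-H,H)$ is the (at most countable) jump set of $u_1$ and $u_1(\pm H)$ denote the one-sided limits of $u_1$ at the endpoints (one-sided limits exist because $u_1^3\in BV$). The notation $v_\varepsilon\stackrel{\wedge}{\rightharpoonup}v$ means weak convergence in $H_{\mathrm{div}}$ together with strong convergence in $L^2$; for vector fields $v_\varepsilon=(v_\varepsilon^{(1)},v_\varepsilon^{(2)})$ depending only on $y$ (so that the divergence is $(v_\varepsilon^{(2)})'$) this means $v_\varepsilon\to v$ in $L^2((-H,H);\mathbb{R}^2)$ and $(v^{(2)}_\varepsilon)'\rightharpoonup v_2'$ weakly in $L^2(-H,H)$. *)

(* Defs.v *)
(* Built on MathComp-Analysis, over an arbitrary realType. *)
From HB Require Import structures.
From mathcomp Require Import all_boot all_order all_algebra.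
From mathcomp Require Import all_classical all_reals all_analysis.
Set Implicit Arguments.
Unset Strict Implicit.
Unset Printing Implicit Defensive.
Import Order.TTheory GRing.Theory Num.Theory.
Import numFieldNormedType.Exports.
Local Open Scope classical_set_scope.
Local Open Scope ring_scope.

(* Fields on (-H, H) are functions on R of which only the values on [-H, H]
   matter. An element of H^1((-H,H)) is represented by its representative that
   is continuous on [-H, H], so that its boundary values are plain values.
   A function u_1 with u_1^3 in BV((-H,H)) is represented by a representative
   whose cube has bounded pointwise variation; any two of these have the same
   one-sided limits, so neither the jump set nor the energy depends on it. *)

Section fields.
Context {R : realType}.
Implicit Types (H a L eps : R) (f g phi : R -> R) (u : R -> R * R).

Local Notation mu := (@lebesgue_measure R).

Definition dom H : set R := `]- H, H[%classic.

(* The norm that the library puts on R * R is the sup norm. *)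
Definition enorm (v : R * R) : R := Num.sqrt (v.1 ^+ 2 + v.2 ^+ 2).

Definition L2 H : set (R -> R) :=
  [set f | f \_ (dom H) \in Lfun mu 2%:E].

(* C^1_c((-H,H)) *)
Definition test_function H phi : Prop :=
  [/\ (forall x, derivable phi x 1), continuous (derive1 phi) &
      exists K : set R,
        [/\ compact K, K `<=` dom H &
            forall x, ~ K x -> phi x = 0]].

Definition is_weak_derivative H f g : Prop :=
  L2 H g /\
  forall phi, test_function H phi ->
    \int[mu]_(y in dom H) (f y * derive1 phi y) =
    - \int[mu]_(y in dom H) (g y * phi y).

Definition H1 H : set (R -> R) :=
  [set f | [/\ {within `[-H, H], continuous f}, L2 H f &
               exists g, is_weak_derivative H f g]].

(* A weak derivative is unique up to a.e. equality, and only its integrals are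
   used below. *)
Definition weak_derivative H f : R -> R :=
  xget (cst 0) [set g | is_weak_derivative H f g].

Definition comp1 u : R -> R := fun y => (u y).1.
Definition comp2 u : R -> R := fun y => (u y).2.

Definition A1 H a : set (R -> R * R) :=
  [set u | [/\ H1 H (comp1 u), H1 H (comp2 u),
               u (- H) = (- Num.sqrt (1 - a ^+ 2), a) &
               u H = (Num.sqrt (1 - a ^+ 2), a)]].

Definition A0 H a : set (R -> R * R) :=
  [set u | [/\ bounded_variation (- H) H (fun y => comp1 u y ^+ 3),
               H1 H (comp2 u),
               comp2 u (- H) = a, comp2 u H = a &
               {ae mu, forall y, dom H y -> enorm (u y) = 1}]].

Definition left_limit f y : R := lim (f x @[x --> y^'-]).
Definition right_limit f y : R := lim (f x @[x --> y^'+]).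

Definition jump_set H f : set R :=
  [set y | dom H y /\ left_limit f y <> right_limit f y].

Definition E1D H L eps u : \bar R :=
  let du1 := weak_derivative H (comp1 u) in
  let du2 := weak_derivative H (comp2 u) in
  ((2^-1)%:E *
   \int[mu]_(y in dom H)
     (eps * enorm (du1 y, du2 y) ^+ 2
      + eps^-1 * (enorm (u y) ^+ 2 - 1) ^+ 2
      + L * du2 y ^+ 2)%:E)%E.

Definition E1D0 H L a u : \bar R :=
  ((L / 2)%:E *
     (\int[mu]_(y in dom H) (weak_derivative H (comp2 u) y ^+ 2)%:E)
   + (4 / 3)%:E *
     (\esum_(y in jump_set H (comp1 u))
        ((1 - comp2 u y ^+ 2) `^ (3 / 2))%:E)
   + (6^-1 * `|right_limit (comp1 u) (- H) + Num.sqrt (1 - a ^+ 2)| ^+ 3)%:E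
   + (6^-1 * `|left_limit (comp1 u) H - Num.sqrt (1 - a ^+ 2)| ^+ 3)%:E)%E.

Definition weak_L2_cvg H (I : Type) (F : set_system I) (g_ : I -> R -> R) g :=
  forall h, L2 H h ->
    \int[mu]_(y in dom H) (g_ i y * h y) @[i --> F] -->
    \int[mu]_(y in dom H) (g y * h y).

Definition strong_L2_cvg H (I : Type) (F : set_system I)
    (v_ : I -> R -> R * R) (v : R -> R * R) :=
  (\int[mu]_(y in dom H) (enorm (v_ i y - v y) ^+ 2)%:E)%E @[i --> F]
    --> 0%E.

(* Strong L^2 convergence with weak convergence in H_div, for fields that
   depend on y only: the divergence is then the derivative of the second
   component. *)
Definition hdiv_cvg H (I : Type) (F : set_system I)
    (v_ : I -> R -> R * R) (v : R -> R * R) :=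
  strong_L2_cvg H F v_ v /\
  weak_L2_cvg H F (fun i => weak_derivative H (comp2 (v_ i)))
    (weak_derivative H (comp2 v)).

End fields.

(* Main.v *)
(* Lower bound. Each jump y of u_1 goes from one of the two values
   +-s, s = sqrt (1 - u_2(y)^2), to the other. A bound on the energy bounds
   u_2' in L^2, so that near y the second component of u_eps stays close to
   u_2(y), while L^2 convergence provides points on both sides of y where the
   first one is close to -+s. Between them AM-GM bounds the energy below by
   \int_(-s)^s (s^2 - z^2) dz = 4/3 s^3. The endpoints are treated in the same
   way, with the boundary values of u_eps as one of the two sides, and the term
   in u_2' is weakly lower semicontinuous.

   Recovery. Keep u_2 and set w_1 = rho tau, where rho regularises |u_1| and
   tau, with values in [-1, 1], switches between -1 and 1 along hyperbolic
   tangents. u_1 may have infinitely many jumps; but on either side of a point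
   where |u_2| < 1 the sign of u_1 is locally constant, and near a point where
   |u_2| = 1 any sign is a good approximation, so that a Cousin covering
   argument, in which the costs of adjacent intervals add up, produces tau on
   the whole interval. *)
Require Import Defs.
From HB Require Import structures.
From mathcomp Require Import all_boot all_order all_algebra.
From mathcomp Require Import all_classical all_reals all_analysis.
From mathcomp Require Import measurable_realfun ring lra.
Set Implicit Arguments.
Unset Strict Implicit.
Unset Printing Implicit Defensive.
Import Order.TTheory GRing.Theory Num.Theory.
Import numFieldNormedType.Exports.
Local Open Scope classical_set_scope.
Local Open Scope ring_scope.

(** * Continuity and integrals on a closed segment *)

Section segment_integrals.
Context {R : realType}.
Implicit Types (p q x y c : R) (f g h : R -> R).

Local Notation mu := (@lebesgue_measure R).

(** The obstacle to recovery is that sqrt (1 - u_2^2) need not be in H^1 near points where |u_2| =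
    1. Hence rho^2 = 1 - u_2^2 + k (a^2 - u_2^2)^2: the added term vanishes at +-H, which keeps the
    boundary values exact, and equals k (1 - a^2)^2 > 0 where |u_2| = 1, because |a| < 1. The
    derivative of rho costs eps / k, the wrong modulus k^2 / eps; eps = r^4 and k = r^3 make both
    tend to 0. For costs to add up, the local statement prescribes a sign at each end of an interval
    and bounds the cost by the E_0 of that interval, boundary terms included. At a joint the sign of
    the left limit is prescribed: the boundary term of the left interval vanishes, and that of the
    right one is the jump cost, since 1/6 (2 s)^3 = 4/3 s^3. The lower bound fixes a real t < E_0
    and only estimates indices of energy below t, so that no subsequence is extracted. It is proved
    along an arbitrary filter and therefore also gives half of the limit for the recovery family.
    The chain rule for absolutely continuous functions and the joining of transitions rest on the
    same covering lemma. *)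

Definition intble p q f := mu.-integrable `[p, q] (EFin \o f).
Definition Intg p q f : R := \int[mu]_(x in `[p, q]) f x.

(** The radius [d] is explicit because windows and neighbourhoods are built from it throughout. *)
Definition cont_on p q f := forall x, p <= x <= q -> forall e, 0 < e ->
  exists2 d, 0 < d & forall y, p <= y <= q -> `|y - x| < d -> `|f y - f x| < e.

Lemma cont_onP p q f : {within `[p, q], continuous f} <-> cont_on p q f.
Proof.
rewrite subspace_continuousP; split=> [cf x xpq e e0|cf x /= xpq].
  have /cf : `[p, q]%classic x by rewrite /= in_itv.
  move=> /cvgrPdist_lt/(_ e e0); rewrite /within /= => -[d /= d0 dP].
  exists d => // y ypq yx; rewrite distrC; apply: (dP y); last by rewrite in_itv.
  by rewrite /ball /= distrC.
rewrite in_itv /= in xpq.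
apply/cvgrPdist_lt => e e0; have [d d0 dP] := cf x xpq e e0.
exists d => //= y yx; rewrite in_itv /= => ypq; rewrite distrC; apply: dP => //.
by rewrite distrC.
Qed.

Lemma cont_on_sub p q x y f : p <= x -> y <= q -> cont_on p q f -> cont_on x y f.
Proof.
move=> px yq cf z /andP[xz zy] e e0.
have [|d d0 dP] := cf z _ e e0; first by rewrite (le_trans px) ?(le_trans zy).
by exists d => // w /andP[xw wy]; apply: dP; rewrite (le_trans px) ?(le_trans wy).
Qed.

Lemma eq_cont_on p q f g : (forall x, p <= x <= q -> f x = g x) ->
  cont_on p q f -> cont_on p q g.
Proof.
move=> fg cf z zpq e e0; have [d d0 dP] := cf z zpq e e0.
by exists d => // y ypq; rewrite -!fg //; exact: dP.
Qed.

Lemma continuous_cont_on p q f : continuous f -> cont_on p q f.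
Proof. by move=> cf; apply/cont_onP; exact: continuous_subspaceT. Qed.

Lemma cont_on_bounded p q f : cont_on p q f ->
  exists2 M, 0 < M & forall x, p <= x <= q -> `|f x| <= M.
Proof.
move=> /cont_onP cf.
have /compact_bounded[M [_ Mr]] := continuous_compact cf (@segment_compact _ p q).
exists (`|M| + 1); first by rewrite ltr_wpDl.
move=> x xpq; apply: Mr; first by rewrite ltr_pwDr // ler_norm.
by exists x => //=; rewrite in_itv.
Qed.

Lemma cont_on_measurable p q f : cont_on p q f -> measurable_fun `[p, q] f.
Proof. by move=> /cont_onP; exact: subspace_continuous_measurable_fun. Qed.

Lemma cont_on_intble p q f : cont_on p q f -> intble p q f.
Proof.
by move=> /cont_onP; apply: continuous_compact_integrable; exact: segment_compact.
Qed.

Lemma cont_on_cst p q c : cont_on p q (cst c).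
Proof. by move=> x _ e e0; exists 1 => // y _ _; rewrite subrr normr0. Qed.

Lemma cont_onD p q f g : cont_on p q f -> cont_on p q g ->
  cont_on p q (fun x => f x + g x).
Proof.
move=> cf cg x xpq e e0.
have [d d0 dP] := cf x xpq (e / 2) ltac:(lra).
have [d' d'0 dP'] := cg x xpq (e / 2) ltac:(lra).
exists (Num.min d d'); first by rewrite lt_min d0.
move=> y ypq; rewrite lt_min => /andP[/(dP _ ypq) + /(dP' _ ypq)].
rewrite opprD addrACA => h1 h2; apply: le_lt_trans (ler_normD _ _) _; lra.
Qed.

Lemma cont_onM p q f g : cont_on p q f -> cont_on p q g ->
  cont_on p q (fun x => f x * g x).
Proof.
move=> /cont_onP/subspace_continuousP cf /cont_onP/subspace_continuousP cg.
apply/cont_onP/subspace_continuousP => x xpq.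
by apply: cvgM; [exact: cf|exact: cg].
Qed.

Lemma cont_onZ p q c f : cont_on p q f -> cont_on p q (fun x => c * f x).
Proof. by move=> cf; apply: cont_onM => //; exact: cont_on_cst. Qed.

Lemma cont_onN p q f : cont_on p q f -> cont_on p q (fun x => - f x).
Proof.
by move=> /(cont_onZ (-1)); apply: eq_cont_on => x _; rewrite mulN1r.
Qed.

Lemma cont_onB p q f g : cont_on p q f -> cont_on p q g ->
  cont_on p q (fun x => f x - g x).
Proof. by move=> cf cg; apply: cont_onD => //; exact: cont_onN. Qed.

Lemma cont_onX p q n f : cont_on p q f -> cont_on p q (fun x => f x ^+ n).
Proof.
move=> cf; elim: n => [|n IHn]; first exact: cont_on_cst.
by apply: eq_cont_on (cont_onM cf IHn) => x _; rewrite exprS.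
Qed.

Lemma intble_sub p q x y f : p <= x -> y <= q -> intble p q f -> intble x y f.
Proof.
move=> px yq; apply: integrableS => //; apply: subset_itv; by rewrite bnd_simp.
Qed.

Lemma eq_intble p q f g : (forall x, p <= x <= q -> f x = g x) ->
  intble p q f -> intble p q g.
Proof.
move=> fg; apply: eq_integrable => // x.
by rewrite inE /= in_itv /= => /fg ->.
Qed.

Lemma eq_int p q f g : (forall x, p <= x <= q -> f x = g x) ->
  Intg p q f = Intg p q g.
Proof.
by move=> fg; apply: eq_Rintegral => x; rewrite inE /= in_itv /= => /fg ->.
Qed.

Lemma intble_cst p q c : intble p q (cst c).
Proof. exact/cont_on_intble/cont_on_cst. Qed.

Lemma intbleD p q f g : intble p q f -> intble p q g ->
  intble p q (fun x => f x + g x).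
Proof.
move=> fi gi; have /(_ (measurable_itv _)) := integrableD _ fi gi.
by apply: eq_integrable.
Qed.

Lemma intbleZ p q c f : intble p q f -> intble p q (fun x => c * f x).
Proof.
move=> fi; have /(_ (measurable_itv _)) := integrableZl _ c fi.
by apply: eq_integrable.
Qed.

Lemma intbleN p q f : intble p q f -> intble p q (fun x => - f x).
Proof. by move=> /(intbleZ (-1)); apply: eq_intble => x _; rewrite mulN1r. Qed.

Lemma intbleB p q f g : intble p q f -> intble p q g ->
  intble p q (fun x => f x - g x).
Proof. by move=> fi gi; apply: intbleD => //; exact: intbleN. Qed.

Lemma intble_norm p q f : intble p q f -> intble p q (fun x => `|f x|).
Proof. exact: integrable_norm. Qed.

Lemma intble_measurable p q f : intble p q f -> measurable_fun `[p, q] f.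
Proof. by move=> /measurable_int/measurable_EFinP. Qed.

Lemma le_intble p q f g : measurable_fun `[p, q] f ->
  (forall x, p <= x <= q -> `|f x| <= g x) -> intble p q g -> intble p q f.
Proof.
move=> mf fg; apply: (@le_integrable _ _ _ mu) => //.
  exact/measurable_EFinP.
move=> x; rewrite /= in_itv /= => xpq; rewrite lee_fin.
by rewrite (le_trans (fg _ xpq))// ler_norm.
Qed.

Lemma intbleM_cont p q h f : cont_on p q h -> intble p q f ->
  intble p q (fun x => h x * f x).
Proof.
move=> ch fi; have [M M0 hM] := cont_on_bounded ch.
apply: (@le_intble p q _ (fun x => M * `|f x|)).
- apply: measurable_funM; [exact: cont_on_measurable|exact: intble_measurable].
- by move=> x xpq; rewrite normrM ler_wpM2r // hM.
- exact/intbleZ/intble_norm.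
Qed.

Lemma intD p q f g : intble p q f -> intble p q g ->
  Intg p q (fun x => f x + g x) = Intg p q f + Intg p q g.
Proof. exact: RintegralD. Qed.

Lemma intB p q f g : intble p q f -> intble p q g ->
  Intg p q (fun x => f x - g x) = Intg p q f - Intg p q g.
Proof. exact: RintegralB. Qed.

Lemma intZ p q c f : intble p q f -> Intg p q (fun x => c * f x) = c * Intg p q f.
Proof. exact: RintegralZl. Qed.

Lemma le_int p q f g : intble p q f -> intble p q g ->
  (forall x, p <= x <= q -> f x <= g x) -> Intg p q f <= Intg p q g.
Proof.
by move=> fi gi fg; apply: le_Rintegral => // x; rewrite /= in_itv; exact: fg.
Qed.

Lemma int_ge0 p q f : (forall x, p <= x <= q -> 0 <= f x) -> 0 <= Intg p q f.
Proof. by move=> f0; apply: Rintegral_ge0 => x; rewrite /= in_itv; exact: f0. Qed.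

Lemma int_cst p q c : p <= q -> Intg p q (cst c) = c * (q - p).
Proof.
move=> pq; rewrite /Intg Rintegral_cst //= lebesgue_measure_itv /= lte_fin.
case: ltP => [_ //|qp]; have -> : q = p by apply/eqP; rewrite eq_le pq qp.
by rewrite subrr.
Qed.

Lemma int_pt p f : Intg p p f = 0.
Proof. by rewrite /Intg set_itv1 Rintegral_set1. Qed.

Lemma int_cat p x q f : p <= x <= q -> intble p q f ->
  Intg p q f = Intg p x f + Intg x q f.
Proof.
move=> /andP[px xq] fi.
have := @Rintegral_itvB _ f (BLeft p) (BRight q) x fi.
rewrite !bnd_simp => /(_ px xq) /eqP; rewrite subr_eq addrC /Intg => /eqP ->.
congr (_ + _); rewrite Rintegral_itv_obnd_cbnd //.
by apply: integrableS fi => //; apply: subset_itv; rewrite bnd_simp.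
Qed.

Lemma norm_int p q f : intble p q f -> `|Intg p q f| <= Intg p q (fun x => `|f x|).
Proof. exact: le_normr_Rintegral. Qed.

Lemma int_sub p q x y f : p <= x -> x <= y -> y <= q -> intble p q f ->
  (forall x, p <= x <= q -> 0 <= f x) -> Intg x y f <= Intg p q f.
Proof.
move=> px xy yq fi f0.
have xq := le_trans xy yq; have py := le_trans px xy.
rewrite (@int_cat p x q) ?px // (@int_cat x y q) ?xy //; last first.
  exact: intble_sub fi.
rewrite addrA addrAC ler_wpDl ?addr_ge0 // int_ge0 // => z /andP[h1 h2].
  by apply: f0; rewrite h1 (le_trans h2).
by apply: f0; rewrite h2 (le_trans py).
Qed.

End segment_integrals.

(** * Absolutely continuous functions and their chain rule *)

Section absolute_continuity.
Context {R : realType}.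
Implicit Types (p q x y c : R) (f g h F : R -> R).

Local Notation mu := (@lebesgue_measure R).

Lemma ae_impl (P Q : R -> Prop) : (forall x, P x -> Q x) ->
  {ae mu, forall x, P x} -> {ae mu, forall x, Q x}.
Proof.
move=> PQ [N [mN N0 PN]]; exists N; split => // x nQx; apply: PN => Px.
by apply: nQx; exact: PQ.
Qed.

Lemma ae_and (P Q : R -> Prop) : {ae mu, forall x, P x} ->
  {ae mu, forall x, Q x} -> {ae mu, forall x, P x /\ Q x}.
Proof. exact: (@filterI _ _ (ae_filter_ringOfSetsType mu)). Qed.

Lemma ae_eq_int p q f g : measurable_fun `[p, q] f -> intble p q g ->
  {ae mu, forall x, p <= x <= q -> f x = g x} ->
  intble p q f /\ Intg p q f = Intg p q g.
Proof.
move=> mf gi fg; have mg := intble_measurable gi.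
have fg' : ae_eq mu `[p, q]%classic (EFin \o f) (EFin \o g).
  by apply: ae_impl fg => x fg; rewrite /= in_itv /= => /fg ->.
have mfE : measurable_fun `[p, q] (EFin \o f) by exact/measurable_EFinP.
have mgE : measurable_fun `[p, q] (EFin \o g) by exact/measurable_EFinP.
split; last by rewrite /Intg /Rintegral; congr fine; exact: ae_eq_integral.
apply/integrableP; split => //; case/integrableP : gi => _; apply: le_lt_trans.
rewrite le_eqVlt; apply/orP; left; apply/eqP; apply: ae_eq_integral => //.
- exact: measurableT_comp.
- exact: measurableT_comp.
- by apply: ae_impl fg' => x /= /[apply] -[->].
Qed.

(** The maximum of [f] and [g] is a.e. equal to [g], hence has the same integral, and it dominates
    [f] at every point. *)
Lemma ae_le_int p q f g : intble p q f -> intble p q g ->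
  {ae mu, forall x, p <= x <= q -> f x <= g x} -> Intg p q f <= Intg p q g.
Proof.
move=> fi gi fg.
have mg := intble_measurable gi; have mf := intble_measurable fi.
have mm : measurable_fun `[p, q] (fun x => Num.max (f x) (g x)).
  exact: measurable_maxr.
have [hi <-] : intble p q (fun x => Num.max (f x) (g x)) /\
    Intg p q (fun x => Num.max (f x) (g x)) = Intg p q g.
  by apply: ae_eq_int => //; apply: ae_impl fg => x /[apply] /max_idPr.
by apply: le_int => // x _; rewrite le_max lexx.
Qed.

(** A single point is null; this absorbs the value of [paste] at the joint. *)
Lemma eq_int_oc p q f g : (forall x, p < x <= q -> f x = g x) -> intble p q g ->
  intble p q f /\ Intg p q f = Intg p q g.
Proof.
move=> fg gi; apply: ae_eq_int => //.
  apply/measurable_fun_itv_obnd_cbndP.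
  apply: (@eq_measurable_fun _ _ _ _ _ g).
    by move=> x; rewrite inE /= in_itv /= => /fg.
  by apply/measurable_fun_itv_obnd_cbndP; exact: intble_measurable.
exists [set p]; split => //; first by rewrite lebesgue_measure_set1.
move=> x /= /not_implyP[/andP[px xq]] fgx; apply/eqP; apply: contra_notT fgx.
by move=> xp; apply: fg; rewrite lt_neqAle eq_sym xp px.
Qed.

Lemma ae_segment p q (P : R -> Prop) : (forall x, p < x < q -> P x) ->
  {ae mu, forall x, p <= x <= q -> P x}.
Proof.
move=> PP; exists ([set p] `|` [set q]); split => //.
- exact: measurableU.
- by apply: null_set_setU => //; exact: lebesgue_measure_set1.
move=> x /= /not_implyP[/andP[px xq]] nP; apply: contrapT => h; apply: nP; apply: PP.
rewrite !lt_neqAle px xq !andbT; apply/andP; split; apply/eqP => e; apply: h.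
  by left.
by right.
Qed.

(** Cousin's covering lemma for a relation that composes over adjacent intervals. Among the points
    reached from [p], the supremum is itself reached, by the condition on its left, and it cannot be
    below [q], by the condition on its right. *)
Lemma cousin_lemma p q (G : R -> R -> Prop) : p < q ->
  (forall x y z, p <= x -> x < y -> y < z -> z <= q ->
    G x y -> G y z -> G x z) ->
  (forall x, p <= x < q ->
    exists2 d, 0 < d & forall y, x < y -> y < x + d -> y <= q -> G x y) ->
  (forall x, p < x <= q ->
    exists2 d, 0 < d & forall y, x - d < y -> y < x -> p <= y -> G y x) ->
  G p q.
Proof.
move=> pq Gtrans Gr Gl.
pose S := [set y | p < y <= q /\ G p y].
have next x : p <= x < q -> exists2 y, x < y <= q & G x y.
  move=> xpq; have [d d0 dP] := Gr x xpq; case/andP: xpq => px xq.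
  have xm : x < Num.min (x + d / 2) q by rewrite lt_min xq ltrDl divr_gt0.
  exists (Num.min (x + d / 2) q); first by rewrite xm /= ge_min lexx orbT.
  apply: dP => //; last by rewrite ge_min lexx orbT.
  by rewrite gt_min; apply/orP; left; lra.
have [y0 /andP[py0 y0q] Gy0] := next p ltac:(lra).
have Sy0 : S y0 by split=> //; rewrite py0.
have Sub : has_ubound S by exists q => y [/andP[]].
have Ss : has_sup S by split => //; exists y0.
have ps : p < sup S by apply: lt_le_trans py0 _; exact: ub_le_sup.
have sq : sup S <= q by apply: ge_sup; [exists y0|move=> y [/andP[]]].
have Gps : G p (sup S).
  have [d d0 dP] := Gl (sup S) ltac:(by rewrite ps).
  have [y [/andP[py yq] Gpy] dy] := sup_adherent d0 Ss.
  have := ub_le_sup Sub (conj (introT andP (conj py yq)) Gpy).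
  rewrite le_eqVlt => /orP[/eqP <- //|ys].
  by apply: (Gtrans p y) => //; apply: dP => //; exact: ltW.
move: sq; rewrite le_eqVlt => /orP[/eqP <- //|sq].
have [y /andP[sy yq] Gsy] := next (sup S) ltac:(lra).
have : y <= sup S.
  apply: ub_le_sup => //; split; first by rewrite (lt_trans ps).
  by apply: (Gtrans p (sup S)).
by rewrite leNgt sy.
Qed.

(** Absolute continuity with the derivative as an explicit datum [g], determined up to a null set,
    so that the rules of calculus do not depend on a chosen derivative. *)
Definition ACon p q f g := intble p q g /\
  forall x y, p <= x -> x <= y -> y <= q -> f y - f x = Intg x y g.

Lemma AC_sub p q x y f g : p <= x -> y <= q -> ACon p q f g -> ACon x y f g.
Proof.
move=> px yq [gi fg]; split; first exact: intble_sub gi.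
by move=> s t xs st ty; apply: fg => //; [exact: le_trans xs|exact: le_trans yq].
Qed.

Lemma eq_AC p q f f' g g' : (forall x, p <= x <= q -> f x = f' x) ->
  (forall x, p <= x <= q -> g x = g' x) -> ACon p q f g -> ACon p q f' g'.
Proof.
move=> ff gg [gi fg]; split; first exact: eq_intble gi.
move=> x y px xy yq.
have xpq : p <= x <= q by rewrite px (le_trans xy).
have ypq : p <= y <= q by rewrite yq (le_trans px).
rewrite -!ff // fg //; apply: eq_int => z /andP[xz zy]; apply: gg.
by rewrite (le_trans px) // (le_trans zy).
Qed.

Lemma AC_cont_on p q f g : ACon p q f g -> cont_on p q f.
Proof.
move=> [gi fg]; have [qp|pq] := ltP q p.
  by move=> x /andP[px xq]; have := lt_le_trans qp (le_trans px xq); rewrite ltxx.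
have cg : cont_on p q (fun x => Intg p x g).
  by apply/cont_onP; exact: parameterized_integral_continuous.
apply: eq_cont_on (cont_onD (@cont_on_cst R p q (f p)) cg) => x /andP[px xq] /=.
by rewrite -fg // addrC subrK.
Qed.

Lemma AC_cst p q c : ACon p q (cst c) (cst 0).
Proof.
split=> [|x y px xy yq]; first exact: intble_cst.
by rewrite int_cst // subrr mul0r.
Qed.

Lemma AC_id p q : ACon p q id (cst 1).
Proof.
split=> [|x y px xy yq]; first exact: intble_cst.
by rewrite int_cst // mul1r.
Qed.

Lemma AC_D p q f1 g1 f2 g2 : ACon p q f1 g1 -> ACon p q f2 g2 ->
  ACon p q (fun x => f1 x + f2 x) (fun x => g1 x + g2 x).
Proof.
move=> [i1 h1] [i2 h2]; split; first exact: intbleD.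
move=> x y px xy yq; rewrite intD; last 2 first.
  exact: intble_sub i1. exact: intble_sub i2.
by rewrite -h1 // -h2 // opprD addrACA.
Qed.

Lemma AC_Z p q c f g : ACon p q f g -> ACon p q (fun x => c * f x) (fun x => c * g x).
Proof.
move=> [i1 h1]; split; first exact: intbleZ.
move=> x y px xy yq; rewrite intZ; last exact: intble_sub i1.
by rewrite -h1 // mulrBr.
Qed.

Lemma AC_B p q f1 g1 f2 g2 : ACon p q f1 g1 -> ACon p q f2 g2 ->
  ACon p q (fun x => f1 x - f2 x) (fun x => g1 x - g2 x).
Proof.
move=> h1 /(AC_Z (-1)) h2; apply: eq_AC (AC_D h1 h2) => x _; by rewrite mulN1r.
Qed.

(* h plays the role of the derivative of F with respect to f. *)
Lemma AC_chain p q f g F h : ACon p q f g -> cont_on p q h ->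
  (forall x, p <= x <= q -> forall e, 0 < e ->
    exists2 d, 0 < d & forall y, p <= y <= q -> `|y - x| < d ->
      `|F y - F x - h x * (f y - f x)| <= e * `|f y - f x|) ->
  ACon p q F (fun x => h x * g x).
Proof.
move=> [gi fg] ch Fh; split; first exact: intbleM_cont.
move=> x y px; rewrite le_eqVlt => /orP[/eqP <- _|xy yq].
  by rewrite subrr int_pt.
have gi' s t : x <= s -> t <= y -> intble s t g.
  by move=> xs ty; apply: intble_sub gi; [exact: le_trans xs|exact: le_trans yq].
have hgi' s t : x <= s -> t <= y -> intble s t (fun x => h x * g x).
  move=> xs ty; apply: intbleM_cont; last exact: gi'.
  by apply: cont_on_sub ch; [exact: le_trans xs|exact: le_trans yq].
suff main e : 0 < e -> `|F y - F x - Intg x y (fun x => h x * g x)| <=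
    e * Intg x y (fun t => `|g t|).
  apply/eqP; rewrite -subr_eq0 -normr_le0; apply/ler_addgt0Pl => e e0.
  rewrite addr0; set N := Intg x y (fun t => `|g t|) in main.
  have N0 : 0 <= N by apply: int_ge0.
  apply: le_trans (main (e / (N + 1)) _) _; first by rewrite divr_gt0 // ltr_wpDl.
  by rewrite mulrAC ler_pdivrMr ?ltr_wpDl // ler_pM2l // lerDl.
(* The estimate composes: defects and integrals of [|g|] both add up over adjacent intervals. It
   thus suffices to have it on short intervals at each point. *)
move=> e0; pose G a b := `|F b - F a - Intg a b (fun x => h x * g x)| <=
  e * Intg a b (fun t => `|g t|).
(* Freezing [h] at [h z] costs [e / 2] twice: for the expansion of [F] and for the variation of
   [h]. *)
have loc z a b : x <= a -> a < b -> b <= y ->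
    `|F b - F a - h z * (f b - f a)| <= e / 2 * `|f b - f a| ->
    (forall t, a <= t <= b -> `|h t - h z| <= e / 2) -> G a b.
  move=> xa ab by' Fz hz.
  have gab := gi' _ _ xa by'; have hgab := hgi' _ _ xa by'.
  have hzgab : intble a b (fun t => (h t - h z) * g t).
    apply: eq_intble (intbleB hgab (intbleZ (h z) gab)) => t _.
    by rewrite mulrBl.
  rewrite /G.
  have -> : Intg a b (fun x => h x * g x) =
      h z * (f b - f a) + Intg a b (fun t => (h t - h z) * g t).
    rewrite fg ?(ltW ab, le_trans px xa, le_trans by' yq) //.
    rewrite -intZ // -intD //; last exact: intbleZ.
    by apply: eq_int => t _; ring.
  rewrite opprD addrA; apply: le_trans (ler_normB _ _) _.
  pose N := Intg a b (fun t => `|g t|); have -> : e * N = e / 2 * N + e / 2 * N by lra.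
  apply: lerD.
    apply: le_trans Fz _; rewrite ler_pM2l ?divr_gt0 //.
    rewrite fg ?(ltW ab, le_trans px xa, le_trans by' yq) //.
    exact: norm_int.
  apply: le_trans (norm_int hzgab) _; rewrite /N -intZ; last exact: intble_norm.
  apply: le_int => [||t tab]; [exact: intble_norm|exact/intbleZ/intble_norm|].
  by rewrite normrM ler_wpM2r // hz.
have close z : x <= z <= y -> exists2 d, 0 < d & forall w, x <= w <= y ->
    `|w - z| < d -> `|F w - F z - h z * (f w - f z)| <= e / 2 * `|f w - f z| /\
    `|h w - h z| <= e / 2.
  move=> /andP[xz zy].
  have zpq : p <= z <= q by rewrite (le_trans px xz) (le_trans zy).
  have [d d0 dP] := Fh z zpq (e / 2) ltac:(lra).
  have [d' d'0 dP'] := ch z zpq (e / 2) ltac:(lra).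
  exists (Num.min d d'); first by rewrite lt_min d0.
  move=> w /andP[xw wy]; rewrite lt_min => /andP[wd wd'].
  have wpq : p <= w <= q by rewrite (le_trans px xw) (le_trans wy).
  by split; [exact: dP|apply/ltW; exact: dP'].
apply: (@cousin_lemma x y G) => //.
- move=> a b c xa ab bc cy; rewrite /G => Gab Gbc.
  have abc : a <= b <= c by rewrite !ltW.
  rewrite !(@int_cat _ a b c) //; last 2 first.
  + exact: intble_norm (gi' _ _ xa cy).
  + exact: hgi'.
  rewrite mulrDr; apply: le_trans (lerD Gab Gbc); apply: le_trans (ler_normD _ _).
  by rewrite le_eqVlt; apply/orP; left; apply/eqP; congr (`|_|); ring.
- move=> z /andP[xz zy].
  have [|d d0 dP] := close z; first by rewrite xz ltW.
  exists d => // w zw wzd wy; apply: (loc z) => //.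
    by apply: (dP w _ _).1; [lra|rewrite gtr0_norm ?subr_gt0 // ltrBlDl].
  move=> t /andP[zt tw]; apply: (dP t _ _).2; first by lra.
  by rewrite ger0_norm ?subr_ge0 //; lra.
- move=> z /andP[xz zy].
  have [|d d0 dP] := close z; first by rewrite zy ltW.
  exists d => // w zw wz xw; apply: (loc z) => //.
    have [|| + _] := dP w; first by lra.
      by rewrite ltr0_norm ?subr_lt0 //; lra.
    rewrite (_ : F z - F w - _ = - (F w - F z - h z * (f w - f z))); last by ring.
    by rewrite normrN (distrC (f z)).
  move=> t /andP[zt tw]; apply: (dP t _ _).2; first by lra.
  by rewrite ler0_norm ?subr_le0 //; lra.
Qed.

(** By continuity [|f y - f x| <= e / K] near [x], which turns the quadratic remainder into the one
    of the chain rule; [K] may vary with [x]. *)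
Lemma AC_chain_quadratic p q f g F h : ACon p q f g -> cont_on p q h ->
  (forall x, p <= x <= q -> exists2 K, 0 < K & forall y, p <= y <= q ->
      `|F y - F x - h x * (f y - f x)| <= K * (f y - f x) ^+ 2) ->
  ACon p q F (fun x => h x * g x).
Proof.
move=> fg ch Fh; apply: (AC_chain fg ch) => x xpq e e0.
have [K K0 KP] := Fh x xpq.
have [d d0 dP] := AC_cont_on fg xpq (divr_gt0 e0 K0).
exists d => // y ypq yx; apply: le_trans (KP y ypq) _.
rewrite -real_normK ?num_real // expr2 mulrA ler_wpM2r // -ler_pdivlMl //.
by rewrite mulrC; exact/ltW/dP.
Qed.

Lemma AC_sqr p q f g : ACon p q f g ->
  ACon p q (fun x => f x ^+ 2) (fun x => 2 * f x * g x).
Proof.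
move=> fg; apply: AC_chain_quadratic (fg) _ _; first exact/cont_onZ/AC_cont_on/fg.
move=> x _; exists 1 => // y _; rewrite mul1r -[leRHS]ger0_norm ?sqr_ge0 //.
by rewrite le_eqVlt; apply/orP; left; apply/eqP; congr (`|_|); ring.
Qed.

(** Polarisation: a product is a quarter of the difference of the squares of sum and difference. *)
Lemma AC_M p q f1 g1 f2 g2 : ACon p q f1 g1 -> ACon p q f2 g2 ->
  ACon p q (fun x => f1 x * f2 x) (fun x => f1 x * g2 x + f2 x * g1 x).
Proof.
move=> h1 h2; have := AC_B (AC_sqr (AC_D h1 h2)) (AC_sqr (AC_B h1 h2)).
by move=> /(AC_Z 4^-1); apply: eq_AC => x _; field.
Qed.

Lemma is_derive_littleo f x l : is_derive x 1 f l -> forall e, 0 < e ->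
  exists2 d, 0 < d & forall y, `|y - x| < d ->
    `|f y - f x - l * (y - x)| <= e * `|y - x|.
Proof.
move=> [/cvgrPdist_le df <-] e e0; have [d /= d0 dP] := df e e0.
exists d => // y yxd; have [->|yx] := eqVneq y x.
  by rewrite !subrr mulr0 subr0 normr0 mulr0.
have := dP (y - x); rewrite /ball_ /= sub0r normrN => /(_ yxd).
rewrite subr_eq0 => /(_ yx); rewrite /= [_%:A]mulr1 subrK.
rewrite -['D_1 f x]/(lim _) => h; rewrite -ler_pdivrMr ?normr_gt0 ?subr_eq0 //.
rewrite -normfV -normrM; apply: le_trans h; rewrite -normrN.
rewrite le_eqVlt; apply/orP; left; apply/eqP; congr (`|_|).
rewrite /GRing.scale /=; field.
by rewrite subr_eq0.
Qed.

(** The chain rule along the identity is the fundamental theorem of calculus. *)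
Lemma AC_derive p q F h : (forall x, p <= x <= q -> is_derive x 1 F (h x)) ->
  cont_on p q h -> ACon p q F h.
Proof.
move=> dF ch; have := @AC_chain p q id (cst 1) F h (AC_id p q) ch.
rewrite (_ : (fun x => h x * cst 1 x) = h); last first.
  by apply/funext => x; rewrite mulr1.
apply => x xpq e e0; have [d d0 dP] := is_derive_littleo (dF x xpq) e0.
by exists d => // y _; exact: dP.
Qed.

Definition paste m f g : R -> R := fun x => if x <= m then f x else g x.

Lemma int_paste p m q f g : p <= m <= q -> intble p m f -> intble m q g ->
  intble p q (paste m f g) /\
  Intg p q (paste m f g) = Intg p m f + Intg m q g.
Proof.
move=> /andP[pm mq] fi gi.
have fi' : intble p m (paste m f g).
  by apply: eq_intble fi => x /andP[_ xm]; rewrite /paste xm.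
have [gi' Egi] : intble m q (paste m f g) /\ Intg m q (paste m f g) = Intg m q g.
  by apply: eq_int_oc => // x /andP[mx _]; rewrite /paste leNgt mx.
have gl : intble p q (paste m f g).
  have pqE : `[p, q]%classic = `[p, m]%classic `|` `]m, q]%classic.
    by apply/seteqP; split => x /=; rewrite !in_itv /=; lra.
  have gi2 : mu.-integrable `]m, q] (EFin \o paste m f g).
    by apply: integrableS gi' => //; apply: subset_itv; rewrite bnd_simp.
  case/integrableP: (fi') => mf fio; case/integrableP: (gi2) => mg gio.
  have mfg : measurable_fun `[p, q] (EFin \o paste m f g).
    by rewrite pqE; apply/measurable_funU.
  apply/integrableP; split => //; rewrite pqE ge0_integral_setU //=.
  - exact: lte_add_pinfty.
  - rewrite -pqE; apply/measurable_EFinP; apply: measurableT_comp => //.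
    exact/measurable_EFinP.
  - by apply/disj_setPS => x [/=]; rewrite !in_itv /= => /andP[_ xm] /andP[]; lra.
split => //; rewrite (@int_cat _ p m q) ?pm // Egi; congr (_ + _).
by apply: eq_int => x /andP[_ xm]; rewrite /paste xm.
Qed.

Lemma paste_right m f g x : f m = g m -> m <= x -> paste m f g x = g x.
Proof.
move=> fg mx; rewrite /paste; case: leP => // xm.
by rewrite (_ : x = m) //; apply/eqP; rewrite eq_le xm.
Qed.

Lemma AC_paste p m q f1 g1 f2 g2 : p <= m <= q -> ACon p m f1 g1 -> ACon m q f2 g2 ->
  f1 m = f2 m -> ACon p q (paste m f1 f2) (paste m g1 g2).
Proof.
move=> pmq [i1 h1] [i2 h2] fm; case/andP: (pmq) => pm mq.
split=> [|x y px xy yq]; first exact: (int_paste pmq i1 i2).1.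
have [ym|my] := leP y m.
  rewrite /paste ym (le_trans xy ym) h1 //; apply: eq_int => t /andP[_ ty].
  by rewrite (le_trans ty ym).
have [mx|xm] := leP m x.
  rewrite !paste_right ?(ltW my) // h2 //; symmetry.
  apply: (@eq_int_oc _ _ _ _ _ _).2.
    by move=> t /andP[xt _]; rewrite /paste leNgt (le_lt_trans mx).
  exact: intble_sub i2.
rewrite (paste_right fm (ltW my)) {1}/paste (ltW xm).
have -> : f2 y - f1 x = (f1 m - f1 x) + (f2 y - f2 m) by rewrite fm; ring.
rewrite h1 ?(ltW xm) // h2 ?(ltW my) //.
rewrite (@int_paste x m y _ _ _ _ _).2 ?(ltW xm) ?(ltW my) //.
  exact: intble_sub i1.
exact: intble_sub i2.
Qed.

End absolute_continuity.

(** * Square-integrable functions on a segment *)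

Section square_integrable.
Context {R : realType}.
Implicit Types (p q x y c : R) (f g h phi : R -> R).

Local Notation mu := (@lebesgue_measure R).

Definition L2on p q f := measurable_fun `[p, q] f /\ intble p q (fun x => f x ^+ 2).

Lemma integrable_itv_oo p q f :
  mu.-integrable `]p, q[ (EFin \o f) <-> intble p q f.
Proof.
split=> [fi|]; last first.
  by apply: integrableS => //; apply: subset_itv; rewrite bnd_simp.
case/integrableP : fi => mf fio.
have mf' : measurable_fun `[p, q] f.
  apply/measurable_fun_itv_obnd_cbndP/measurable_fun_itv_bndo_bndcP.
  exact/measurable_EFinP.
apply/integrableP; split; first exact/measurable_EFinP.
rewrite -integral_itv_obnd_cbnd -?integral_itv_bndo_bndc //;
  do 2 apply: measurableT_comp => //;
  by apply: measurable_funS mf' => //; apply: subset_itv; rewrite bnd_simp.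
Qed.

Lemma Rintegral_itv_oo p q f : intble p q f ->
  \int[mu]_(x in `]p, q[) f x = Intg p q f.
Proof.
move=> fi; rewrite Rintegral_itv_bndo_bndc; last exact/integrable_itv_oo.
rewrite Rintegral_itv_obnd_cbnd //.
by apply: integrableS fi => //; apply: subset_itv; rewrite bnd_simp.
Qed.

Lemma integral_itv_oo p q f : intble p q f ->
  (\int[mu]_(x in `]p, q[) (f x)%:E)%E = (Intg p q f)%:E.
Proof.
move=> fi; rewrite -Rintegral_itv_oo // /Rintegral fineK //.
by apply: integrable_fin_num => //; apply/integrable_itv_oo.
Qed.

Lemma L2P H f : L2 H f <-> L2on (- H) H f.
Proof.
have sqE : (fun x => (f \_ (dom H)) x ^+ 2) = (fun x => f x ^+ 2) \_ (dom H).
  by apply/funext => x; rewrite !patchE; case: ifP => // _; rewrite expr0n.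
have mP : measurable_fun setT (f \_ (dom H)) <-> measurable_fun `[- H, H] f.
  rewrite -measurable_restrictT; last exact: measurable_itv.
  split=> [mf|]; last by apply: measurable_funS => //; apply: subset_itv; rewrite bnd_simp.
  exact/measurable_fun_itv_obnd_cbndP/measurable_fun_itv_bndo_bndcP.
have iP : mu.-integrable setT (EFin \o (fun x => (f \_ (dom H)) x ^+ 2)) <->
    intble (- H) H (fun x => f x ^+ 2).
  rewrite sqE -integrable_itv_oo.
  have := integrable_mkcond (mu := mu) (EFin \o (fun x => f x ^+ 2)) (D := dom H).
  rewrite restrict_EFin => ->; last exact: measurable_itv.
  by [].
split=> [fL|[mf fi]].
  split; last exact/iP/Lfun2_integrable_sqr.
  by apply/mP; move: fL; rewrite /L2 /= inE => /andP[]; rewrite inE.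
rewrite /L2 /= inE; apply/andP; split; rewrite inE /=; first exact/mP.
rewrite /finite_norm unlock /= poweR_lty //.
move/iP/integrableP : fi => [_]; apply: le_lt_trans.
rewrite le_eqVlt; apply/orP; left; apply/eqP; apply: eq_integral => x _ /=.
by rewrite powR_mulrn // normrX.
Qed.

Lemma le_L2on p q f g : measurable_fun `[p, q] f ->
  (forall x, p <= x <= q -> `|f x| <= g x) -> L2on p q g -> L2on p q f.
Proof.
move=> mf fg [mg gi]; split => //.
apply: le_intble gi; first exact: measurable_funX.
by move=> x xpq; rewrite normrX lerXn2r ?nnegrE // ?fg // (le_trans _ (fg x xpq)).
Qed.

Lemma L2onM p q f g : L2on p q f -> L2on p q g -> intble p q (fun x => f x * g x).
Proof.
move=> [mf fi] [mg gi]; apply: le_intble (intbleD fi gi).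
  exact: measurable_funM.
move=> x _; rewrite ler_norml; apply/andP; split.
  by rewrite -subr_ge0; have := sqr_ge0 (f x + g x); nra.
by have := sqr_ge0 (f x - g x); nra.
Qed.

Lemma L2onD p q f g : L2on p q f -> L2on p q g -> L2on p q (fun x => f x + g x).
Proof.
move=> fL gL; split; first by apply: measurable_funD; [case: fL|case: gL].
have := intbleD (intbleD fL.2 gL.2) (intbleZ 2 (L2onM fL gL)).
by apply: eq_intble => x _; ring.
Qed.

Lemma cont_on_L2on p q f : cont_on p q f -> L2on p q f.
Proof.
by move=> cf; split; [exact: cont_on_measurable|exact/cont_on_intble/cont_onX].
Qed.

Lemma L2onM_cont p q h f : cont_on p q h -> L2on p q f ->
  L2on p q (fun x => h x * f x).
Proof.
move=> ch [mf fi]; split.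
  by apply: measurable_funM => //; exact: cont_on_measurable.
have := intbleM_cont (cont_onX 2 ch) fi.
by apply: eq_intble => x _; rewrite exprMn.
Qed.

Lemma L2onZ p q c f : L2on p q f -> L2on p q (fun x => c * f x).
Proof. by apply: L2onM_cont; exact: cont_on_cst. Qed.

Lemma L2on_sub p q x y f : p <= x -> y <= q -> L2on p q f -> L2on x y f.
Proof.
move=> px yq [mf fi]; split; last exact: intble_sub fi.
by apply: measurable_funS mf => //; apply: subset_itv; rewrite bnd_simp.
Qed.

Lemma L2on_intble p q f : L2on p q f -> intble p q f.
Proof.
move=> fL; have := L2onM fL (cont_on_L2on (@cont_on_cst _ p q 1)).
by apply: eq_intble => x _; rewrite mulr1.
Qed.

End square_integrable.

(** * Weak derivatives and primitives *)

Section weak_derivatives.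
Context {R : realType}.
Implicit Types (p q x y c H : R) (f g h phi : R -> R).

Local Notation mu := (@lebesgue_measure R).

(** A uniform form of C^{1,1} that is stable under sums, multiples and shifts, and can be checked by
    algebra alone; continuity of [g] follows from it. *)
Definition quad_derive f g := exists2 K, 0 < K &
  forall x y, `|f y - f x - g x * (y - x)| <= K * (y - x) ^+ 2.

Lemma quad_is_derive f g x : quad_derive f g -> is_derive x 1 f (g x).
Proof.
move=> [K K0 KP].
have cv : h^-1 *: ((f \o shift x) h%:A - f x) @[h --> 0^'] --> g x.
  apply/cvgrPdist_le => e e0; exists (e / K); first by rewrite /= divr_gt0.
  move=> h; rewrite /ball_ /= sub0r normrN ltr_pdivlMr // => hd h0.
  rewrite -normrN opprB /GRing.scale /= mulr1.
  have -> : h^-1 * (f (h + x) - f x) - g x =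
      h^-1 * (f (h + x) - f x - g x * (h + x - x)) by field.
  rewrite normrM normfV ler_pdivrMl ?normr_gt0 //.
  apply: le_trans (KP _ _) _; rewrite addrK -real_normK ?num_real //.
  by rewrite expr2 mulrA mulrC ler_pM2l ?normr_gt0 // mulrC ltW.
split; first by apply/cvg_ex; exists (g x).
exact: cvg_lim cv.
Qed.

(** Adding the expansions at [x] and at [y] cancels [f] and leaves
    [|g x - g y| <= 2 * K * |x - y|]. *)
Lemma quad_continuous f g : quad_derive f g -> continuous g.
Proof.
move=> [K K0 KP] x; apply/cvgrPdist_le => e e0.
exists (e / (2 * K)); first by rewrite /= divr_gt0 // mulr_gt0.
move=> y; rewrite /ball_ /= ltr_pdivlMr ?mulr_gt0 // => yx.
have [->|xy] := eqVneq x y; first by rewrite subrr normr0 ltW.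
have := lerD (KP x y) (KP y x).
have -> : K * (y - x) ^+ 2 + K * (x - y) ^+ 2 = 2 * K * `|x - y| * `|x - y|.
  by rewrite -mulrA -expr2 real_normK ?num_real //; ring.
move=> /(le_trans (ler_normD _ _)).
have -> : f y - f x - g x * (y - x) + (f x - f y - g y * (x - y)) =
  (g x - g y) * (x - y) by ring.
rewrite normrM ler_pM2r ?normr_gt0 ?subr_eq0 // => /le_trans; apply.
by rewrite mulrC ltW.
Qed.

Lemma quad_deriveD f1 g1 f2 g2 : quad_derive f1 g1 -> quad_derive f2 g2 ->
  quad_derive (fun x => f1 x + f2 x) (fun x => g1 x + g2 x).
Proof.
move=> [K1 K10 h1] [K2 K20 h2]; exists (K1 + K2); first exact: addr_gt0.
move=> x y; rewrite (mulrDl K1); apply: le_trans (lerD (h1 x y) (h2 x y)).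
apply: le_trans (ler_normD _ _); rewrite le_eqVlt; apply/orP; left; apply/eqP.
by congr (`|_|); ring.
Qed.

Lemma quad_deriveZ c f g : quad_derive f g ->
  quad_derive (fun x => c * f x) (fun x => c * g x).
Proof.
move=> [K K0 h]; exists ((`|c| + 1) * K); first by rewrite mulr_gt0 // ltr_wpDl.
move=> x y; have -> : c * f y - c * f x - c * g x * (y - x) =
  c * (f y - f x - g x * (y - x)) by ring.
rewrite normrM -mulrA ler_pM // lerDl //.
Qed.

Lemma quad_derive_shift c f g : quad_derive f g ->
  quad_derive (fun x => f (x - c)) (fun x => g (x - c)).
Proof.
move=> [K K0 h]; exists K => // x y; have := h (x - c) (y - c).
by rewrite opprB addrA subrK.
Qed.

Lemma quad_derive_pos_sqr :
  quad_derive (fun x => Num.max 0 x ^+ 2) (fun x => 2 * Num.max 0 x).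
Proof.
exists 1 => // x y; rewrite ler_norml mul1r !expr2.
have := mulr_ge0 (normr_ge0 x) (normr_ge0 y).
have := sqr_ge0 (y - x); have := sqr_ge0 x; have := sqr_ge0 y; rewrite !expr2.
case: (leP 0 x) => x0; case: (leP 0 y) => y0.
- rewrite !ger0_norm //; lra.
- rewrite (ger0_norm x0) (ltr0_norm y0); lra.
- rewrite (ltr0_norm x0) (ger0_norm y0); lra.
- rewrite (ltr0_norm x0) (ltr0_norm y0); lra.
Qed.

(* The difference quotients of t_+^2 build a C^1 step from 0 to 2 r^2 whose
   derivative is a tent supported on [0, 2 r]. *)
Definition step r x : R :=
  Num.max 0 x ^+ 2 - 2 * Num.max 0 (x - r) ^+ 2 + Num.max 0 (x - 2 * r) ^+ 2.
Definition tent r x : R :=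
  2 * (Num.max 0 x - 2 * Num.max 0 (x - r) + Num.max 0 (x - 2 * r)).

Lemma quad_derive_step r : quad_derive (step r) (tent r).
Proof.
have := quad_deriveD (quad_deriveD quad_derive_pos_sqr (quad_deriveZ (-2)
  (quad_derive_shift r quad_derive_pos_sqr)))
  (quad_derive_shift (2 * r) quad_derive_pos_sqr).
congr quad_derive; apply/funext => x; rewrite /step /tent; ring.
Qed.

Lemma step_le0 r x : 0 < r -> x <= 0 -> step r x = 0.
Proof.
move=> r0 x0; rewrite /step.
by do ![rewrite (@max_l _ _ 0); last by lra]; rewrite expr0n /=; ring.
Qed.

Lemma step_ge r x : 0 < r -> 2 * r <= x -> step r x = 2 * r ^+ 2.
Proof.
move=> r0 x0; rewrite /step.
by do ![rewrite (@max_r _ _ 0); last by lra]; ring.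
Qed.

Lemma tent_ge0 r x : 0 < r -> 0 <= tent r x.
Proof.
by move=> r0; rewrite /tent; case: (leP 0 x) => ?; case: (leP 0 (x - r)) => ?;
  case: (leP 0 (x - 2 * r)) => ?; lra.
Qed.

Lemma tent_eq0 r x : 0 < r -> ~~ (0 <= x <= 2 * r) -> tent r x = 0.
Proof.
move=> r0; rewrite /tent; case: (leP 0 x) => ? /=; case: (leP 0 (x - r)) => ?;
  case: (leP 0 (x - 2 * r)) => ? ?; lra.
Qed.

Lemma test_function_AC H phi : 0 < H -> test_function H phi ->
  [/\ ACon (- H) H phi (derive1 phi), cont_on (- H) H (derive1 phi),
      phi (- H) = 0 & phi H = 0].
Proof.
move=> H0 [dphi cphi [K [_ KH K0]]]; split; last 2 first.
- by apply: K0 => /KH; rewrite /dom /= in_itv /= ltxx.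
- by apply: K0 => /KH; rewrite /dom /= in_itv /= ltxx andbF.
- apply: AC_derive; last exact: continuous_cont_on.
  by move=> x _; rewrite derive1E; exact: DeriveDef.
- exact: continuous_cont_on.
Qed.

Lemma AC_weak_derivative H f g : 0 < H -> ACon (- H) H f g ->
  L2on (- H) H g -> is_weak_derivative H f g.
Proof.
move=> H0 fg gL; split=> [|phi]; first exact/L2P.
move=> /(test_function_AC H0)[phiAC cdphi phi0 phi1].
have cf := AC_cont_on fg; have cphi := AC_cont_on phiAC.
have i1 : intble (- H) H (fun y => f y * derive1 phi y).
  exact/cont_on_intble/cont_onM.
have i2 : intble (- H) H (fun y => g y * phi y).
  apply: eq_intble (intbleM_cont cphi fg.1) => y _; exact: mulrC.
rewrite /dom !Rintegral_itv_oo //.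
have [_ /(_ (- H) H (lexx _) _ (lexx _))] := AC_M fg phiAC.
rewrite phi0 phi1 !mulr0 subrr => /(_ ltac:(lra)) E.
apply/eqP; rewrite -addr_eq0 -intD // E; apply/eqP; apply: eq_int => x _.
by rewrite (mulrC (g x)).
Qed.

(** If [h x > h y], a test function rising after [x] and falling back after [y] gives a
    contradiction. Its derivative [psi] has integral zero, so [h] may be replaced by [h - m], which
    exceeds [e] on the first tent and is below [-e] on the second. *)
Lemma du_bois_reymond_le H h x y : cont_on (- H) H h ->
  (forall phi, test_function H phi ->
    Intg (- H) H (fun t => h t * derive1 phi t) = 0) ->
  - H < x -> x < y -> y < H -> h x <= h y.
Proof.
move=> ch hphi Hx xy yH; rewrite leNgt; apply/negP => hyx.
pose m := (h x + h y) / 2; pose e := (h x - h y) / 4.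
have e0 : 0 < e by rewrite /e; lra.
have [d1 d10 P1] := ch x ltac:(lra) e e0.
have [d2 d20 P2] := ch y ltac:(lra) e e0.
(* The tents have width [2 * r]: they fit where [h] varies by less than [e], and end before [H]. *)
pose r := Num.min (Num.min d1 d2 / 4) ((H - y) / 4).
have r0 : 0 < r by rewrite lt_min !divr_gt0 ?lt_min ?d10 ?d20 //= subr_gt0.
have rd : r <= Num.min d1 d2 / 4 by rewrite /r ge_min lexx.
have rd1 : r <= d1 / 4 by apply: le_trans rd _; rewrite ler_pM2r // ge_min lexx.
have rd2 : r <= d2 / 4.
  by apply: le_trans rd _; rewrite ler_pM2r // ge_min lexx orbT.
have rH : r <= (H - y) / 4 by rewrite /r ge_min lexx orbT.
pose phi t := step r (t - x) + -1 * step r (t - y).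
pose psi t := tent r (t - x) + -1 * tent r (t - y).
have qd : quad_derive phi psi.
  apply: quad_deriveD; first exact/quad_derive_shift/quad_derive_step.
  exact/quad_deriveZ/quad_derive_shift/quad_derive_step.
have dphi (t : R) : is_derive t 1 phi (psi t) by exact: quad_is_derive.
have phiE : derive1 phi = psi.
  by apply/funext => t; rewrite derive1E; exact: derive_val.
have cpsi := quad_continuous qd.
have phi0 (t : R) : ~ `[x, y + 2 * r]%classic t -> phi t = 0.
  rewrite /= in_itv /= => /negP; rewrite negb_and -!ltNge /phi => /orP[tx|ty].
    by rewrite !step_le0 //; lra.
  by rewrite !step_ge //; lra.
have tphi : test_function H phi.
  split=> //; first by rewrite phiE.
  exists `[x, y + 2 * r]%classic; split => //; first exact: segment_compact.
  by move=> t /=; rewrite /dom /= !in_itv /=; lra.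
have cont_tent (z : R) : cont_on (- H) H (fun t => tent r (t - z)).
  apply: continuous_cont_on.
  exact: quad_continuous (quad_derive_shift z (quad_derive_step r)).
have phiAC : ACon (- H) H phi psi.
  by apply: AC_derive => //; exact: continuous_cont_on.
have Ipsi : Intg (- H) H psi = 0.
  rewrite -(phiAC.2 (- H) H) ?lexx //; last by lra.
  by rewrite !phi0 ?subrr //= in_itv /=; lra.
have Itent : Intg (- H) H (fun t => tent r (t - x)) = 2 * r ^+ 2.
  have [] := @AC_derive _ (- H) H (fun t => step r (t - x)) _
    (fun t _ => quad_is_derive t (quad_derive_shift x (quad_derive_step r)))
    (cont_tent x).
  move=> _ /(_ (- H) H) <- //; last by lra.
  by rewrite step_ge // ?step_le0 ?subr0 //; lra.
have := hphi phi tphi; rewrite phiE => hpsi.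
have i0 : intble (- H) H psi by case: phiAC.
have i1 : intble (- H) H (fun t => h t * psi t) by exact: intbleM_cont.
have : Intg (- H) H (fun t => e * tent r (t - x)) <=
       Intg (- H) H (fun t => h t * psi t - m * psi t).
  apply: le_int => [||t tH].
  - exact/cont_on_intble/cont_onZ.
  - by apply: intbleB => //; exact: intbleZ.
  have -> : h t * psi t - m * psi t =
    (h t - m) * tent r (t - x) + (m - h t) * tent r (t - y) by rewrite /psi; ring.
  rewrite -[leLHS]addr0; apply: lerD.
    have [tx|/(tent_eq0 r0) ->] := boolP (0 <= t - x <= 2 * r); last by rewrite !mulr0.
    rewrite ler_wpM2r ?tent_ge0 //; have := P1 t tH; rewrite ger0_norm; last by lra.
    by move=> /(_ ltac:(lra)); rewrite ltr_norml /m /e; lra.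
  have [tx|/(tent_eq0 r0) ->] := boolP (0 <= t - y <= 2 * r); last by rewrite !mulr0.
  rewrite mulr_ge0 ?tent_ge0 //; have := P2 t tH; rewrite ger0_norm; last by lra.
  by move=> /(_ ltac:(lra)); rewrite ltr_norml /m /e; lra.
rewrite intB //; last exact: intbleZ.
rewrite (@intZ _ _ _ m) // (@intZ _ _ _ e); last exact: cont_on_intble.
by rewrite hpsi Ipsi Itent mulr0 subr0 leNgt (mulr_gt0 e0) // mulr_gt0 // exprn_gt0.
Qed.

(** [f] minus a primitive of [g] has zero weak derivative; the du Bois-Reymond inequality, applied
    to it and to its opposite, makes it constant. *)
Lemma weak_derivative_AC H f g : 0 < H -> cont_on (- H) H f ->
  is_weak_derivative H f g -> ACon (- H) H f g /\ L2on (- H) H g.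
Proof.
move=> H0 cf [/L2P gL fg]; split => //.
pose F x := Intg (- H) x g.
have gi := L2on_intble gL.
have FAC : ACon (- H) H F g.
  split => // x y px xy yq; rewrite /F (@int_cat _ (- H) x y) ?px //.
    by rewrite addrC addKr.
  exact: intble_sub gi.
have cF := AC_cont_on FAC.
have [_ Fg] := AC_weak_derivative H0 FAC gL.
pose h x := f x - F x.
have ch : cont_on (- H) H h by exact: cont_onB.
have hphi phi : test_function H phi ->
    Intg (- H) H (fun t => h t * derive1 phi t) = 0.
  move=> tphi; have [phiAC cdphi _ _] := test_function_AC H0 tphi.
  have := Fg phi tphi; rewrite -(fg phi tphi) /dom !Rintegral_itv_oo => [E||];
    try exact/cont_on_intble/cont_onM.
  rewrite (eq_int (g := fun t => f t * derive1 phi t - F t * derive1 phi t)).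
    by rewrite intB ?E ?subrr //; exact/cont_on_intble/cont_onM.
  by move=> x _; rewrite /h mulrBl.
have mono x y : - H < x -> x < y -> y < H -> h x = h y.
  move=> Hx xy yH; apply/eqP; rewrite eq_le (du_bois_reymond_le ch) //=.
  rewrite -lerN2; apply: (@du_bois_reymond_le H (fun t => - h t)) => //.
    exact: cont_onN.
  move=> phi tphi; have [phiAC cdphi _ _] := test_function_AC H0 tphi.
  rewrite (eq_int (g := fun t => -1 * (h t * derive1 phi t))); last first.
    by move=> t _; ring.
  by rewrite intZ ?hphi ?mulr0 //; exact/cont_on_intble/cont_onM.
have mono0 x : - H < x < H -> h x = h 0.
  move=> /andP[Hx xH]; have [x0|x0|-> //] := ltgtP x 0.
    by apply: mono => //; lra.
  by symmetry; apply: mono => //; lra.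
have hE x : - H <= x <= H -> h x = h 0.
  move=> xH; apply/eqP; rewrite -subr_eq0 -normr_le0; apply/ler_addgt0Pl => e e0.
  rewrite addr0; have [d d0 dP] := ch x xH e e0.
  (* Moving [x] towards 0 by a small proportion gives an interior point close to it, at both ends
     alike. *)
  pose t := Num.min 1 (d / (2 * H)); pose y := x * (1 - t / 2).
  have t0 : 0 < t by rewrite lt_min ltr01 divr_gt0 // mulr_gt0.
  have t1 : t <= 1 by rewrite ge_min lexx.
  have td : t * (2 * H) <= d.
    by rewrite -ler_pdivlMr ?mulr_gt0 // ge_min lexx orbT.
  have yH : - H < y < H by rewrite /y; nra.
  rewrite -(mono0 y yH) distrC; apply/ltW/dP; first by case/andP: yH => ? ?; rewrite !ltW.
  have -> : y - x = - (x * (t / 2)) by rewrite /y; ring.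
  by rewrite normrN ltr_norml; nra.
have := AC_D FAC (AC_cst (- H) H (h 0)).
apply: eq_AC => x xH /=; last by rewrite addr0.
by rewrite -(hE x xH) /h; ring.
Qed.

(** The difference, extended by zero, has zero integral up to every point; Lebesgue differentiation
    ([FTC1Ny]) makes it vanish a.e. *)
Lemma AC_ae_unique p q f g1 g2 : ACon p q f g1 -> ACon p q f g2 ->
  {ae mu, forall x, p <= x <= q -> g1 x = g2 x}.
Proof.
move=> [i1 h1] [i2 h2].
pose h := (fun x => g1 x - g2 x) \_ `[p, q].
have hi : mu.-integrable setT (EFin \o h).
  have := integrable_mkcond (mu := mu) (EFin \o (fun x => g1 x - g2 x))
    (D := `[p, q]%classic).
  rewrite restrict_EFin => mk; apply/mk; first exact: measurable_itv.
  exact: intbleB.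
have hloc : locally_integrable [set: R] h.
  by apply: open_integrable_locally => //; exact: openT.
have hy y : mu.-integrable `]-oo, y] (EFin \o h) by exact: integrableS hi.
have F0 y : \int[mu]_(t in `]-oo, y]) h t = 0.
  rewrite -Rintegral_mkcondr.
  have -> : `]-oo, y] `&` `[p, q] = `[p, Num.min y q]%classic.
    apply/seteqP; split => x /=; rewrite !in_itv /= le_min; first by case; lra.
    by split; lra.
  have [py|] := leP p (Num.min y q); last first.
    by move=> yp; rewrite set_itv_ge ?Rintegral_set0 // bnd_simp -ltNge.
  have yq : Num.min y q <= q by rewrite ge_min lexx orbT.
  rewrite -/(Intg p (Num.min y q) _) intB; last 2 first.
    exact: intble_sub i1. exact: intble_sub i2.
  by rewrite -h1 // -h2 // subrr.
have := FTC1Ny hy hloc; apply: ae_impl => x [_].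
have -> : (fun x => \int[mu]_(t in `]-oo, x]) h t) = cst 0.
  by apply/funext => y; exact: F0.
rewrite derive1_cst /h patchE => + xpq; rewrite mem_set ?in_itv //= => /esym/eqP.
by rewrite subr_eq0 => /eqP.
Qed.

Lemma H1_AC H f : 0 < H -> H1 H f ->
  ACon (- H) H f (weak_derivative H f) /\ L2on (- H) H (weak_derivative H f).
Proof.
move=> H0 [/cont_onP cf _ [g gw]]; apply: weak_derivative_AC => //.
by apply: (@xgetPex _ (cst 0) [set g | is_weak_derivative H f g]); exists g.
Qed.

Lemma AC_H1 H f g : 0 < H -> ACon (- H) H f g -> L2on (- H) H g -> H1 H f.
Proof.
move=> H0 fg gL; split; first exact/cont_onP/AC_cont_on/fg.
  exact/L2P/cont_on_L2on/AC_cont_on/fg.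
by exists g; exact: AC_weak_derivative.
Qed.

Lemma weak_derivative_ae H f g : 0 < H -> ACon (- H) H f g -> L2on (- H) H g ->
  {ae mu, forall x, - H <= x <= H -> weak_derivative H f x = g x}.
Proof.
move=> H0 fg gL; have [fAC _] := H1_AC H0 (AC_H1 H0 fg gL).
exact: AC_ae_unique fAC fg.
Qed.

End weak_derivatives.

(** * One-sided limits of a function whose cube has bounded variation *)

Section one_sided_limits.
Context {R : realType}.
Implicit Types (p q x y c l : R) (f g h : R -> R).

Local Notation mu := (@lebesgue_measure R).

Definition rlim f y l := forall e, 0 < e ->
  exists2 d, 0 < d & forall x, y < x < y + d -> `|f x - l| < e.
Definition llim f y l := forall e, 0 < e ->
  exists2 d, 0 < d & forall x, y - d < x < y -> `|f x - l| < e.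

Lemma rlim_right_limit f y l : rlim f y l -> right_limit f y = l.
Proof.
move=> fl; apply/cvg_lim => //; apply/cvgrPdist_lt => e e0.
have [d d0 dP] := fl e e0; exists d => // x; rewrite /ball_ /= => yx xy.
rewrite distrC; apply: dP; rewrite xy /=; move: yx.
by rewrite distrC ger0_norm ?subr_ge0 ?ltW // ltrBlDl.
Qed.

Lemma llim_left_limit f y l : llim f y l -> left_limit f y = l.
Proof.
move=> fl; apply/cvg_lim => //; apply/cvgrPdist_lt => e e0.
have [d d0 dP] := fl e e0; exists d => // x; rewrite /ball_ /= => yx xy.
rewrite distrC; apply: dP; rewrite xy andbT; move: yx.
by rewrite ger0_norm ?subr_ge0 ?ltW // ltrBlDr ltrBlDl addrC.
Qed.

Lemma rlimN f y l : rlim f y l -> rlim (fun x => - f x) y (- l).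
Proof.
move=> fl e e0; have [d d0 dP] := fl e e0; exists d => // x xd.
by rewrite -opprD normrN; exact: dP.
Qed.

Lemma rlim_llim f y l : rlim (fun x => f (- x)) (- y) l -> llim f y l.
Proof.
move=> fl e e0; have [d d0 dP] := fl e e0; exists d => // x xd.
by have := dP (- x); rewrite opprK; apply; lra.
Qed.

Lemma rlimD f g y l m : rlim f y l -> rlim g y m ->
  rlim (fun x => f x + g x) y (l + m).
Proof.
move=> fl gm e e0.
have [d d0 dP] := fl (e / 2) ltac:(lra).
have [d' d'0 dP'] := gm (e / 2) ltac:(lra).
exists (Num.min d d'); first by rewrite lt_min d0.
move=> x; rewrite -ltrBlDl lt_min => /and3P[yx xd xd'].
have := dP x ltac:(lra); have := dP' x ltac:(lra).
by rewrite !ltr_norml; lra.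
Qed.

Lemma nondecreasing_rlim f y : {homo f : x y / x <= y} -> exists l, rlim f y l.
Proof.
move=> fh; pose A := f @` [set x | y < x].
have A0 : A !=set0 by exists (f (y + 1)), (y + 1) => //=; rewrite ltrDl.
have Alb : has_lbound A by exists (f y) => _ [x /= yx <-]; apply/fh/ltW.
exists (inf A) => e e0; have [_ [z /= yz <-] fz] := inf_adherent e0 (conj A0 Alb).
exists (z - y); first by rewrite subr_gt0.
move=> x; rewrite subrKC => /andP[yx xz].
have Ax : inf A <= f x by apply: ge_inf => //; exists x.
by rewrite ger0_norm ?subr_ge0 // ltrBlDl (le_lt_trans _ fz) // fh // ltW.
Qed.

(** [4 (x^2 + x y + y^2) - (x - y)^2 = 3 (x + y)^2]. This Hölder continuity of the cube root carries
    limits of the cube over to the function. *)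
Lemma cube_dist x y : `|x - y| ^+ 3 <= 4 * `|x ^+ 3 - y ^+ 3|.
Proof.
have -> : x ^+ 3 - y ^+ 3 = (x - y) * (x ^+ 2 + x * y + y ^+ 2) by ring.
rewrite normrM exprS [leRHS]mulrCA ler_wpM2l // real_normK ?num_real //.
have sq := sqr_ge0 (x + y); have sx := sqr_ge0 x; have sy := sqr_ge0 y.
by rewrite ger0_norm; nra.
Qed.

Lemma rlim_cube f y l : rlim (fun x => f x ^+ 3) y (l ^+ 3) -> rlim f y l.
Proof.
move=> fl e e0; have [d d0 dP] := fl (e ^+ 3 / 4) ltac:(by rewrite divr_gt0 ?exprn_gt0).
exists d => // x /dP; rewrite ltr_pdivlMr // mulrC => /(le_lt_trans (cube_dist _ _)).
by rewrite ltr_pXn2r ?nnegrE ?normr_ge0 ?(ltW e0).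
Qed.

Definition cbrt x : R := if 0 <= x then x `^ 3^-1 else - (- x) `^ 3^-1.

Lemma cbrtK x : cbrt x ^+ 3 = x.
Proof.
have pos z : 0 <= z -> (z `^ 3^-1) ^+ 3 = z.
  by move=> z0; rewrite -powR_mulrn ?powR_ge0 // -powRrM mulVf // powRr1.
rewrite /cbrt; case: leP => [/pos //|x0].
have -> : forall z : R, (- z) ^+ 3 = - z ^+ 3 by move=> z; ring.
by rewrite pos ?opprK // oppr_ge0 ltW.
Qed.

Lemma cube_inj x y : x ^+ 3 = y ^+ 3 -> x = y.
Proof.
move=> xy; apply/eqP; rewrite -subr_eq0 -normr_le0 leNgt; apply/negP => h.
have := cube_dist x y; rewrite xy subrr normr0 mulr0 leNgt exprn_gt0 //.
Qed.

Lemma cbrt_nondecreasing : {homo cbrt : x y / x <= y}.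
Proof.
move=> x y; apply: contraLR; rewrite -!ltNge => yx.
rewrite -(cbrtK x) -(cbrtK y); set s := cbrt x in yx *; set t := cbrt y in yx *.
rewrite -subr_gt0.
have -> : s ^+ 3 - t ^+ 3 = (s - t) * (s ^+ 2 + s * t + t ^+ 2) by ring.
rewrite mulr_gt0 ?subr_gt0 //.
have := sqr_ge0 (s + t); have := sqr_ge0 s; have := sqr_ge0 t.
have : 0 < (s - t) ^+ 2 by rewrite exprn_gt0 // subr_gt0.
nra.
Qed.

(** By Jordan decomposition the cube is a difference of nondecreasing functions, which are
    measurable and have one-sided limits; both properties pass through the cube root. *)
Lemma bounded_variation_cube p q f : p <= q ->
  bounded_variation p q (fun x => f x ^+ 3) ->
  [/\ measurable_fun `[p, q] f,
      exists M, forall x, p <= x <= q -> `|f x| <= M,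
      forall y, p <= y < q -> exists l, rlim f y l &
      forall y, p < y <= q -> exists l, llim f y l].
Proof.
(* Clamping to [[p, q]] makes both variations nondecreasing on the whole line, so that the end
   points are not special. *)
move=> pq BV; pose cl x := Num.max p (Num.min q x).
have clE x : p <= x <= q -> cl x = x.
  by case/andP => px xq; rewrite /cl min_r // max_r.
have clpq x : cl x \in `[p, q].
  by rewrite in_itv /= le_max lexx /= ge_max pq ge_min lexx.
have clh : {homo cl : x y / x <= y}.
  move=> x y xy; rewrite /cl ge_max !le_max lexx /=; apply/orP; right.
  by rewrite le_min !ge_min lexx xy orbT.
pose P x := fine (pos_tv p (fun x => f x ^+ 3) (cl x)).
pose N x := fine (neg_tv p (fun x => f x ^+ 3) (cl x)).
have Nh : {homo N : x y / x <= y}.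
  by move=> x y xy; apply: (fine_neg_tv_nondecreasing BV) => //; exact: clh.
have Ph : {homo P : x y / x <= y}.
  move=> x y xy; rewrite /P /pos_tv.
  apply: (fine_neg_tv_nondecreasing (a := p) (b := q)) => //; last exact: clh.
  exact/bounded_variationN.
have fE x : p <= x <= q -> f x ^+ 3 = P x - N x.
  move=> xpq; have := bounded_variation_pos_neg_tvE BV.
  by move=> /(_ x); rewrite in_itv /= => /(_ xpq) ->; rewrite /P /N clE.
have PNlim y : exists l, rlim (fun x => P x - N x) y (l ^+ 3).
  have [l Pl] := nondecreasing_rlim y Ph; have [m Nm] := nondecreasing_rlim y Nh.
  by exists (cbrt (l - m)); rewrite cbrtK; exact: rlimD (rlimN Nm).
have PNlim' y : exists l, llim (fun x => P x - N x) y (l ^+ 3).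
  (* Left limits are right limits after the reflection of the line; the outer minus keeps the
     functions nondecreasing. *)
  have Ph' : {homo (fun x => - P (- x)) : x y / x <= y}.
    by move=> x y' xy; rewrite lerN2 Ph // lerN2.
  have Nh' : {homo (fun x => - N (- x)) : x y / x <= y}.
    by move=> x y' xy; rewrite lerN2 Nh // lerN2.
  have [l Pl] := nondecreasing_rlim (- y) Ph'.
  have [m Nm] := nondecreasing_rlim (- y) Nh'.
  exists (cbrt (- l + m)); rewrite cbrtK; apply: rlim_llim.
  have := rlimD (rlimN Pl) Nm.
  by congr rlim; apply/funext => x; rewrite opprK.
have mP : measurable_fun `[p, q] P by exact: nondecreasing_measurable.
have mN : measurable_fun `[p, q] N by exact: nondecreasing_measurable.
split.
- apply: (@eq_measurable_fun _ _ _ _ _ (cbrt \o (fun x => P x - N x))).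
    move=> x; rewrite inE /= in_itv /= => xpq; apply: cube_inj.
    by rewrite cbrtK fE.
  apply: measurableT_comp; last exact: measurable_funB.
  by apply: nondecreasing_measurable => //; exact: cbrt_nondecreasing.
- pose M := `|P p| + `|P q| + (`|N p| + `|N q|).
  exists (1 + M) => x xpq; have [px xq] := andP xpq.
  have M0 : 0 <= M by rewrite !addr_ge0.
  have bd : `|f x ^+ 3| <= M.
    rewrite fE //; apply: le_trans (ler_normB _ _) _; apply: lerD.
      have := Ph _ _ px; have := Ph _ _ xq.
      have := ler_norm (P q); have := ler_norm (- P p); rewrite normrN.
      have := normr_ge0 (P p); have := normr_ge0 (P q); rewrite ler_norml; lra.
    have := Nh _ _ px; have := Nh _ _ xq.
    have := ler_norm (N q); have := ler_norm (- N p); rewrite normrN.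
    have := normr_ge0 (N p); have := normr_ge0 (N q); rewrite ler_norml; lra.
  rewrite leNgt; apply/negP => h; have := bd; rewrite normrX leNgt => /negP; apply.
  have : `|f x| <= `|f x| ^+ 3 by apply: ler_eXnr => //; lra.
  lra.
- move=> y /andP[py yq]; have [l h] := PNlim y; exists l; apply: rlim_cube => e e0.
  have [d d0 dP] := h e e0; exists (Num.min d (q - y)).
    by rewrite lt_min d0 subr_gt0.
  move=> x; rewrite -ltrBlDl lt_min => xy; rewrite fE; last by lra.
  by apply: dP; lra.
- move=> y /andP[py yq]; have [l h] := PNlim' y; exists l.
  apply: rlim_llim; apply: rlim_cube => e e0.
  have [d d0 dP] := h e e0; exists (Num.min d (y - p)).
    by rewrite lt_min d0 subr_gt0.
  move=> x; rewrite -ltrBlDl lt_min => xy; rewrite fE; last by lra.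
  by apply: dP; lra.
Qed.

Lemma ae_exists (P : R -> Prop) p q : {ae mu, forall x, P x} -> p < q ->
  exists2 x, p < x < q & P x.
Proof.
move=> [N [mN N0 PN]] pq; apply: contrapT => h.
have sub : `]p, q[%classic `<=` N.
  move=> x /=; rewrite in_itv /= => xpq; apply: PN => Px; apply: h; by exists x.
have : (mu `]p, q[%classic <= mu N)%E by apply: le_measure; rewrite ?inE.
by rewrite N0 lebesgue_measure_itv /= lte_fin pq -EFinB lee_fin subr_le0 leNgt pq.
Qed.

End one_sided_limits.

(** * Pointwise consequences of |u| = 1 *)

Section admissible_fields.
Context {R : realType}.
Implicit Types (x y d e l : R).
Context (H a : R) (u : R -> R * R) (H0 : 0 < H) (uA0 : A0 H a u).

Local Notation mu := (@lebesgue_measure R).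
Local Notation f := (comp1 u).
Local Notation v := (comp2 u).

Local Ltac hlra := move: (H0); lra.

(* |u_1| = sinus y at almost every y, since |u| = 1. *)
Definition sinus (y : R) : R := Num.sqrt (1 - v y ^+ 2).

Lemma A0_AC2 : ACon (- H) H v (weak_derivative H v) /\
  L2on (- H) H (weak_derivative H v).
Proof. by case: uA0 => _ h _ _ _; exact: H1_AC. Qed.

Lemma A0_cont2 : cont_on (- H) H v.
Proof. exact: AC_cont_on A0_AC2.1. Qed.

Lemma A0_sphere : {ae mu, forall x, - H < x < H -> f x ^+ 2 + v x ^+ 2 = 1}.
Proof.
case: uA0 => _ _ _ _; apply: ae_impl => x h xH.
have : dom H x by rewrite /dom /= in_itv.
move=> /h; rewrite /enorm => /(congr1 (fun t => t ^+ 2)).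
by rewrite sqr_sqrtr ?expr1n // addr_ge0 ?sqr_ge0.
Qed.

Lemma A0_sphere_near x d : - H <= x <= H -> 0 < d ->
  exists2 y, - H < y < H /\ `|y - x| < d & f y ^+ 2 + v y ^+ 2 = 1.
Proof.
move=> xH d0.
have pq : Num.max (- H) (x - d) < Num.min H (x + d).
  rewrite gt_max !lt_min.
by apply/andP; split; apply/andP; split; hlra.
have [y] := ae_exists A0_sphere pq; rewrite gt_max lt_min => yP h.
exists y; last by apply: h; hlra.
by split; [hlra|rewrite ltr_norml; hlra].
Qed.

(** The constraint holds only a.e., but at points arbitrarily near [x], and [v] is continuous. *)
Lemma A0_le1 x : - H <= x <= H -> v x ^+ 2 <= 1.
Proof.
move=> xH; apply/ler_addgt0Pl => e e0.
have [d d0 dP] := cont_onX 2 A0_cont2 xH e0.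
have [y [yH yx] h] := A0_sphere_near xH d0.
have := dP y ltac:(hlra) yx; rewrite ltr_norml; have := sqr_ge0 (f y); hlra.
Qed.

Lemma sinus_ge0 x : 0 <= sinus x. Proof. exact: sqrtr_ge0. Qed.

Lemma sinus_sqr x : - H <= x <= H -> sinus x ^+ 2 = 1 - v x ^+ 2.
Proof. by move=> xH; rewrite sqr_sqrtr // subr_ge0 A0_le1. Qed.

Lemma sinus_le1 x : sinus x <= 1.
Proof.
by rewrite -sqrtr1 ler_wsqrtr // lerBlDr lerDl sqr_ge0.
Qed.

Lemma cont_on_sinus : cont_on (- H) H sinus.
Proof.
have := cont_onB (@cont_on_cst _ (- H) H 1) (cont_onX 2 A0_cont2).
move=> /cont_onP/subspace_continuousP cs; apply/cont_onP/subspace_continuousP.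
move=> x xH; exact: (cvg_comp _ _ (cs x xH) (@sqrt_continuous R _)).
Qed.

Lemma sinus_powR y : - H <= y <= H -> (1 - v y ^+ 2) `^ (3 / 2) = sinus y ^+ 3.
Proof.
move=> yH; have h : 0 <= 1 - v y ^+ 2 by rewrite subr_ge0 A0_le1.
rewrite /sinus -powR12_sqrt // -[RHS]powR_mulrn ?powR_ge0 // -powRrM.
by congr (_ `^ _); field.
Qed.

(** Points of the circle with [f] near [l] and [v] near [v y] force [l^2 + (v y)^2 = 1]; this serves
    limits from either side. *)
Lemma eq_sinus y l : - H <= y <= H -> (forall e, 0 < e ->
    exists2 x, - H <= x <= H /\ `|f x - l| < e & `|v x - v y| < e /\
      f x ^+ 2 + v x ^+ 2 = 1) -> l = sinus y \/ l = - sinus y.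
Proof.
move=> yH h; suff /eqP : l ^+ 2 = sinus y ^+ 2.
  by rewrite eqf_sqr => /orP[/eqP|/eqP]; [left|right].
rewrite sinus_sqr //; apply/eqP; rewrite -subr_eq0 -normr_le0.
apply/ler_addgt0Pl => e e0; rewrite addr0.
(* [K] is the sum of the bounds [2 * |l| + 1] for [|l + f x|] and 3 for [|v y + v x|]. *)
pose K := 2 * `|l| + 4; have K0 : 0 < K by rewrite ltr_wpDl ?mulr_ge0.
have [x [xH xl] [xv x1]] := h (Num.min 1 (e / K)) ltac:(by rewrite lt_min ltr01 divr_gt0).
have -> : l ^+ 2 - (1 - v y ^+ 2) =
    (l - f x) * (l + f x) + (v y - v x) * (v y + v x) by rewrite -x1; ring.
apply: le_trans (ler_normD _ _) _; rewrite !normrM.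
move: xl xv; rewrite !lt_min => /andP[fl1 fle] /andP[vv1 vve].
have n1 : `|l + f x| <= 2 * `|l| + 1.
  have -> : l + f x = (f x - l) + 2 * l by ring.
  apply: le_trans (ler_normD _ _) _; rewrite normrM (ger0_norm (_ : 0 <= 2)) //.
  by hlra.
have n2 : `|v y + v x| <= 3.
  have -> : v y + v x = (v x - v y) + 2 * v y by ring.
  apply: le_trans (ler_normD _ _) _; rewrite normrM (ger0_norm (_ : 0 <= 2)) //.
  have : `|v y| <= 1 by rewrite -(@ler_pXn2r _ 2) ?nnegrE // expr1n real_normK ?num_real // A0_le1.
  by hlra.
have -> : e = e / K * (2 * `|l| + 1) + e / K * 3.
  by rewrite /K; field; rewrite gt_eqF.
by rewrite (distrC l) (distrC (v y)); apply: lerD; apply: ler_pM => //; exact: ltW.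
Qed.

Let BVf : [/\ measurable_fun `[- H, H] f,
      exists M, forall x, - H <= x <= H -> `|f x| <= M,
      forall y, - H <= y < H -> exists l, rlim f y l &
      forall y, - H < y <= H -> exists l, llim f y l].
Proof. by apply: bounded_variation_cube; [hlra|case: uA0]. Qed.

Lemma A0_L2on1 : L2on (- H) H f.
Proof.
case: BVf => mf [M fM] _ _.
by apply: le_L2on mf fM _; apply: cont_on_L2on; exact: cont_on_cst.
Qed.

Lemma A0_rlim y : - H <= y < H ->
  exists2 l, rlim f y l & l = sinus y \/ l = - sinus y.
Proof.
move=> yH; case: BVf => _ _ /(_ y yH)[l fl] _; exists l => //.
apply: eq_sinus => [|e e0]; first by hlra.
have [d d0 dP] := fl e e0.
have [d' d'0 dP'] := A0_cont2 (x := y) ltac:(hlra) e0.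
have pq : y < Num.min H (Num.min (y + d) (y + d')) by rewrite !lt_min; hlra.
have [x] := ae_exists A0_sphere pq; rewrite !lt_min => xP h.
exists x; first by split; [hlra|apply: dP; hlra].
by split; [apply: dP'; [hlra|rewrite ltr_norml; hlra]|apply: h; hlra].
Qed.

Lemma A0_llim y : - H < y <= H ->
  exists2 l, llim f y l & l = sinus y \/ l = - sinus y.
Proof.
move=> yH; case: BVf => _ _ _ /(_ y yH)[l fl]; exists l => //.
apply: eq_sinus => [|e e0]; first by hlra.
have [d d0 dP] := fl e e0.
have [d' d'0 dP'] := A0_cont2 (x := y) ltac:(hlra) e0.
have pq : Num.max (- H) (Num.max (y - d) (y - d')) < y by rewrite !gt_max; hlra.
have [x] := ae_exists A0_sphere pq; rewrite !gt_max => xP h.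
exists x; first by split; [hlra|apply: dP; hlra].
by split; [apply: dP'; [hlra|rewrite ltr_norml; hlra]|apply: h; hlra].
Qed.

End admissible_fields.

(** * The energy and the cost of one transition *)

Section energy.
Context {R : realType}.
Implicit Types (p q x y c H L eps r : R) (f g v : R -> R).

Local Notation mu := (@lebesgue_measure R).

Definition density L eps f g1 v g2 : R -> R := fun y =>
  eps * (g1 y ^+ 2 + g2 y ^+ 2) + eps^-1 * (f y ^+ 2 + v y ^+ 2 - 1) ^+ 2
  + L * g2 y ^+ 2.

Lemma density_intble p q L eps f g1 v g2 : cont_on p q f -> cont_on p q v ->
  L2on p q g1 -> L2on p q g2 -> intble p q (density L eps f g1 v g2).
Proof.
move=> cf cv [_ g1L] [_ g2L]; apply: intbleD; last exact: intbleZ.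
apply: intbleD; first exact/intbleZ/intbleD.
apply/cont_on_intble/cont_onZ/cont_onX/cont_onB; last exact: cont_on_cst.
by apply: cont_onD; exact: cont_onX.
Qed.

Lemma enorm_sqr (w : R * R) : enorm w ^+ 2 = w.1 ^+ 2 + w.2 ^+ 2.
Proof. by rewrite sqr_sqrtr // addr_ge0 ?sqr_ge0. Qed.

(** Weak derivatives are unique a.e., so any derivatives [g1], [g2] in L^2 compute the energy, which
    is then a real number. *)
Lemma E1D_AC H L eps (w : R -> R * R) g1 g2 : 0 < H ->
  ACon (- H) H (comp1 w) g1 -> L2on (- H) H g1 ->
  ACon (- H) H (comp2 w) g2 -> L2on (- H) H g2 ->
  E1D H L eps w =
  (2^-1 * Intg (- H) H (density L eps (comp1 w) g1 (comp2 w) g2))%:E.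
Proof.
move=> H0 w1 g1L w2 g2L.
set d1 := weak_derivative H (comp1 w); set d2 := weak_derivative H (comp2 w).
have cw1 := AC_cont_on w1; have cw2 := AC_cont_on w2.
have [w1' d1L] := H1_AC H0 (AC_H1 H0 w1 g1L).
have [w2' d2L] := H1_AC H0 (AC_H1 H0 w2 g2L).
have di := @density_intble _ _ L eps _ _ _ _ cw1 cw2 d1L d2L.
have -> : Intg (- H) H (density L eps (comp1 w) g1 (comp2 w) g2) =
    Intg (- H) H (density L eps (comp1 w) d1 (comp2 w) d2).
  have gi := @density_intble _ _ L eps _ _ _ _ cw1 cw2 g1L g2L.
  apply: (ae_eq_int (intble_measurable gi) di _).2.
  apply: ae_impl (ae_and (weak_derivative_ae H0 w1 g1L)
    (weak_derivative_ae H0 w2 g2L)) => x [e1 e2] xH.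
  by rewrite /density /d1 /d2 e1 // e2.
rewrite EFinM -integral_itv_oo // /E1D -/d1 -/d2; congr (_ * _)%E.
apply: eq_integral => y _; rewrite enorm_sqr enorm_sqr; congr (_%:E).
Qed.

(* A primitive of the double-well profile (r^2 - z^2)_+ . *)
Definition well_primitive r z : R :=
  let c := Num.max (- r) (Num.min r z) in r ^+ 2 * c - c ^+ 3 / 3.

(** The profile is Lipschitz, so the remainder of its primitive is quadratic; [3 * r] adds the
    constants of [cube_bound] and [cross_bound]. The nine cases place [x] and [y] below, above or
    inside [[-r, r]]. *)
Lemma quad_derive_well r : 0 < r ->
  quad_derive (well_primitive r) (fun z => Num.max 0 (r ^+ 2 - z ^+ 2)).
Proof.
move=> r0; exists (3 * r); first by rewrite mulr_gt0.
move=> x y; rewrite /well_primitive ler_norml.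
have sq z : r ^+ 2 - z ^+ 2 = (r - z) * (r + z) by ring.
have inside z : - r <= z -> z <= r -> Num.max 0 (r ^+ 2 - z ^+ 2) = r ^+ 2 - z ^+ 2.
  by move=> h1 h2; rewrite max_r // sq mulr_ge0 //; lra.
have above z : r <= z -> Num.max 0 (r ^+ 2 - z ^+ 2) = 0.
  by move=> h1; rewrite max_l // sq; nra.
have below z : z <= - r -> Num.max 0 (r ^+ 2 - z ^+ 2) = 0.
  by move=> h1; rewrite max_l // sq; nra.
have cin z : - r <= z -> z <= r -> Num.max (- r) (Num.min r z) = z.
  by move=> h1 h2; rewrite min_r // max_r.
have cab z : r <= z -> Num.max (- r) (Num.min r z) = r.
  by move=> h1; rewrite min_l // max_r //; lra.
have cbe z : z <= - r -> Num.max (- r) (Num.min r z) = - r.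
  by move=> h1; rewrite min_r ?max_l //; lra.
(* [r * d^2 - d^3 / 3] is the integral of [r^2 - z^2] over the segment of length [d] inside
   [[-r, r]] from one of its ends; [2 * r * d - d^2] below is the value at distance [d] from that
   end. *)
have cube_bound d D : 0 <= d -> d <= 2 * r -> d <= D ->
    0 <= r * d ^+ 2 - d ^+ 3 / 3 /\ r * d ^+ 2 - d ^+ 3 / 3 <= r * D ^+ 2.
  move=> d0 dr dD; have d2 := sqr_ge0 d.
  have dD2 : d ^+ 2 <= D ^+ 2 by rewrite lerXn2r ?nnegrE //; lra.
  have h1 : 0 <= d ^+ 2 * (3 * r - d) by rewrite mulr_ge0 //; lra.
  have h2 : 0 <= d ^+ 2 * d by rewrite mulr_ge0.
  have h3 : 0 <= r * (D ^+ 2 - d ^+ 2) by rewrite mulr_ge0 ?subr_ge0 // ltW.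
  by rewrite exprS mulrC; split; lra.
have cross_bound d D : 0 <= d -> d <= 2 * r -> d <= D ->
    0 <= (2 * r * d - d ^+ 2) * D /\ (2 * r * d - d ^+ 2) * D <= 2 * r * D ^+ 2.
  move=> d0 dr dD; have D0 : 0 <= D by lra.
  have -> : 2 * r * d - d ^+ 2 = d * (2 * r - d) by ring.
  split; first by rewrite !mulr_ge0 // subr_ge0.
  rewrite expr2 !mulrA ler_wpM2r // mulrC ler_pM ?subr_ge0 //.
  by rewrite lerBlDr lerDl.
have DD : 0 <= r * (y - x) ^+ 2 by rewrite mulr_ge0 ?sqr_ge0 // ltW.
have tot (z w : R) : z <= w \/ w < z by case: leP => _; [left|right].
have [xl|xl] := tot x (- r); [|have [xr|xr] := tot r x];
  (have [yl|yl] := tot y (- r); [|have [yr|yr] := tot r y]).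
- by rewrite below // !cbe //; apply/andP; split; lra.
- have [] := cube_bound (2 * r) (y - x) ltac:(lra) ltac:(lra) ltac:(lra).
  rewrite below // (cbe x) // (cab y) // => *; apply/andP; split; lra.
- have [] := cube_bound (r + y) (y - x) ltac:(lra) ltac:(lra) ltac:(lra).
  by rewrite below // (cbe x) // (cin y (ltW yl) (ltW yr)) => *; apply/andP; split; lra.
- have [] := cube_bound (2 * r) (x - y) ltac:(lra) ltac:(lra) ltac:(lra).
  by rewrite above // (cab x) // (cbe y) // => *; apply/andP; split; lra.
- by rewrite above // !cab //; apply/andP; split; lra.
- have [] := cube_bound (r - y) (x - y) ltac:(lra) ltac:(lra) ltac:(lra).
  by rewrite above // (cab x) // (cin y (ltW yl) (ltW yr)) => *; apply/andP; split; lra.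
- have [] := cube_bound (r + x) (x - y) ltac:(lra) ltac:(lra) ltac:(lra).
  have [] := cross_bound (r + x) (x - y) ltac:(lra) ltac:(lra) ltac:(lra).
  by rewrite (inside x (ltW xl) (ltW xr)) (cin x (ltW xl) (ltW xr)) (cbe y) // => *; apply/andP; split; lra.
- have [] := cube_bound (r - x) (y - x) ltac:(lra) ltac:(lra) ltac:(lra).
  have [] := cross_bound (r - x) (y - x) ltac:(lra) ltac:(lra) ltac:(lra).
  by rewrite (inside x (ltW xl) (ltW xr)) (cin x (ltW xl) (ltW xr)) (cab y) // => *; apply/andP; split; lra.
- rewrite (inside x (ltW xl) (ltW xr)) (cin x (ltW xl) (ltW xr)).
  rewrite (cin y (ltW yl) (ltW yr)).
  have -> : r ^+ 2 * y - y ^+ 3 / 3 - (r ^+ 2 * x - x ^+ 3 / 3)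
      - (r ^+ 2 - x ^+ 2) * (y - x) = - ((y - x) ^+ 2 * ((y + 2 * x) / 3)) by field.
  rewrite -mulNr mulrC -mulrN.
  have D2 := sqr_ge0 (y - x); apply/andP; split; nra.
Qed.

(* AM-GM trades the two terms of the energy for |g (f^2 + v^2 - 1)|, which
   dominates the derivative of a primitive of (r^2 - z^2)_+ along f. *)
Lemma transition_cost p q eps r sg f g v : 0 < eps -> 0 < r -> p <= q ->
  ACon p q f g -> L2on p q g -> cont_on p q v ->
  (forall x, p <= x <= q -> r ^+ 2 <= 1 - v x ^+ 2) ->
  sg ^+ 2 = 1 -> sg * f p <= - r -> r <= sg * f q ->
  4 / 3 * r ^+ 3 <= 2^-1 * Intg p q (fun x =>
    eps * g x ^+ 2 + eps^-1 * (f x ^+ 2 + v x ^+ 2 - 1) ^+ 2).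
Proof.
move=> eps0 r0 pq fg gL cv rv sg1 fp fq.
have qd := quad_derive_well r0.
pose phi z := Num.max 0 (r ^+ 2 - z ^+ 2).
have cphi0 : continuous phi by exact: quad_continuous qd.
have sfg := AC_Z sg fg.
have csf := AC_cont_on sfg.
have cphi : cont_on p q (fun x => phi (sg * f x)).
  move: csf => /cont_onP/subspace_continuousP csf.
  apply/cont_onP/subspace_continuousP => x xpq.
  apply: (@cvg_comp _ _ _ (fun x => sg * f x) phi _ _ _ (csf x xpq)).
  exact: cphi0.
have FAC : ACon p q (fun x => well_primitive r (sg * f x))
    (fun x => phi (sg * f x) * (sg * g x)).
  apply: AC_chain_quadratic sfg cphi _ => x xpq.
  by case: qd => K K0 KP; exists K => // y _; exact: KP.
have := FAC.2 p q (lexx _) pq (lexx _).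
have -> : well_primitive r (sg * f q) = 2 / 3 * r ^+ 3.
  by rewrite /well_primitive min_l // max_r; [field|lra].
have -> : well_primitive r (sg * f p) = - (2 / 3 * r ^+ 3).
  by rewrite /well_primitive min_r; [rewrite max_l //; field|lra].
move=> E; have -> : 4 / 3 * r ^+ 3 = 2 / 3 * r ^+ 3 - - (2 / 3 * r ^+ 3) by field.
have cf := AC_cont_on fg.
have di : intble p q (fun x =>
    eps * g x ^+ 2 + eps^-1 * (f x ^+ 2 + v x ^+ 2 - 1) ^+ 2).
  apply: intbleD; first exact: intbleZ gL.2.
  apply/cont_on_intble/cont_onZ/cont_onX/cont_onB; last exact: cont_on_cst.
  by apply: cont_onD; exact: cont_onX.
rewrite {}E -intZ //; apply: le_int => [||x xpq]; [exact: FAC.1|exact: intbleZ|].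
set W := f x ^+ 2 + _ - 1; set ph := phi _.
(* Since [r^2 <= 1 - v^2], [r^2 - f^2] is at most [- W]; where it is negative, [ph] vanishes. *)
have phW : ph ^+ 2 <= W ^+ 2.
  rewrite /ph /phi exprMn sg1 mul1r /W; have := rv x xpq.
  case: (leP 0 (r ^+ 2 - f x ^+ 2)) => [h1 h2|_ _]; last by rewrite expr0n sqr_ge0.
  by rewrite -(sqrrN (_ - 1)) lerXn2r ?nnegrE //; lra.
have key : 0 <= eps^-1 * (eps * (sg * g x) - ph) ^+ 2.
  by rewrite mulr_ge0 ?sqr_ge0 // invr_ge0 ltW.
have E : eps^-1 * (eps * (sg * g x) - ph) ^+ 2 =
    eps * g x ^+ 2 - 2 * (ph * (sg * g x)) + eps^-1 * ph ^+ 2.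
  rewrite (_ : g x ^+ 2 = sg ^+ 2 * g x ^+ 2); last by rewrite sg1 mul1r.
  by field; rewrite gt_eqF.
have : eps^-1 * ph ^+ 2 <= eps^-1 * W ^+ 2 by rewrite ler_wpM2l // invr_ge0 ltW.
by rewrite E in key; lra.
Qed.

End energy.

(** * Lower bound along a filter *)

Section lower_bound.
Context {R : realType} (H L a : R) (u : R -> R * R).
Context (H0 : 0 < H) (L0 : 0 < L) (uA0 : A0 H a u).
Context (I : Type) (F : set_system I) {FF : Filter F}.
Context (eps : I -> R) (u_ : I -> R -> R * R) (t : R).
Implicit Types (p q x y c d e : R) (i : I).

Local Notation mu := (@lebesgue_measure R).
Local Notation f := (comp1 u).
Local Notation v := (comp2 u).
Local Notation fi i := (comp1 (u_ i)).
Local Notation vi i := (comp2 (u_ i)).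
Local Notation g1 i := (weak_derivative H (comp1 (u_ i))).
Local Notation g2 i := (weak_derivative H (comp2 (u_ i))).
Local Notation sinus := (sinus u).
Local Ltac hlra := move: (H0) (L0); lra.

Definition admissible i := 0 < eps i /\ A1 H a (u_ i).

(** The part of the density that pays for transitions, and the only one that is localised; the term
    in [L] is kept apart for weak lower semicontinuity. *)
Definition local_density i : R -> R := fun x =>
  eps i * g1 i x ^+ 2 + (eps i)^-1 * (fi i x ^+ 2 + vi i x ^+ 2 - 1) ^+ 2.

Definition local_energy i p q := 2^-1 * Intg p q (local_density i).

Definition energy i := 2^-1 *
  Intg (- H) H (density L (eps i) (fi i) (g1 i) (vi i) (g2 i)).

Context (adm : \forall i \near F, admissible i) (ucv : hdiv_cvg H F u_ u).

Lemma admissible_AC i : admissible i ->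
  [/\ ACon (- H) H (fi i) (g1 i), L2on (- H) H (g1 i),
      ACon (- H) H (vi i) (g2 i) & L2on (- H) H (g2 i)].
Proof. by case=> _ [/(H1_AC H0)[? ?] /(H1_AC H0)[? ?] _ _]. Qed.

Lemma admissible_E1D i : admissible i -> E1D H L (eps i) (u_ i) = (energy i)%:E.
Proof. by move=> /admissible_AC[*]; exact: E1D_AC. Qed.

Lemma local_density_intble i : admissible i -> intble (- H) H (local_density i).
Proof.
move=> /admissible_AC[h1 [_ g1L] h2 _].
apply: intbleD; first exact: intbleZ.
apply/cont_on_intble/cont_onZ/cont_onX/cont_onB; last exact: cont_on_cst.
by apply: cont_onD; apply: cont_onX; [exact: AC_cont_on h1|exact: AC_cont_on h2].
Qed.

Lemma local_density_ge0 i x : admissible i -> 0 <= local_density i x.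
Proof.
move=> [e0 _]; apply: addr_ge0; apply: mulr_ge0; rewrite ?sqr_ge0 //.
  exact: ltW.
by rewrite invr_ge0 ltW.
Qed.

Lemma local_energy_ge0 i p q : admissible i -> 0 <= local_energy i p q.
Proof.
by move=> ai; rewrite mulr_ge0 // int_ge0 // => x _; exact: local_density_ge0.
Qed.

Lemma local_energy_cat i p m q : admissible i -> - H <= p -> p <= m -> m <= q ->
  q <= H -> local_energy i p q = local_energy i p m + local_energy i m q.
Proof.
move=> ai Hp pm mq qH; rewrite /local_energy (@int_cat _ p m q) ?mulrDr ?pm //.
exact: intble_sub (local_density_intble ai).
Qed.

Lemma energy_ge i : admissible i ->
  local_energy i (- H) H + L / 2 * Intg (- H) H (fun x => g2 i x ^+ 2) <= energy i.
Proof.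
move=> ai; have [h1 g1L h2 g2L] := admissible_AC ai.
have gi := intbleZ L g2L.2.
have -> : L / 2 * Intg (- H) H (fun x => g2 i x ^+ 2) =
    2^-1 * Intg (- H) H (fun x => L * g2 i x ^+ 2).
  by rewrite intZ; [ring|exact: g2L.2].
rewrite /local_energy /energy -mulrDr ler_pM2l ?invr_gt0 // -intD //; last first.
  exact: local_density_intble.
apply: le_int => [||x xH].
- by apply: intbleD => //; exact: local_density_intble.
- by apply: density_intble => //; [exact: AC_cont_on h1|exact: AC_cont_on h2].
rewrite lerD2r /local_density /density lerD2r mulrDr lerDl mulr_ge0 ?sqr_ge0 //.
by case: ai => /ltW.
Qed.

Lemma derivative2_bound i : admissible i -> energy i < t ->
  Intg (- H) H (fun x => g2 i x ^+ 2) <= 2 * `|t| / L.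
Proof.
move=> ai et; have := energy_ge ai; have := local_energy_ge0 (- H) H ai.
rewrite ler_pdivlMr //; have := ler_norm t; lra.
Qed.

(** Integrating [|g| <= k / 2 * g^2 + (2 * k)^-1] gives equicontinuity with a free [k], to be chosen
    small before the interval is made short. *)
Lemma oscillation2 i x y k : admissible i -> energy i < t -> 0 < k ->
  - H <= x -> x <= y -> y <= H ->
  `|vi i y - vi i x| <= k / 2 * (2 * `|t| / L) + (y - x) / (2 * k).
Proof.
move=> ai et k0 Hx xy yH; have [_ _ h2 g2L] := admissible_AC ai.
have gL := L2on_sub Hx yH g2L; have gi := L2on_intble gL.
rewrite h2.2 //; apply: le_trans (norm_int gi) _.
pose M (z : R) : R := k / 2 * g2 i z ^+ 2 + (2 * k)^-1.
have iM : intble x y (fun z => k / 2 * g2 i z ^+ 2) by exact: intbleZ gL.2.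
apply: (@le_trans _ _ (Intg x y M)).
  apply: le_int => [||z _]; first exact: intble_norm.
    by apply: intbleD => //; exact: intble_cst.
  rewrite /M -(real_normK (num_real (g2 i z))).
  have := sqr_ge0 (k * `|g2 i z| - 1); set n := `|_| => h.
  have : 0 <= (2 * k)^-1 * (k * n - 1) ^+ 2 by rewrite mulr_ge0 // invr_ge0; lra.
  have -> : (2 * k)^-1 * (k * n - 1) ^+ 2 = k / 2 * n ^+ 2 - n + (2 * k)^-1.
    by field; rewrite gt_eqF.
  by lra.
rewrite intD //; last exact: intble_cst.
rewrite int_cst // intZ; last exact: gL.2.
apply: lerD; last by rewrite mulrC.
rewrite ler_pM2l; last by rewrite divr_gt0.
apply: le_trans _ (derivative2_bound ai et).
by apply: int_sub => //; [exact: g2L.2|move=> z _; exact: sqr_ge0].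
Qed.

(** Restricting to energies below [t] provides the L^2 bound on the derivative of the second
    component; the other indices already satisfy the final bound by [t]. *)
Definition cost_at_least p q c := forall e, 0 < e ->
  \forall i \near F, energy i < t -> c - e <= local_energy i p q.

Lemma cost_cat p m q c1 c2 : - H <= p -> p <= m -> m <= q -> q <= H ->
  cost_at_least p m c1 -> cost_at_least m q c2 -> cost_at_least p q (c1 + c2).
Proof.
move=> Hp pm mq qH h1 h2 e e0.
apply: filterS3 adm (h1 (e / 2) _) (h2 (e / 2) _) => [i ai e1 e2 et||]; try by lra.
rewrite (@local_energy_cat i p m q) //; have := e1 et; have := e2 et; lra.
Qed.

Lemma cost0 p q : cost_at_least p q 0.
Proof.
move=> e e0; apply: filterS adm => i ai _.
by have := local_energy_ge0 p q ai; lra.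
Qed.

(** An [r] slightly below [s = sinus y] leaves room twice: the values at [x1] and [x2] pass [-r] and
    [r], and [r^2 <= 1 - v_i^2] survives the oscillation of [v_i] between them. The sign [sg] covers
    jumps in both directions. *)
Lemma cost_transition sg y p q : sg ^+ 2 = 1 -> - H <= y <= H ->
  - H <= p -> p <= q -> q <= H ->
  (forall k, 0 < k -> \forall i \near F, exists x1 x2,
     [/\ p <= x1, x1 <= x2, x2 <= q & x2 - x1 <= k] /\
     [/\ `|sg * fi i x1 + sinus y| <= k, `|sg * fi i x2 - sinus y| <= k &
         `|vi i x1 - v y| <= k]) ->
  cost_at_least p q (4 / 3 * sinus y ^+ 3).
Proof.
move=> sg1 yH Hp pq qH hyp e e0; set s := sinus y in hyp *.
have s0 : 0 <= s by exact: sinus_ge0.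
have s1 : s <= 1 by exact: sinus_le1.
have sq : s ^+ 2 = 1 - v y ^+ 2 by exact: (sinus_sqr H0 uA0 yH).
move: s0; rewrite le_eqVlt => /orP[/eqP s0|s0].
  by rewrite -s0 expr0n mulr0; exact: (@cost0 p q).
(* The loss [4 / 3 * (s^3 - r^3)] is at most [4 * th], because [(1 - th)^3 >= 1 - 3 * th] and
   [s <= 1]. *)
pose th := Num.min 2^-1 (e / 4).
have th0 : 0 < th by rewrite lt_min; apply/andP; split; lra.
have th2 : th <= 2^-1 by rewrite ge_min lexx.
have the : th <= e / 4 by rewrite ge_min lexx orbT.
pose r := s * (1 - th); have r0 : 0 < r by rewrite mulr_gt0 //; lra.
have s3 : 0 < s ^+ 3 by rewrite exprn_gt0.
have s31 : s ^+ 3 <= 1 by rewrite exprn_ile1 // ltW.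
have r3 : 4 / 3 * s ^+ 3 - e <= 4 / 3 * r ^+ 3.
  have h1 : 1 - 3 * th <= (1 - th) ^+ 3 by have := sqr_ge0 th; nra.
  rewrite /r exprMn; have : s ^+ 3 * (1 - 3 * th) <= s ^+ 3 * (1 - th) ^+ 3.
    by rewrite ler_pM2l.
  have : s ^+ 3 * th <= th by rewrite ger_pMl.
  by lra.
have s2 : 0 < s ^+ 2 by rewrite exprn_gt0.
(* A deviation of [w <= 1] raises the square of the second component by at most [3 * w <= s^2 * th],
   and [r^2 <= s^2 - s^2 * th]. *)
pose w := Num.min 1 (s ^+ 2 * th / 3).
have w0 : 0 < w by rewrite lt_min ltr01 divr_gt0 // mulr_gt0.
have w1 : w <= 1 by rewrite ge_min lexx.
have w3 : w <= s ^+ 2 * th / 3 by rewrite ge_min lexx orbT.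
pose M := 2 * `|t| / L + 1.
have M0 : 0 < M by rewrite ltr_wpDl // divr_ge0 ?mulr_ge0 // ltW.
(* [w] is split in thirds: [k1] controls the energy term of [oscillation2], [k] its length term and
   the deviation at [x1]. *)
pose k1 := 2 * w / (3 * M).
have k10 : 0 < k1 by rewrite divr_gt0 ?mulr_gt0.
pose k := Num.min (s * th) (Num.min (w / 3) (2 * k1 * w / 3)).
have k0 : 0 < k.
  rewrite !lt_min; apply/and3P; split; first exact: mulr_gt0.
    exact: divr_gt0.
  by apply: divr_gt0 => //; apply: mulr_gt0 => //; exact: mulr_gt0.
have ks : k <= s * th by rewrite ge_min lexx.
have kw : k <= w / 3 by rewrite !ge_min lexx orbT.
have kk : k <= 2 * k1 * w / 3 by rewrite !ge_min lexx !orbT.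
have tM : 2 * `|t| / L <= M by rewrite lerDl.
have k1M : k1 / 2 * M = w / 3 by rewrite /k1; field; rewrite gt_eqF.
clearbody k k1 w M.
apply: filterS2 adm (hyp k k0) => i ai [x1 [x2 [[px1 x12 x2q x12k] [f1 f2 v1]]]] et.
have [h1 g1L h2 _] := admissible_AC ai.
have Hx1 : - H <= x1 by exact: le_trans px1.
have x2H : x2 <= H by exact: le_trans qH.
have vosc x : x1 <= x <= x2 -> `|vi i x - v y| <= w.
  move=> /andP[x1x xx2].
  have := oscillation2 ai et k10 Hx1 x1x (le_trans xx2 x2H).
  have : k1 / 2 * (2 * `|t| / L) <= w / 3.
    by rewrite -k1M ler_pM2l ?divr_gt0.
  have : (x - x1) / (2 * k1) <= w / 3.
    rewrite ler_pdivrMr ?mulr_gt0 //; lra.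
  have -> : vi i x - v y = (vi i x - vi i x1) + (vi i x1 - v y) by ring.
  move=> ? ? ?; apply: le_trans (ler_normD _ _) _; lra.
have vy1 : v y ^+ 2 <= 1 by exact: (A0_le1 H0 uA0 yH).
have rv x : x1 <= x <= x2 -> r ^+ 2 <= 1 - vi i x ^+ 2.
  move=> /vosc; rewrite ler_norml => vw.
  have vyb : - 1 <= v y <= 1.
    by rewrite -ler_norml -(@ler_pXn2r _ 2) ?nnegrE // expr1n real_normK ?num_real.
  have : vi i x ^+ 2 <= v y ^+ 2 + 3 * w.
    by set z := vi i x in vw *; set z' := v y in vw vyb *; nra.
  have : r ^+ 2 <= s ^+ 2 * (1 - th) by rewrite /r exprMn ler_pM2l //; nra.
  by rewrite -/s in sq *; lra.
apply: le_trans r3 _.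
have le12 : local_energy i x1 x2 <= local_energy i p q.
  rewrite (@local_energy_cat i p x1 q) ?(le_trans x12) //.
  rewrite (@local_energy_cat i x1 x2 q) //.
  by have := local_energy_ge0 p x1 ai; have := local_energy_ge0 x2 q ai; lra.
apply: le_trans _ le12.
apply: (@transition_cost _ _ _ _ _ sg) => //.
- by case: ai.
- exact: AC_sub h1.
- exact: L2on_sub g1L.
- exact: cont_on_sub (AC_cont_on h2).
- by move: f1; rewrite ler_norml /r; lra.
- by move: f2; rewrite ler_norml /r; lra.
Qed.

Lemma L2_close e : 0 < e -> \forall i \near F,
  Intg (- H) H (fun x => (fi i x - f x) ^+ 2 + (vi i x - v x) ^+ 2) < e /\
  intble (- H) H (fun x => (fi i x - f x) ^+ 2 + (vi i x - v x) ^+ 2).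
Proof.
move=> e0; case: ucv => + _; rewrite /strong_L2_cvg => cv.
have := cv [set x | (x < e%:E)%E] => /(_ _) h.
apply: filterS2 adm (h _) => [i ai /= lt|]; last first.
  by apply: open_nbhs_nbhs; split; [exact: open_ereal_lt_ereal|rewrite /= lte_fin].
have [h1 _ h2 _] := admissible_AC ai.
have fL := L2onD (cont_on_L2on (AC_cont_on h1)) (L2onZ (-1) (A0_L2on1 H0 uA0)).
have vL := L2onD (cont_on_L2on (AC_cont_on h2))
  (L2onZ (-1) (cont_on_L2on (A0_cont2 H0 uA0))).
have di : intble (- H) H (fun x => (fi i x - f x) ^+ 2 + (vi i x - v x) ^+ 2).
  by apply: eq_intble (intbleD fL.2 vL.2) => x _; rewrite !mulN1r.
split=> //; move: lt; rewrite -lte_fin -integral_itv_oo //; apply: le_lt_trans.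
rewrite le_eqVlt; apply/orP; left; apply/eqP; apply: eq_integral => x _.
by rewrite enorm_sqr.
Qed.

(** Otherwise the squared distance is at least [e^2] throughout the interval, and its integral at
    least [e^2 * (q - p)]. *)
Lemma pick_close p q e : - H <= p -> p < q -> q <= H -> 0 < e ->
  \forall i \near F, exists2 x, p < x < q &
    `|fi i x - f x| < e /\ `|vi i x - v x| < e.
Proof.
move=> Hp pq qH e0.
have eq0 : 0 < e ^+ 2 * (q - p) by rewrite mulr_gt0 ?exprn_gt0 // subr_gt0.
apply: filterS (L2_close eq0) => i [lt di]; apply: contrapT => h.
have := lt; rewrite ltNge => /negP; apply.
rewrite -int_cst ?(ltW pq) //.
apply: le_trans (_ : Intg p q (fun x => (fi i x - f x) ^+ 2 + (vi i x - v x) ^+ 2) <= _);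
  last first.
  by apply: int_sub => //; [exact: ltW|move=> x _; rewrite addr_ge0 ?sqr_ge0].
apply: ae_le_int; [exact: intble_cst|exact: intble_sub di|].
apply: ae_segment => x pxq; rewrite leNgt; apply/negP => lt'; apply: h; exists x => //.
have bd z : z ^+ 2 < e ^+ 2 -> `|z| < e.
  by rewrite -(real_normK (num_real z)) ltr_pXn2r ?nnegrE // ltW.
by split; apply: bd; apply: le_lt_trans lt'; rewrite ?lerDl ?lerDr sqr_ge0.
Qed.

Lemma cost_jump y p q : jump_set H f y -> - H <= p -> p < y -> y < q -> q <= H ->
  cost_at_least p q (4 / 3 * sinus y ^+ 3).
Proof.
move=> [yH lr] Hp py yq qH; move: yH; rewrite /dom /= in_itv /= => yH.
have [l1 f1 l1E] := A0_llim H0 uA0 (y := y) ltac:(hlra).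
have [l2 f2 l2E] := A0_rlim H0 uA0 (y := y) ltac:(hlra).
rewrite (llim_left_limit f1) (rlim_right_limit f2) in lr.
(* The limits are distinct and both among [+-sinus y], hence opposite; [sg] is the direction of the
   jump. *)
have [sg [sg1 sgE]] : exists sg : R, sg ^+ 2 = 1 /\
    (l1 = - (sg * sinus y) /\ l2 = sg * sinus y).
  case: l1E => e1; case: l2E => e2; rewrite e1 e2 in lr *.
  - by [].
  - by exists (-1); rewrite sqrrN expr1n mulN1r opprK.
  - by exists 1; rewrite expr1n mul1r.
  - by [].
case: sgE => e1 e2.
apply: (@cost_transition sg) => //; [hlra|hlra|move=> k k0].
have [d1 d10 P1] := f1 (k / 2) ltac:(hlra).
have [d2 d20 P2] := f2 (k / 2) ltac:(hlra).
have [d3 d30 P3] := A0_cont2 H0 uA0 (x := y) ltac:(hlra) (e := k / 2) ltac:(hlra).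
pose d := Num.min (k / 2) (Num.min d1 (Num.min d2 d3)).
have d0 : 0 < d by rewrite !lt_min d10 d20 d30 divr_gt0.
have [dk [dd1 [dd2 dd3]]] : d <= k / 2 /\ d <= d1 /\ d <= d2 /\ d <= d3.
  by rewrite /d !ge_min !lexx !orbT.
clearbody d.
have pd : Num.max p (y - d) < y by rewrite gt_max; apply/andP; split; hlra.
have qd : y < Num.min q (y + d) by rewrite lt_min; apply/andP; split; hlra.
have Hpd : - H <= Num.max p (y - d) by rewrite le_max Hp.
have qHd : Num.min q (y + d) <= H by rewrite ge_min qH.
have k20 : 0 < k / 2 by rewrite divr_gt0.
have near1 := pick_close Hpd pd ltac:(hlra) k20.
have near2 := pick_close (p := y) ltac:(hlra) qd qHd k20.
apply: filterS2 near1 near2 => i [x1 + [fx1 vx1]] [x2 + [fx2 vx2]].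
rewrite gt_max lt_min => x1P x2P; exists x1, x2.
have sgn z : `|sg * z| = `|z|.
  suff : `|sg| = 1 by rewrite normrM => ->; rewrite mul1r.
  by apply/eqP; rewrite -(@eqrXn2 _ 2) // expr1n real_normK ?num_real // sg1.
have sg2 z : sg * (sg * z) = z by rewrite mulrA -expr2 sg1 mul1r.
split; first by split; hlra.
have := P1 x1 ltac:(hlra); have := P2 x2 ltac:(hlra).
have := P3 x1 ltac:(hlra) ltac:(rewrite ltr_norml; hlra).
move=> v1 f2' f1'; split.
- rewrite -(sgn (_ + _)) mulrDr sg2.
  have -> : fi i x1 + sg * sinus y = (fi i x1 - f x1) + (f x1 - l1).
    by rewrite e1; ring.
  apply: le_trans (ler_normD _ _) _; lra.
- rewrite -(sgn (_ - _)) mulrBr sg2.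
  have -> : fi i x2 - sg * sinus y = (fi i x2 - f x2) + (f x2 - l2).
    by rewrite e2; ring.
  apply: le_trans (ler_normD _ _) _; lra.
- have -> : vi i x1 - v y = (vi i x1 - v x1) + (v x1 - v y) by ring.
  apply: le_trans (ler_normD _ _) _; lra.
Qed.

(** The right limit is [+-s]. If it is [-s], it agrees with the boundary value and costs nothing; if
    it is [s], a full transition starts at [-H] itself. *)
Lemma cost_left q : - H < q -> q <= H -> cost_at_least (- H) q
  (6^-1 * `|right_limit f (- H) + Num.sqrt (1 - a ^+ 2)| ^+ 3).
Proof.
move=> Hq qH; have vH : v (- H) = a by case: uA0.
rewrite -[in Num.sqrt _]vH -/(sinus (- H)).
have [l fl lE] := A0_rlim H0 uA0 (y := - H) ltac:(hlra).
rewrite (rlim_right_limit fl); case: lE => lE; last first.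
  by rewrite lE addNr normr0 expr0n mulr0; exact: cost0.
have s0 := sinus_ge0 u (- H).
have -> : 6^-1 * `|l + sinus (- H)| ^+ 3 = 4 / 3 * sinus (- H) ^+ 3.
  by rewrite lE ger0_norm ?addr_ge0 //; field.
apply: (@cost_transition 1); rewrite ?expr1n //; try hlra; move=> k k0.
have [d2 d20 P2] := fl (k / 2) ltac:(hlra).
pose d := Num.min k d2.
have d0 : 0 < d by rewrite lt_min k0.
have [dk dd2] : d <= k /\ d <= d2 by rewrite /d !ge_min !lexx orbT.
clearbody d.
have qd : - H < Num.min q (- H + d) by rewrite lt_min; apply/andP; split; hlra.
have qHd : Num.min q (- H + d) <= H by rewrite ge_min qH.
have k20 : 0 < k / 2 by rewrite divr_gt0.
have near2 := pick_close (p := - H) (lexx _) qd qHd k20.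
apply: filterS2 adm near2 => i [_ [_ _ uH _]] [x2 + [fx2 vx2]].
rewrite lt_min => x2P; exists (- H), x2.
have := P2 x2 ltac:(hlra); move=> f2'; split; first by split; hlra.
split.
- by rewrite /comp1 uH /= mul1r /sinus vH addNr normr0 ltW.
- have -> : 1 * fi i x2 - sinus (- H) = (fi i x2 - f x2) + (f x2 - l).
    by rewrite lE; ring.
  apply: le_trans (ler_normD _ _) _; lra.
- by rewrite {1}/comp2 uH /= vH subrr normr0 ltW.
Qed.

Lemma cost_right p : - H <= p -> p < H -> cost_at_least p H
  (6^-1 * `|left_limit f H - Num.sqrt (1 - a ^+ 2)| ^+ 3).
Proof.
move=> Hp pH; have vH : v H = a by case: uA0.
rewrite -[in Num.sqrt _]vH -/(sinus H).
have [l fl lE] := A0_llim H0 uA0 (y := H) ltac:(hlra).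
rewrite (llim_left_limit fl); case: lE => lE.
  by rewrite lE subrr normr0 expr0n mulr0; exact: cost0.
have s0 := sinus_ge0 u H.
have -> : 6^-1 * `|l - sinus H| ^+ 3 = 4 / 3 * sinus H ^+ 3.
  by rewrite lE -opprD normrN ger0_norm ?addr_ge0 //; field.
apply: (@cost_transition 1); rewrite ?expr1n //; try hlra; move=> k k0.
have [d1 d10 P1] := fl (k / 2) ltac:(hlra).
have [d3 d30 P3] := A0_cont2 H0 uA0 (x := H) ltac:(hlra) (e := k / 2) ltac:(hlra).
pose d := Num.min k (Num.min d1 d3).
have d0 : 0 < d by rewrite !lt_min k0 d10.
have [dk [dd1 dd3]] : d <= k /\ d <= d1 /\ d <= d3.
  by rewrite /d !ge_min !lexx !orbT.
clearbody d.
have pd : Num.max p (H - d) < H by rewrite gt_max; apply/andP; split; hlra.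
have Hpd : - H <= Num.max p (H - d) by rewrite le_max Hp.
have k20 : 0 < k / 2 by rewrite divr_gt0.
have near1 := pick_close Hpd pd (lexx _) k20.
apply: filterS2 adm near1 => i [_ [_ _ _ uH]] [x1 + [fx1 vx1]].
rewrite gt_max => x1P; exists x1, H.
have := P1 x1 ltac:(hlra); have := P3 x1 ltac:(hlra) ltac:(rewrite ltr_norml; hlra).
move=> v1 f1'; split; first by split; hlra.
split.
- have -> : 1 * fi i x1 + sinus H = (fi i x1 - f x1) + (f x1 - l).
    by rewrite lE; ring.
  apply: le_trans (ler_normD _ _) _; lra.
- by rewrite /comp1 uH /= mul1r /sinus vH subrr normr0 ltW.
- have -> : vi i x1 - v H = (vi i x1 - v x1) + (v x1 - v H) by ring.
  apply: le_trans (ler_normD _ _) _; lra.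
Qed.

Lemma cost_jumps (ys : seq R) p : - H <= p -> p < H ->
  (forall y, y \in ys -> jump_set H f y) -> path <%R p ys ->
  cost_at_least p H (4 / 3 * (\sum_(y <- ys) sinus y ^+ 3) +
    6^-1 * `|left_limit f H - Num.sqrt (1 - a ^+ 2)| ^+ 3).
Proof.
elim: ys p => [|y ys IH] p Hp pH ysJ /=.
  by move=> _; rewrite big_nil mulr0 add0r; exact: cost_right.
move=> /andP[py pys]; have Jy : jump_set H f y by apply: ysJ; rewrite mem_head.
have : - H < y < H by case: (Jy); rewrite /dom /= in_itv.
(* [head H ys] is the next jump, or [H] after the last one; cutting halfway gives each jump its own
   interval. *)
move=> yH; pose z := (y + head H ys) / 2.
have yh : y < head H ys.
  by case: (ys) pys => [|y' ys' /= /andP[]] //=; hlra.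
have hH : head H ys <= H.
  case: (ys) ysJ => [|y' ys'] //= J; have [] := J y' _.
    by rewrite !inE eqxx orbT.
  by rewrite /dom /= in_itv /= => /andP[_ /ltW].
have yz : y < z by rewrite /z; lra.
have zh : z < head H ys by rewrite /z; lra.
have zys : path <%R z ys.
  by case: (ys) pys zh => [|y' ys'] //= /andP[_ ->]; rewrite andbT.
clearbody z.
rewrite big_cons mulrDr -addrA; apply: (@cost_cat p z H) => //; try hlra.
  by apply: cost_jump => //; hlra.
apply: IH => //; [hlra|hlra|].
by move=> y' y'ys; apply: ysJ; rewrite inE y'ys orbT.
Qed.

(** Expand the nonnegative integral of [(g_i - d)^2], with [d] the weak limit; weak convergence
    tested against [d] itself controls the cross term. *)
Lemma derivative2_lsc e : 0 < e -> \forall i \near F,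
  Intg (- H) H (fun x => weak_derivative H v x ^+ 2) - e <=
  Intg (- H) H (fun x => g2 i x ^+ 2).
Proof.
move=> e0; have [_ dL] := A0_AC2 H0 uA0.
set d := weak_derivative H v in dL *.
have dd : intble (- H) H (fun y => d y * d y).
  by apply: eq_intble dL.2 => x _; rewrite expr2.
case: ucv => _ /(_ d (proj2 (L2P _ _) dL)) /cvgrPdist_lt.
move=> /(_ (e / 2) ltac:(hlra)); rewrite -/d; apply: filterS2 adm => i ai.
have [_ _ _ gL] := admissible_AC ai; have gd := L2onM gL dL.
rewrite /dom !Rintegral_itv_oo // ltr_norml => lt.
have : 0 <= Intg (- H) H (fun x => (g2 i x - d x) ^+ 2).
  by apply: int_ge0 => x _; exact: sqr_ge0.
rewrite (eq_int (g := fun x => g2 i x ^+ 2 + d x ^+ 2 - 2 * (g2 i x * d x)));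
  last by move=> x _; ring.
rewrite (intB (intbleD gL.2 dL.2) (intbleZ 2 gd)) (intD gL.2 dL.2) (intZ 2 gd).
have E : Intg (- H) H (fun y => d y * d y) = Intg (- H) H (fun x => d x ^+ 2).
  by apply: eq_int => x _; rewrite expr2.
move: lt; rewrite {}E.
move: (Intg _ _ (fun y => g2 i y * d y)) (Intg _ _ (fun x => d x ^+ 2)).
move: (Intg _ _ (fun x => g2 i x ^+ 2)) => X Y Z lt h.
lra.
Qed.

Lemma energy_lower_bound (ys : seq R) e : uniq ys ->
  (forall y, y \in ys -> jump_set H f y) -> 0 < e ->
  \forall i \near F, energy i < t ->
    L / 2 * Intg (- H) H (fun x => weak_derivative H v x ^+ 2) +
    4 / 3 * (\sum_(y <- ys) sinus y ^+ 3) +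
    6^-1 * `|right_limit f (- H) + Num.sqrt (1 - a ^+ 2)| ^+ 3 +
    6^-1 * `|left_limit f H - Num.sqrt (1 - a ^+ 2)| ^+ 3 - e <= energy i.
Proof.
have combine (A B E E' S b1 b2 d : R) : A - d / 2 <= B -> E + B <= E' ->
    b1 + (4 / 3 * S + b2) - d / 2 <= E -> A + 4 / 3 * S + b1 + b2 - d <= E'.
  by lra.
move=> ysU ysJ e0; pose xs := sort <=%R ys.
have xsJ y : y \in xs -> jump_set H f y by rewrite mem_sort; exact: ysJ.
have xs_sorted : sorted <%R xs.
  by rewrite lt_sorted_uniq_le sort_uniq ysU sort_le_sorted.
have -> : \sum_(y <- ys) sinus y ^+ 3 = \sum_(y <- xs) sinus y ^+ 3.
  by apply: perm_big; rewrite perm_sym perm_sort.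
pose z := (- H + head H xs) / 2.
have hH : - H < head H xs <= H.
  case: (xs) xsJ => [|y' ys'] //= J; first by hlra.
  have [] := J y' _; first by rewrite mem_head.
  by rewrite /dom /= in_itv /= => /andP[-> /ltW].
have Hz : - H < z by rewrite /z; lra.
have zh : z < head H xs by rewrite /z; lra.
have zxs : path <%R z xs.
  by case: (xs) xs_sorted zh => [|y' ys'] //= -> ->.
clearbody z.
have zH : z < H by hlra.
have := cost_cat (p := - H) (q := H) (lexx _) (ltW Hz) (ltW zH) (lexx _)
  (cost_left Hz (ltW zH)) (cost_jumps (ltW Hz) zH xsJ zxs).
have eL : 0 < e / L by rewrite divr_gt0.
move=> /(_ (e / 2)) h; apply: filterS3 adm (h _) (derivative2_lsc eL); first last.
  by rewrite divr_gt0.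
move=> i ai h1 h2 et; have := h1 et; have := energy_ge ai.
have : L / 2 * (Intg (- H) H (fun x => weak_derivative H v x ^+ 2) - e / L) <=
  L / 2 * Intg (- H) H (fun x => g2 i x ^+ 2) by rewrite ler_pM2l // divr_gt0.
rewrite mulrBr (_ : L / 2 * (e / L) = e / 2); last by field; rewrite gt_eqF.
by move=> h3 h4 h5; exact: combine h3 h4 h5.
Qed.

End lower_bound.

(** * The liminf inequality *)

Section liminf_inequality.
Context {R : realType}.
Implicit Types (H L a t : R) (u : R -> R * R).

Local Notation mu := (@lebesgue_measure R).

Lemma le_real_below (x y : \bar R) : (forall t, (t%:E < x)%E -> (t%:E <= y)%E) -> (x <= y)%E.
Proof.
case: x => [r| |] xy; last exact: leNye.
  apply/lee_subgt0Pr => e e0; rewrite -EFinB; apply: xy.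
  by rewrite lte_fin ltrBlDr ltrDl.
case: y xy => [r| |] // xy; last by have := xy 0 (ltry _).
by have := xy (r + 1) (ltry _); rewrite lee_fin gerDl ler10.
Qed.

Lemma limn_einf_ge (w : nat -> \bar R) (x : \bar R) :
  (\forall n \near \oo, (x <= w n)%E) -> (x <= limn_einf w)%E.
Proof.
move=> [N _ xw]; rewrite limn_einf_lim.
have /cvg_lim -> // := @cvg_einfs_sup _ w.
apply: le_trans (_ : einfs w N <= _)%E; last by apply: ereal_sup_ubound; exists N.
by apply: le_ereal_inf_tmp => _ [n /= Nn <-]; exact: xw.
Qed.

Definition boundary_cost H a u :=
  6^-1 * `|right_limit (comp1 u) (- H) + Num.sqrt (1 - a ^+ 2)| ^+ 3 +
  6^-1 * `|left_limit (comp1 u) H - Num.sqrt (1 - a ^+ 2)| ^+ 3.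

Definition dirichlet H L u :=
  L / 2 * Intg (- H) H (fun x => weak_derivative H (comp2 u) x ^+ 2).

Lemma E1D0E H L a u : 0 < H -> A0 H a u -> E1D0 H L a u =
  ((dirichlet H L u)%:E +
   (4 / 3)%:E * (\esum_(y in jump_set H (comp1 u)) (sinus u y ^+ 3)%:E) +
   (boundary_cost H a u)%:E)%E.
Proof.
move=> H0 uA0; rewrite /E1D0 /boundary_cost /dirichlet /dom integral_itv_oo.
  rewrite [in RHS](EFinD (6^-1 * _)) addeA -EFinM.
congr (_ + _ * _ + _ + _)%E.
  apply: eq_esum => y [] yH _; rewrite (sinus_powR H0 uA0) //.
  by move: yH; rewrite /dom /= in_itv /=; lra.
by have [_ []] := A0_AC2 H0 uA0.
Qed.

(** Finitely many jumps already bring the limit energy above [t]; an energy below [t] would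
    contradict the lower bound for these jumps. The filter is free in order to serve sequences as
    well as [0^'+]. *)
Lemma E1D0_lower_bound (I : Type) (F : set_system I) {FF : Filter F}
    H L a u (eps : I -> R) (u_ : I -> R -> R * R) t :
  0 < H -> 0 < L -> A0 H a u ->
  (\forall i \near F, admissible H a eps u_ i) -> hdiv_cvg H F u_ u ->
  (t%:E < E1D0 H L a u)%E ->
  \forall i \near F, (t%:E <= E1D H L (eps i) (u_ i))%E.
Proof.
move=> H0 L0 uA0 adm ucv; rewrite (E1D0E L H0 uA0).
set D := dirichlet H L u; set B := boundary_cost H a u.
set J := jump_set H (comp1 u) => tE.
have [ys [ysU ysJ lt]] : exists ys : seq R, [/\ uniq ys,
    forall y, y \in ys -> J y &
    t < D + 4 / 3 * (\sum_(y <- ys) sinus u y ^+ 3) + B].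
  (* Otherwise all finite sums, hence the whole sum, are so small that [E1D0] is at most [t]. *)
  apply: contrapT => h; move: tE; rewrite ltNge => /negP; apply.
  have es : (\esum_(y in J) (sinus u y ^+ 3)%:E <= ((t - D - B) * (3 / 4))%:E)%E.
    apply: ge_ereal_sup => _ [X [finX XJ] <-].
    rewrite fsbig_finite // sumEFin lee_fin leNgt; apply/negP => lt; apply: h.
    exists (finmap.enum_fset (fset_set X)); split; first exact: finmap.fset_uniq.
      by move=> y yX; apply: XJ; rewrite -in_setE -in_fset_set.
    by lra.
  have -> : t%:E = (D%:E + (4 / 3)%:E * ((t - D - B) * (3 / 4))%:E + B%:E)%E.
    by rewrite -EFinM -!EFinD; congr (_%:E); field.
  by rewrite !leeD2r // leeD2l // lee_pmul2l.
(* With this [e] the lower bound minus [e] is exactly [t]. *)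
pose e := D + 4 / 3 * (\sum_(y <- ys) sinus u y ^+ 3) + B - t.
have e0 : 0 < e by rewrite /e subr_gt0.
have := energy_lower_bound H0 L0 uA0 t adm ucv ysU ysJ e0.
move=> /(_ FF) lbF; apply: filterS2 adm lbF => i ai lb; rewrite (admissible_E1D L H0 ai) lee_fin leNgt.
apply/negP => lt'; have := lb lt'; move: lt'; rewrite /e /D /B /dirichlet /boundary_cost.
lra.
Qed.

Lemma E1D0_liminf H L a u (eps : nat -> R) (u_ : nat -> R -> R * R) :
  0 < H -> 0 < L -> A0 H a u ->
  (forall n, 0 < eps n) -> (forall n, A1 H a (u_ n)) -> hdiv_cvg H \oo u_ u ->
  (E1D0 H L a u <= limn_einf (fun n => E1D H L (eps n) (u_ n)))%E.
Proof.
move=> H0 L0 uA0 eps0 uA1 ucv; apply: le_real_below => t tE.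
apply: limn_einf_ge; apply: (E1D0_lower_bound H0 L0 uA0) tE => //.
by apply: nearW => n; split.
Qed.

End liminf_inequality.

(** * Hyperbolic tangents adjusted to a window *)

Section transition_profile.
Context {R : realType}.
Implicit Types (p q x y z c m t eps : R) (f g A B : R -> R).

Definition tanh z : R := 1 - 2 / (expR (2 * z) + 1).

Let den_gt0 z : 0 < expR z + 1.
Proof. by rewrite addr_gt0 ?expR_gt0. Qed.

Lemma tanhN z : tanh (- z) = - tanh z.
Proof.
rewrite /tanh mulrN expRN; have := expR_gt0 (2 * z); set e := expR _ => e0.
have h1 : e != 0 by rewrite gt_eqF.
have h2 : e + 1 != 0 by rewrite gt_eqF // addr_gt0.
have h3 : 1 + e != 0 by rewrite addrC.
by field; rewrite ?h1 ?h2 ?h3 //= ?h1 ?h2 ?h3.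
Qed.

Lemma ler_tanh x y : x <= y -> tanh x <= tanh y.
Proof.
move=> xy; rewrite /tanh lerD2l lerN2 ler_pM2l // lef_pV2 ?posrE ?den_gt0 //.
by rewrite lerD2r ler_expR ler_pM2l.
Qed.

Lemma tanh_lt1 z : tanh z < 1.
Proof. by rewrite /tanh gtrBl divr_gt0. Qed.

(** It comes from [1 + 2 * z <= expR (2 * z)] and bounds the later stretching factor [1 / tanh X] by
    [1 + 1 / X]. *)
Lemma tanh_lower z : 0 < z -> z / (1 + z) <= tanh z.
Proof.
move=> z0; have e1 : 1 + 2 * z <= expR (2 * z) by rewrite expR_ge1Dx.
rewrite /tanh (_ : z / (1 + z) = 1 - (1 + z)^-1); last first.
  by field; rewrite gt_eqF // addr_gt0.
rewrite lerD2l lerN2 ler_pdivrMr ?den_gt0 // mulrC ler_pdivlMr ?addr_gt0 //.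
by lra.
Qed.

Lemma is_derive_tanh c z x : is_derive x 1 (fun y => tanh (c * (y - z)))
  (c * (1 - tanh (c * (x - z)) ^+ 2)).
Proof.
have lin : is_derive x 1 (fun y => 2 * (c * (y - z))) (2 * c).
  apply: (@quad_is_derive _ _ (cst (2 * c))); exists 1 => // s t.
  have -> : 2 * (c * (t - z)) - 2 * (c * (s - z)) - 2 * c * (t - s) = 0 by ring.
  by rewrite normr0 mulr_ge0 ?sqr_ge0.
have ex := @is_derive1_comp _ expR (fun y => 2 * (c * (y - z))) x _ _
  (is_derive_expR (2 * (c * (x - z)))) lin.
have e0 : expR (2 * (c * (x - z))) + 1 != 0 by rewrite gt_eqF.
have den : is_derive x 1 (fun y => expR (2 * (c * (y - z))) + 1)
    (expR (2 * (c * (x - z))) * (2 * c)).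
  have := is_deriveD ex (is_derive_cst (1 : R) x (1 : R)).
  by rewrite addr0.
have dV := @is_deriveV _ (fun y => expR (2 * (c * (y - z))) + 1) x _ 1 e0 den.
have := is_deriveB (is_derive_cst (1 : R) x (1 : R)) (is_deriveZ 2 dV).
move=> h; apply: (@is_derive_eq _ _ _ _ _ _ _ _ h) => //.
rewrite /GRing.scale /= /tanh; move: e0; set e := expR _ => e0.
field.
by rewrite e0.
Qed.

Lemma cont_on_tanh p q c z : cont_on p q (fun y => tanh (c * (y - z))).
Proof.
apply: continuous_cont_on => x; apply: differentiable_continuous.
by apply/derivable1_diffP; have [] := is_derive_tanh c z x.
Qed.

(** For constant amplitude [m] the optimal profile solves [eps * tau' = m * (1 - tau^2)], which
    makes the two energy terms equal; hence the slope [m / eps]. It never attains [+-1]: dividing by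
    its value [T] at the end of the window repairs this and costs the factor [K^2], [K = 1 / T]. The
    weights [A] and [B] are dominated by those of amplitude [m]. *)
Lemma tanh_window p q eps m : p < q -> 0 < eps -> 0 < m -> exists tau g,
  [/\ ACon p q tau g, cont_on p q g, tau p = -1 /\ tau q = 1,
      forall x, p <= x <= q -> `|tau x| <= 1 &
      forall A B, cont_on p q A -> cont_on p q B ->
        (forall x, p <= x <= q -> 0 <= A x <= m ^+ 2) ->
        (forall x, p <= x <= q -> 0 <= B x <= m ^+ 4) ->
        2^-1 * Intg p q (fun x => eps * (A x * g x ^+ 2) +
          eps^-1 * (B x * (1 - tau x ^+ 2) ^+ 2)) <=
        (1 + eps / (m * ((q - p) / 2))) ^+ 2 * (4 / 3 * m ^+ 3)].
Proof.
move=> pq eps0 m0.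
have invX (r : R) : 0 < r -> eps / (m * r) = (m / eps * r)^-1.
  by move=> r0; field; rewrite !gt_eqF.
pose z := (p + q) / 2; pose c := m / eps.
have c0 : 0 < c by rewrite divr_gt0.
pose h := (q - p) / 2; have h0 : 0 < h by rewrite /h; lra.
pose X := c * h; have X0 : 0 < X by rewrite mulr_gt0.
pose th y := tanh (c * (y - z)).
have thp : th p = - tanh X by rewrite /th -tanhN; congr tanh; rewrite /X /h /z; field.
have thq : th q = tanh X by rewrite /th; congr tanh; rewrite /X /h /z; field.
set T := tanh X in thp thq; have T1 : T < 1 by exact: tanh_lt1.
have Tlow : X / (1 + X) <= T by exact: tanh_lower.
have T0 : 0 < T by apply: lt_le_trans Tlow; rewrite divr_gt0 // addr_gt0.
clearbody T.
have thb x : p <= x <= q -> - T <= th x <= T.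
  move=> /andP[px xq]; rewrite -thp -thq /th.
  by apply/andP; split; apply: ler_tanh; rewrite ler_pM2l // lerD2r.
pose K := T^-1; have K0 : 0 < K by rewrite invr_gt0.
have KT : K * T = 1 by rewrite mulVf // gt_eqF.
have K1 : 1 <= K by rewrite -[leLHS]KT ger_pMr // ltW.
have KX : K <= 1 + eps / (m * h).
  rewrite (invX h h0) -/c -/X.
  have -> : 1 + X^-1 = (X / (1 + X))^-1.
    by field; rewrite !gt_eqF // addr_gt0.
  by rewrite lef_pV2 // posrE divr_gt0 // addr_gt0.
pose D x := 1 - th x ^+ 2.
have cth : cont_on p q th by exact: cont_on_tanh.
have cD : cont_on p q D by apply: cont_onB; [exact: cont_on_cst|exact: cont_onX].
have thAC : ACon p q th (fun x => c * D x).
  by apply: AC_derive => [x _|]; [exact: is_derive_tanh|exact: cont_onZ].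
have Db x : p <= x <= q -> 0 <= D x.
  by move=> /thb tb; rewrite /D; nra.
exists (fun x => K * th x), (fun x => K * (c * D x)); split.
- exact: AC_Z.
- exact/cont_onZ/cont_onZ.
- by rewrite thp thq mulrN KT.
- move=> x xpq; rewrite normrM gtr0_norm // -[leRHS]KT ler_pM2l // ler_norml.
  exact: thb.
move=> A B cA cB Ab Bb.
have DAC : ACon p q (fun x => th x - 3^-1 * (th x ^+ 2 * th x))
    (fun x => D x * (c * D x)).
  have := AC_B thAC (AC_Z 3^-1 (AC_M (AC_sqr thAC) thAC)).
  by apply: eq_AC => x _ //; rewrite /D; field.
(* [2 * T - 2 / 3 * T^3 <= 4 / 3] amounts to [(1 - T)^2 * (2 + T) >= 0]. *)
have iD : Intg p q (fun x => D x * (c * D x)) <= 4 / 3.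
  rewrite -(DAC.2 p q (lexx _) (ltW pq) (lexx _)) thp thq.
  have : 0 <= (1 - T) ^+ 2 * (2 + T) by rewrite mulr_ge0 ?sqr_ge0 //; lra.
  lra.
apply: (@le_trans _ _ (2^-1 * Intg p q
    (fun x => 2 * (K ^+ 2 * m ^+ 3) * (D x * (c * D x))))).
  rewrite ler_pM2l ?invr_gt0 //; apply: le_int => [||x xpq].
  - apply/cont_on_intble/cont_onD/cont_onZ/cont_onM => //; last first.
      by apply/cont_onX/cont_onB/cont_onX/cont_onZ => //; exact: cont_on_cst.
    by apply/cont_onZ/cont_onM => //; apply/cont_onX/cont_onZ/cont_onZ.
  - exact/intbleZ/DAC.1.
  have -> : 2 * (K ^+ 2 * m ^+ 3) * (D x * (c * D x)) =
    eps * (m ^+ 2 * (K * (c * D x)) ^+ 2) + eps^-1 * (m ^+ 4 * (K * D x) ^+ 2).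
    by rewrite /c; field; rewrite gt_eqF.
  apply: lerD; apply: ler_wpM2l; rewrite ?invr_ge0 ?(ltW eps0) //.
    by apply: ler_wpM2r; [exact: sqr_ge0|case/andP: (Ab x xpq)].
  apply: ler_pM; rewrite ?sqr_ge0 //; try by case/andP: (Bb x xpq).
  have tb := thb x xpq.
  (* Stretching moves the profile towards [+-1] without passing it, so [1 - tau^2] only
     decreases. *)
  have kt : (K * th x) ^+ 2 <= 1.
    rewrite -(real_normK (num_real _)) exprn_ile1 // normrM gtr0_norm //.
    by rewrite -[leRHS]KT ler_pM2l // ler_norml.
  have tk : th x ^+ 2 <= (K * th x) ^+ 2.
    by rewrite exprMn ler_peMl ?sqr_ge0 // exprn_ege1.
  rewrite lerXn2r ?nnegrE ?mulr_ge0 ?Db ?(ltW K0) //; first by lra.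
  apply: (@le_trans _ _ (D x)); first by rewrite /D lerD2l lerN2.
  by rewrite ler_peMl // Db.
rewrite intZ; last exact: DAC.1.
have -> : forall i : R, 2^-1 * (2 * (K ^+ 2 * m ^+ 3) * i) = K ^+ 2 * (i * m ^+ 3).
  by move=> i; field.
apply: ler_pM; rewrite ?sqr_ge0 ?mulr_ge0 ?exprn_ge0 ?(ltW m0) //.
- apply: int_ge0 => x xpq; apply: mulr_ge0; first exact: Db.
  by apply: mulr_ge0; [exact: ltW|exact: Db].
- rewrite lerXn2r ?nnegrE ?(ltW K0) //.
  by apply: addr_ge0 => //; apply: ltW; apply: divr_gt0 => //; exact: mulr_gt0.
- by rewrite ler_pM2r // exprn_gt0.
Qed.

End transition_profile.

(** * Sign profiles on an interval *)

Section profiles.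
Context {R : realType} (H a : R) (u : R -> R * R).
Context (H0 : 0 < H) (uA0 : A0 H a u).
Implicit Types (p q m x y z eps k c e d : R) (tau g : R -> R).

Local Notation mu := (@lebesgue_measure R).
Local Notation f := (comp1 u).
Local Notation v := (comp2 u).
Local Notation s := (sinus u).
Local Ltac hlra := move: (H0); lra.

(** [s^2 + k] dominates the square of the regularised modulus that multiplies the derivative of
    [tau]; the potential keeps [s], and the difference becomes an error term of the recovery
    field. *)
Definition cost_density eps k tau g : R -> R := fun x =>
  eps * ((s x ^+ 2 + k) * g x ^+ 2) + eps^-1 * (s x ^+ 4 * (1 - tau x ^+ 2) ^+ 2).
Definition gap tau : R -> R := fun x => (s x * tau x - f x) ^+ 2.

(* The first component of the recovery sequence is close to sinus * tau, so a
   profile has to switch between the signs al and be of u_1 at low cost. *)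
Definition profile eps k p q (al be c e : R) := exists tau g,
  [/\ ACon p q tau g, L2on p q g, tau p = al /\ tau q = be,
      forall x, p <= x <= q -> `|tau x| <= 1 &
      2^-1 * Intg p q (cost_density eps k tau g) <= c /\
      Intg p q (gap tau) <= e].

Lemma cost_density_intble eps k p q tau g : - H <= p -> q <= H ->
  cont_on p q tau -> L2on p q g -> intble p q (cost_density eps k tau g).
Proof.
move=> Hp qH ctau [_ gL].
have cs : cont_on p q s by apply: cont_on_sub (cont_on_sinus H0 uA0).
apply: intbleD.
  apply: intbleZ; apply: intbleM_cont => //.
  by apply: cont_onD; [exact: cont_onX|exact: cont_on_cst].
apply/cont_on_intble/cont_onZ/cont_onM; first exact: cont_onX.
by apply/cont_onX/cont_onB; [exact: cont_on_cst|exact: cont_onX].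
Qed.

Lemma gap_L2on p q tau : - H <= p -> q <= H -> cont_on p q tau ->
  L2on p q (fun x => s x * tau x - f x).
Proof.
move=> Hp qH ctau.
have cs : cont_on p q s by apply: cont_on_sub (cont_on_sinus H0 uA0).
have fL := L2onZ (-1) (L2on_sub Hp qH (A0_L2on1 H0 uA0)).
have := L2onD (cont_on_L2on (cont_onM cs ctau)) fL.
by under [X in L2on _ _ X]funext do rewrite mulN1r.
Qed.

Lemma gap_intble p q tau : - H <= p -> q <= H -> cont_on p q tau ->
  intble p q (gap tau).
Proof. by move=> Hp qH /(gap_L2on Hp qH)[]. Qed.

Lemma profile_paste eps k p m q al ga be c1 c2 e1 e2 :
  - H <= p -> p <= m -> m <= q -> q <= H ->
  profile eps k p m al ga c1 e1 -> profile eps k m q ga be c2 e2 ->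
  profile eps k p q al be (c1 + c2) (e1 + e2).
Proof.
move=> Hp pm mq qH [t1 [g1 [A1 L1 [t1p t1m] b1 [C1 E1]]]].
move=> [t2 [g2 [A2 L2' [t2m t2q] b2 [C2 E2]]]].
have pmq : p <= m <= q by rewrite pm.
have Hm : - H <= m by exact: le_trans pm.
have mH : m <= H by exact: le_trans qH.
have t12 : t1 m = t2 m by rewrite t1m t2m.
have i1 := cost_density_intble eps k Hp mH (AC_cont_on A1) L1.
have i2 := cost_density_intble eps k Hm qH (AC_cont_on A2) L2'.
have j1 := gap_intble Hp mH (AC_cont_on A1).
have j2 := gap_intble Hm qH (AC_cont_on A2).
exists (paste m t1 t2), (paste m g1 g2); split.
- exact: AC_paste.
- have [gi _] := int_paste pmq (L2on_intble L1) (L2on_intble L2').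
  split; first exact: intble_measurable.
  have [gi2 _] := int_paste pmq L1.2 L2'.2.
  by apply: eq_intble gi2 => x _; rewrite /paste; case: ifP.
- by split; [rewrite /paste pm|rewrite paste_right].
- move=> x /andP[px xq]; rewrite /paste; case: (leP x m) => xm.
    by apply: b1; rewrite px.
  by apply: b2; rewrite xq ltW.
split.
- have [_] := int_paste pmq i1 i2.
  rewrite (_ : paste m _ _ = cost_density eps k (paste m t1 t2) (paste m g1 g2)).
    by move=> ->; rewrite mulrDr; exact: lerD.
  by apply/funext => x; rewrite /paste /cost_density; case: ifP.
- have [_] := int_paste pmq j1 j2.
  rewrite (_ : paste m _ _ = gap (paste m t1 t2)).
    by move=> ->; exact: lerD.
  by apply/funext => x; rewrite /paste /gap; case: ifP.
Qed.

Lemma le_profile eps k p q al be c e c' e' : c <= c' -> e <= e' ->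
  profile eps k p q al be c e -> profile eps k p q al be c' e'.
Proof.
move=> cc ee [tau [g [A L B C [D E]]]]; exists tau, g; split => //.
by split; [exact: le_trans cc|exact: le_trans ee].
Qed.

Lemma gap_bound p q tau D : - H <= p -> p <= q -> q <= H -> cont_on p q tau ->
  {ae mu, forall x, p <= x <= q -> gap tau x <= D} ->
  Intg p q (gap tau) <= D * (q - p).
Proof.
move=> Hp pq qH ctau gD; rewrite -int_cst //; apply: ae_le_int => //.
  exact: gap_intble.
exact: intble_cst.
Qed.

Lemma gap_le4 p q tau : - H <= p -> p <= q -> q <= H ->
  (forall x, p <= x <= q -> `|tau x| <= 1) ->
  {ae mu, forall x, p <= x <= q -> gap tau x <= 4}.
Proof.
move=> Hp pq qH t1.
have ends : {ae mu, forall x, p <= x <= q -> p < x < q} by exact: ae_segment.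
apply: ae_impl (ae_and (A0_sphere uA0) ends) => x [sph ins] pxq.
have /andP[px xq] := ins pxq.
have xH : - H < x < H by rewrite (le_lt_trans Hp px) (lt_le_trans xq qH).
have f1 : `|f x| <= 1.
  rewrite -(@ler_pXn2r _ 2) ?nnegrE // expr1n real_normK ?num_real //.
  by rewrite -(sph xH) lerDl sqr_ge0.
have st : `|s x * tau x| <= 1.
  rewrite normrM ger0_norm ?sinus_ge0 // -[leRHS]mulr1.
  by apply: ler_pM; rewrite ?sinus_ge0 ?sinus_le1 // t1.
have two : `|s x * tau x - f x| <= 2.
  by apply: le_trans (ler_normB _ _) _; apply: le_trans (lerD st f1) _; lra.
rewrite /gap -(real_normK (num_real _)) (_ : 4 = 2 ^+ 2 :> R); last by ring.
by rewrite lerXn2r ?nnegrE.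
Qed.

Lemma profile_cst eps k p q al D : - H <= p -> p <= q -> q <= H -> al ^+ 2 = 1 ->
  {ae mu, forall x, p <= x <= q -> gap (cst al) x <= D} ->
  profile eps k p q al al 0 (D * (q - p)).
Proof.
move=> Hp pq qH al1 gD; exists (cst al), (cst 0); split => //.
- exact: AC_cst.
- exact/cont_on_L2on/cont_on_cst.
- move=> x _ /=; rewrite -(@ler_pXn2r _ 2) ?nnegrE // expr1n.
  by rewrite real_normK ?num_real // al1.
split; last by apply: gap_bound => //; exact: cont_on_cst.
rewrite (@eq_int _ _ _ _ (cst 0)) ?int_cst ?mul0r ?mulr0 // => x _.
by rewrite /cost_density /= al1 subrr !expr0n /= !mulr0 addr0.
Qed.

Lemma profile_flip eps k p q m al : - H <= p -> p < q -> q <= H -> al ^+ 2 = 1 ->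
  0 < eps -> 0 <= k -> 0 < m ->
  (forall x, p <= x <= q -> s x ^+ 2 + k <= m ^+ 2) ->
  profile eps k p q (- al) al
    ((1 + eps / (m * ((q - p) / 2))) ^+ 2 * (4 / 3 * m ^+ 3)) (4 * (q - p)).
Proof.
move=> Hp pq qH al1 eps0 k0 m0 sm.
have [tau [g [A cg [tp tq] t1 C]]] := tanh_window pq eps0 m0.
have cs : cont_on p q s by apply: cont_on_sub (cont_on_sinus H0 uA0).
have nal : `|al| = 1.
  by apply/eqP; rewrite -(@eqrXn2 _ 2) // expr1n real_normK ?num_real // al1.
have at1 x : p <= x <= q -> `|al * tau x| <= 1.
  by move=> /t1; rewrite normrM nal mul1r.
exists (fun x => al * tau x), (fun x => al * g x); split => //.
- exact: AC_Z.
- exact/L2onZ/cont_on_L2on.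
- by rewrite tp tq mulrN mulr1.
split; last first.
  apply: gap_bound; rewrite ?(ltW pq) //; first exact/AC_cont_on/(AC_Z al A).
  by apply: gap_le4 => //; exact: ltW.
apply: le_trans (C (fun x => s x ^+ 2 + k) (fun x => s x ^+ 4) _ _ _ _).
- rewrite (@eq_int _ _ _ _ (fun x => eps * ((s x ^+ 2 + k) * g x ^+ 2) +
    eps^-1 * (s x ^+ 4 * (1 - tau x ^+ 2) ^+ 2))) // => x _.
  by rewrite /cost_density !exprMn al1 !mul1r.
- by apply: cont_onD; [exact: cont_onX|exact: cont_on_cst].
- exact: cont_onX.
- by move=> x xpq; rewrite addr_ge0 ?sqr_ge0 // sm.
- move=> x xpq; rewrite exprn_ge0 ?sinus_ge0 //=.
  rewrite lerXn2r ?nnegrE ?sinus_ge0 ?(ltW m0) //.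
  rewrite -(@ler_pXn2r _ 2) ?nnegrE ?sinus_ge0 ?(ltW m0) //.
  by apply: le_trans (sm x xpq); rewrite lerDl.
Qed.

End profiles.

(** * Optimal cost of joining prescribed signs *)

Section reachability.
Context {R : realType}.
Implicit Types (S w th C e : R).

(** The terms containing [w] sum to at most [7 * w], and [4 / 3 * 7] is half of [56 / 3]. *)
Lemma cube_perturb S w e : 0 <= S <= 1 -> 0 < w <= 1 -> 56 / 3 * w <= e ->
  4 / 3 * (S + w) ^+ 3 <= 4 / 3 * S ^+ 3 + e / 2.
Proof.
move=> /andP[S0 S1] /andP[w0 w1] we.
have S2 : S ^+ 2 <= 1 by rewrite exprn_ile1.
have w2 : w ^+ 2 <= w by rewrite expr2 ger_pMr.
have h1 : S ^+ 2 * w <= w by rewrite ger_pMl.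
have h2 : S * w ^+ 2 <= w by apply: le_trans w2; rewrite ler_piMl ?sqr_ge0.
have h3 : w * w ^+ 2 <= w by apply: le_trans w2; rewrite ler_piMl ?sqr_ge0.
have -> : (S + w) ^+ 3 = S ^+ 3 + 3 * (S ^+ 2 * w) + 3 * (S * w ^+ 2) + w * w ^+ 2.
  by ring.
lra.
Qed.

(** The excess is at most [3 * th * C <= 32 * th]; the bound [32 / 3] on [C] is [4 / 3 * 2^3], for
    an amplitude at most 2. *)
Lemma square_perturb th C e : 0 <= th <= 1 -> 0 <= C <= 32 / 3 -> 64 * th <= e ->
  (1 + th) ^+ 2 * C <= C + e / 2.
Proof.
move=> /andP[th0 th1] /andP[C0 C1] te.
have h1 : th * C <= 32 / 3 * th by rewrite mulrC ler_wpM2r.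
have h2 : th * (th * C) <= th * C by rewrite ler_piMl ?mulr_ge0.
have -> : (1 + th) ^+ 2 * C = C + 2 * (th * C) + th * (th * C) by ring.
lra.
Qed.

Context (H a : R) (u : R -> R * R) (H0 : 0 < H) (uA0 : A0 H a u).
Implicit Types (p q x y z d l sg al be ga : R).

Local Notation mu := (@lebesgue_measure R).
Local Notation f := (comp1 u).
Local Notation s := (sinus u).
Local Ltac hlra := move: (H0); lra.

(** This form gives 0 for equal signs and [4 / 3 * s^3] for opposite ones, and matches the boundary
    terms of the limit energy. *)
Let flip_cost al be z := 6^-1 * `|be * s z - al * s z| ^+ 3.

Let sign_eq al be : al ^+ 2 = 1 -> be ^+ 2 = 1 -> be = al \/ be = - al.
Proof. by move=> <- /eqP; rewrite eqf_sqr => /orP[/eqP|/eqP]; [left|right]. Qed.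

Let flip_cost_eq z be : be ^+ 2 = 1 -> flip_cost (- be) be z = 4 / 3 * s z ^+ 3.
Proof.
move=> be1; rewrite /flip_cost (_ : be * s z - - be * s z = be * (2 * s z)); last by ring.
have nbe : `|be| = 1.
  by apply/eqP; rewrite -(@eqrXn2 _ 2) // expr1n real_normK ?num_real // be1.
by rewrite normrM nbe mul1r ger0_norm ?mulr_ge0 ?sinus_ge0 //; field.
Qed.

(** If the signs differ, the amplitude is frozen at [m = s z + w], which dominates [s] on every
    window near [z] by continuity. The window is fixed before [eps], so [e0] may depend on its
    length. *)
Lemma profile_flip_near z e al be : - H <= z <= H -> 0 < e ->
  al ^+ 2 = 1 -> be ^+ 2 = 1 ->
  exists2 d, 0 < d & forall p q, - H <= p -> p < q -> q <= H ->
    `|p - z| <= d -> `|q - z| <= d ->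
    exists2 e0, 0 < e0 & forall eps k, 0 < eps < e0 -> 0 <= k < e0 ->
      profile u eps k p q al be (flip_cost al be z + e) (4 * (q - p)).
Proof.
move=> zH e0 al1 be1; have [bal|bal] := sign_eq al1 be1.
  exists 1 => // p q Hp pq qH _ _; exists 1 => // eps k _ _.
  rewrite bal; apply: le_profile (profile_cst H0 uA0 eps k Hp (ltW pq) qH al1 _) => //.
    by rewrite /flip_cost subrr normr0 expr0n mulr0 add0r ltW.
  apply: (gap_le4 uA0) => //; first exact: ltW.
  move=> x _ /=; rewrite -(@ler_pXn2r _ 2) ?nnegrE // expr1n.
  by rewrite real_normK ?num_real // al1.
have -> : al = - be by rewrite bal opprK.
pose S := s z; have S0 : 0 <= S by exact: sinus_ge0.
have S1 : S <= 1 by exact: sinus_le1.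
pose w := Num.min 1 (3 / 56 * e).
have w0 : 0 < w by rewrite lt_min ltr01 mulr_gt0.
have w1 : w <= 1 by rewrite ge_min lexx.
have we : 56 / 3 * w <= e.
  have : w <= 3 / 56 * e by rewrite ge_min lexx orbT.
  lra.
clearbody w.
have w20 : 0 < w / 2 by rewrite divr_gt0.
have [d d0 dP] := cont_on_sinus H0 uA0 zH w20.
exists (d / 2); first by rewrite divr_gt0.
move=> p q Hp pq qH pz qz.
pose m := S + w; have m0 : 0 < m by rewrite ltr_wpDl.
pose h := (q - p) / 2; have h0 : 0 < h by rewrite divr_gt0 ?subr_gt0.
have w2 : 0 < w ^+ 2 / 2 by rewrite divr_gt0 ?exprn_gt0.
have mh0 : 0 < m * h by exact: mulr_gt0.
have e10 : 0 < Num.min 1 (e / 64) by rewrite lt_min ltr01 divr_gt0.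
(* The bound on [k] keeps [s^2 + k] below [m^2]; the one on [eps] keeps the stretching excess
   [eps / (m * h)] below [min 1 (e / 64)]. *)
exists (Num.min (w ^+ 2 / 2) (m * h * Num.min 1 (e / 64))).
  by rewrite lt_min w2 mulr_gt0.
move=> eps k /andP[eps0 +] /andP[k0 +]; rewrite !lt_min => /andP[_ epsh] /andP[kw _].
apply: le_profile (profile_flip H0 uA0 (eps := eps) (k := k) (m := m) Hp pq qH be1 _ _ _ _);
  rewrite ?lexx //; last first.
  move=> x xpq; apply: (@le_trans _ _ ((S + w / 2) ^+ 2 + k)).
    rewrite lerD2r lerXn2r ?nnegrE ?sinus_ge0 ?addr_ge0 ?(ltW w20) //.
    have xz : `|x - z| < d.
      move: pz qz; rewrite !ler_norml ltr_norml => pz qz.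
      by lra.
    have xH : - H <= x <= H.
      by case/andP: xpq => px xq; rewrite (le_trans Hp px) (le_trans xq qH).
    by have := dP x xH xz; rewrite ltr_norml -/S; lra.
  have Sw : 0 <= S * w by rewrite mulr_ge0 // ltW.
  have -> : m ^+ 2 = (S + w / 2) ^+ 2 + (S * w + w ^+ 2 / 2 + w ^+ 2 / 4).
    by rewrite /m; field.
  rewrite lerD2l; apply: le_trans (ltW kw) _; have := sqr_ge0 w; lra.
rewrite flip_cost_eq // -/S -/h.
pose th := eps / (m * h).
have th0 : 0 <= th by rewrite divr_ge0 ?ltW.
have the : th <= Num.min 1 (e / 64) by rewrite ler_pdivrMr // mulrC ltW.
move: the; rewrite le_min => /andP[th1 the].
have sw := cube_perturb (e := e) (S := S) (w := w) ltac:(by rewrite S0) ltac:(by rewrite w0) we.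
have C1 : 4 / 3 * m ^+ 3 <= 32 / 3.
  have : m ^+ 3 <= 2 ^+ 3.
    by rewrite lerXn2r ?nnegrE ?(ltW m0) // /m; apply: le_trans (lerD S1 w1) _; lra.
  lra.
have C0 : 0 <= 4 / 3 * m ^+ 3 by rewrite mulr_ge0 // exprn_ge0 // ltW.
have th64 : 64 * th <= e by lra.
have := square_perturb (e := e) (th := th) (C := 4 / 3 * m ^+ 3)
  ltac:(by rewrite th0) ltac:(by rewrite C0) th64.
rewrite -/th => h1; apply: le_trans h1 _; rewrite /m; lra.
Qed.

Context (dl : R).

(** Where [sinus] is small the sign of [u_1] is not followed, so a squared distance of [4 * dl^2]
    per unit length is conceded; [dl] is chosen small only in the recovery. *)
Definition reach p q al be c := forall e, 0 < e -> exists2 e0, 0 < e0 &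
  forall eps k, 0 < eps < e0 -> 0 <= k < e0 ->
    profile u eps k p q al be (c + e) (4 * dl ^+ 2 * (q - p) + e).

Lemma reach_cat p m q al ga be c1 c2 : - H <= p -> p <= m -> m <= q -> q <= H ->
  reach p m al ga c1 -> reach m q ga be c2 -> reach p q al be (c1 + c2).
Proof.
move=> Hp pm mq qH r1 r2 e e0.
have e20 : 0 < e / 2 by rewrite divr_gt0.
have [d1 d10 P1] := r1 _ e20; have [d2 d20 P2] := r2 _ e20.
exists (Num.min d1 d2); first by rewrite lt_min d10.
move=> eps k /andP[eps0 +] /andP[k0 +]; rewrite !lt_min => /andP[e1 e2] /andP[k1 k2].
have h1 := P1 eps k ltac:(by rewrite eps0) ltac:(by rewrite k0).
have h2 := P2 eps k ltac:(by rewrite eps0) ltac:(by rewrite k0).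
apply: le_profile (profile_paste H0 uA0 Hp pm mq qH h1 h2).
  lra.
by rewrite le_eqVlt; apply/orP; left; apply/eqP; field.
Qed.

(** The sign [sg] is held in the middle; short windows at the ends carry the changes from [al] and
    to [be], at the cost that [sinus] has there. *)
Lemma reach_flat x y sg al be : - H <= x -> x < y -> y <= H ->
  sg ^+ 2 = 1 -> al ^+ 2 = 1 -> be ^+ 2 = 1 ->
  {ae mu, forall t, x <= t <= y -> gap u (cst sg) t <= 4 * dl ^+ 2} ->
  reach x y al be (flip_cost al sg x + flip_cost sg be y).
Proof.
move=> Hx xy yH sg1 al1 be1 flat e e0.
have e20 : 0 < e / 2 by rewrite divr_gt0.
have xH : - H <= x <= H by rewrite Hx (le_trans (ltW xy)).
have yH' : - H <= y <= H by rewrite yH (le_trans Hx) // ltW.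
have [d1 d10 P1] := profile_flip_near xH e20 al1 sg1.
have [d2 d20 P2] := profile_flip_near yH' e20 sg1 be1.
(* A window of length [r] has a gap of at most [4 * r], and there are two, hence [e / 8]; a third of
   [y - x] keeps them apart. *)
pose r := Num.min (Num.min d1 d2) (Num.min ((y - x) / 3) (e / 8)).
have r0 : 0 < r by rewrite !lt_min d10 d20 !divr_gt0 ?subr_gt0.
have [r1 [r2 [r3 r4]]] : r <= d1 /\ r <= d2 /\ r <= (y - x) / 3 /\ r <= e / 8.
  by rewrite /r !ge_min !lexx !orbT.
clearbody r.
pose x1 := x + r; pose y1 := y - r.
have xx1 : x < x1 by rewrite /x1 ltrDl.
have y1y : y1 < y by rewrite /y1 ltrBlDr ltrDl.
have x1y1 : x1 < y1 by rewrite /x1 /y1; lra.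
have x1H : x1 <= H by rewrite (le_trans (ltW x1y1)) // (le_trans (ltW y1y)).
have Hy1 : - H <= y1 by rewrite (le_trans Hx) // (le_trans (ltW xx1)) // ltW.
have nx1 : `|x1 - x| <= d1 by rewrite /x1 addrAC subrr add0r gtr0_norm.
have ny1 : `|y1 - y| <= d2.
  by rewrite /y1 addrAC subrr add0r normrN gtr0_norm.
have nx : `|x - x| <= d1 by rewrite subrr normr0 ltW.
have ny : `|y - y| <= d2 by rewrite subrr normr0 ltW.
have [a1 a10 Q1] := P1 x x1 Hx xx1 x1H nx nx1.
have [a2 a20 Q2] := P2 y1 y Hy1 y1y yH ny1 ny.
exists (Num.min a1 a2); first by rewrite lt_min a10.
move=> eps k /andP[eps0 +] /andP[k0 +]; rewrite !lt_min => /andP[e1 e2] /andP[k1 k2].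
have h1 := Q1 eps k ltac:(by rewrite eps0) ltac:(by rewrite k0).
have h2 := Q2 eps k ltac:(by rewrite eps0) ltac:(by rewrite k0).
have Hx1 : - H <= x1 by rewrite (le_trans Hx) // ltW.
have y1H : y1 <= H by rewrite (le_trans (ltW y1y)).
have flat' : {ae mu, forall t, x1 <= t <= y1 -> gap u (cst sg) t <= 4 * dl ^+ 2}.
  apply: ae_impl flat => t h /andP[t1 t2]; apply: h.
  by rewrite (le_trans (ltW xx1)) // (le_trans t2) // ltW.
have h3 := profile_cst H0 uA0 eps k Hx1 (ltW x1y1) y1H sg1 flat'.
have h13 := profile_paste H0 uA0 Hx (ltW xx1) (ltW x1y1) y1H h1 h3.
apply: le_profile (profile_paste H0 uA0 Hx (ltW (lt_trans xx1 x1y1)) (ltW y1y) yH h13 h2).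
  by rewrite le_eqVlt; apply/orP; left; apply/eqP; field.
have D0 := sqr_ge0 dl.
have : 4 * dl ^+ 2 * (y1 - x1) <= 4 * dl ^+ 2 * (y - x).
  by apply: ler_wpM2l; [exact: mulr_ge0|rewrite /x1 /y1; lra].
have -> : x1 - x = r by rewrite /x1 addrAC subrr add0r.
have -> : y - y1 = r by rewrite /y1 opprB addrC subrK.
move: (4 * dl ^+ 2 * (y1 - x1)) (4 * dl ^+ 2 * (y - x)) => A B AB; lra.
Qed.

Local Notation J := (jump_set H f).
Local Notation jumps A := (\esum_(y in J `&` A) (s y ^+ 3)%:E)%E.

Let cube_ge0 y : (0 <= (s y ^+ 3)%:E)%E.
Proof. by rewrite lee_fin exprn_ge0 // sinus_ge0. Qed.

Lemma jumps_cat x y z : x < y -> y < z ->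
  (jumps `]x, y[%classic + jumps [set y] + jumps `]y, z[%classic <=
   jumps `]x, z[%classic)%E.
Proof.
have pos (A : set R) i : (0 <= if i \in J `&` A then (s i ^+ 3)%:E else 0)%E.
  by case: ifP.
move=> xy yz; rewrite !(esum_mkcond (_ `&` _)).
rewrite -esumD; [|by move=> i _; exact: pos..].
rewrite -esumD; [|by move=> i _; apply: adde_ge0; exact: pos|by move=> i _; exact: pos].
apply: le_esum => i _; have [Ji|nJ] := pselect (J i); last first.
  by rewrite !memNset ?adde0 // => -[].
have inJ (A : set R) : (i \in J `&` A) = (i \in A).
  by rewrite in_setI (mem_set Ji).
have initv p q : (i \in `]p, q[%classic) = (p < i < q).
  by apply/idP/idP; rewrite inE /= in_itv.
have in1 : (i \in [set y]) = (i == y) by apply/idP/eqP; rewrite inE.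
rewrite !inJ !initv in1; have [iy|yi|->] := ltgtP i y.
- by rewrite (lt_trans iy yz) andbT /= !adde0.
- by rewrite (lt_trans xy yi) andbF /= !add0e.
- by rewrite xy yz andbF /= add0e adde0.
Qed.

(** The bound is the limit energy of the interval without its derivative term, for boundary values
    [al * s p] and [be * s q]. Since all signs are allowed, two intervals can be joined at whichever
    sign is cheapest. *)
Definition good p q := forall al be, al ^+ 2 = 1 -> be ^+ 2 = 1 ->
  exists2 c, reach p q al be c &
    (c%:E <= (6^-1 * `|right_limit f p - al * s p| ^+ 3)%:E +
      (4 / 3)%:E * jumps `]p, q[%classic +
      (6^-1 * `|left_limit f q - be * s q| ^+ 3)%:E)%E.

Let sign_exists l y : l = s y \/ l = - s y ->
  exists2 sg, sg ^+ 2 = 1 & l = sg * s y.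
Proof.
by move=> [->|->]; [exists 1|exists (-1)]; rewrite ?sqrrN ?expr1n // ?mul1r ?mulN1r.
Qed.

(** Join at the sign [ga] of the left limit: the left interval pays nothing at [y], and the right
    one pays for the jump at [y], if there is one. *)
Lemma good_cat x y z : - H <= x -> x < y -> y < z -> z <= H ->
  good x y -> good y z -> good x z.
Proof.
move=> Hx xy yz zH G1 G2 al be al1 be1.
have yH : - H < y < H by rewrite (le_lt_trans Hx xy) (lt_le_trans yz zH).
have [l1 f1 l1E] := A0_llim H0 uA0 (y := y) ltac:(by case/andP: yH => -> /ltW).
have [l2 f2 l2E] := A0_rlim H0 uA0 (y := y) ltac:(by case/andP: yH => /ltW ->).
have [ga ga1 l1ga] := sign_exists l1E.
have [c1 r1 h1] := G1 al ga al1 ga1.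
have [c2 r2 h2] := G2 ga be ga1 be1.
exists (c1 + c2).
  by apply: reach_cat r1 r2 => //; exact: ltW.
move: h1 h2; rewrite (llim_left_limit f1) (rlim_right_limit f2).
rewrite {1}l1ga subrr normr0 expr0n mulr0 adde0.
set A := (6^-1 * _)%:E; set B := (6^-1 * `|left_limit f z - _| ^+ 3)%:E.
move=> h1 h2.
have jump : ((6^-1 * `|l2 - ga * s y| ^+ 3)%:E <= (4 / 3)%:E * jumps [set y])%E.
  rewrite -l1ga; have [e|ne] := eqVneq l2 l1.
    rewrite e subrr normr0 expr0n mulr0; apply: mule_ge0; first by rewrite lee_fin.
    by apply: esum_ge0 => i _.
  have -> : J `&` [set y] = [set y].
    apply/seteqP; split => [i [] //|i /= ->]; split => //; split.
      by rewrite /dom /= in_itv.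
    by rewrite (llim_left_limit f1) (rlim_right_limit f2); apply/eqP; rewrite eq_sym.
  rewrite esum_set1 // -EFinM lee_fin.
  have [ga2 ga21 l2ga] := sign_exists l2E; rewrite l2ga l1ga in ne *.
  have [e|->] := sign_eq ga1 ga21; first by rewrite e eqxx in ne.
  by rewrite distrC -(flip_cost_eq y ga1) /flip_cost mulNr.
rewrite EFinD; apply: le_trans (leeD h1 h2) _.
have cat := jumps_cat xy yz.
have cat' : ((4 / 3)%:E * jumps `]x, y[%classic + (4 / 3)%:E * jumps [set y] +
    (4 / 3)%:E * jumps `]y, z[%classic <= (4 / 3)%:E * jumps `]x, z[%classic)%E.
  have j0 (A' : set R) : (0 <= jumps A')%E by apply: esum_ge0 => i _.
  rewrite -ge0_muleDr ?j0 // -ge0_muleDr ?adde_ge0 ?j0 //.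
  by apply: lee_wpmul2l => //; rewrite lee_fin.
apply: (@le_trans _ _ (A + ((4 / 3)%:E * jumps `]x, y[%classic +
  (4 / 3)%:E * jumps [set y] + (4 / 3)%:E * jumps `]y, z[%classic + B))%E).
  rewrite -!addeA; apply: leeD2l; apply: leeD2l; exact: leeD2r jump.
by rewrite addeA; apply: leeD2r; apply: leeD2l.
Qed.

Let jumps_ge0 (A : set R) : (0 <= (4 / 3)%:E * jumps A)%E.
Proof.
by apply: mule_ge0; [rewrite lee_fin|apply: esum_ge0 => i _].
Qed.

(** A change of sign is free where [sinus] vanishes, so it is made at that end; in between either
    sign errs by at most [2 * sinus]. *)
Lemma good_of_small_sinus x y : - H <= x -> x < y -> y <= H ->
  s x = 0 \/ s y = 0 -> (forall t, x <= t <= y -> s t <= dl) -> good x y.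
Proof.
move=> Hx xy yH sxy sdl al be al1 be1.
have ends : {ae mu, forall t, x <= t <= y -> x < t < y} by exact: ae_segment.
have flat sg : sg ^+ 2 = 1 ->
    {ae mu, forall t, x <= t <= y -> gap u (cst sg) t <= 4 * dl ^+ 2}.
  move=> sg1; apply: ae_impl (ae_and (A0_sphere uA0) ends) => t [sph ins] xty.
  have /andP[xt ty] := ins xty.
  have tH : - H < t < H by rewrite (le_lt_trans Hx xt) (lt_le_trans ty yH).
  have tH' : - H <= t <= H by case/andP: tH => /ltW -> /ltW.
  have := sinus_sqr H0 uA0 tH'; have := sph tH; rewrite /gap /=.
  have s2 : s t ^+ 2 <= dl ^+ 2.
    rewrite lerXn2r ?nnegrE ?sinus_ge0 ?sdl //.
    exact: le_trans (sinus_ge0 u t) (sdl t xty).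
  move=> e1 e2; have f2 : f t ^+ 2 = s t ^+ 2 by rewrite e2 -e1 addrK.
  have : 0 <= (s t * sg + f t) ^+ 2 by exact: sqr_ge0.
  have -> : (s t * sg - f t) ^+ 2 =
      2 * (s t ^+ 2 * sg ^+ 2 + f t ^+ 2) - (s t * sg + f t) ^+ 2 by ring.
  rewrite sg1 f2 mulr1; move: (s t ^+ 2) s2 ((_ + _) ^+ 2) => A AB B; lra.
have pos c : c = 0 -> (c%:E <= (6^-1 * `|right_limit f x - al * s x| ^+ 3)%:E +
    (4 / 3)%:E * jumps `]x, y[%classic +
    (6^-1 * `|left_limit f y - be * s y| ^+ 3)%:E)%E.
  by move=> ->; apply: adde_ge0; [apply: adde_ge0 => //|];
    rewrite lee_fin mulr_ge0 ?exprn_ge0.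
have [s0|s0] := sxy.
  exists (flip_cost al be x + flip_cost be be y).
    by apply: reach_flat => //; exact: flat.
  by apply: pos; rewrite /flip_cost s0 !mulr0 !subrr normr0 expr0n mulr0 addr0.
exists (flip_cost al al x + flip_cost al be y).
  by apply: reach_flat => //; exact: flat.
by apply: pos; rewrite /flip_cost s0 !mulr0 !subrr normr0 expr0n mulr0 addr0.
Qed.

(** Here [f = sg * s] a.e. and in both one-sided limits, so holding [sg] has no gap, and the changes
    at the ends cost exactly the boundary terms. *)
Lemma good_of_constant_sign x y sg S : - H <= x -> x < y -> y <= H ->
  sg ^+ 2 = 1 -> 0 < S -> (forall t, x < t < y -> `|f t - sg * S| < S / 2) ->
  good x y.
Proof.
move=> Hx xy yH sg1 S0 fS al be al1 be1.
have nsg : `|sg| = 1.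
  by apply/eqP; rewrite -(@eqrXn2 _ 2) // expr1n real_normK ?num_real // sg1.
(* The opposite value [- sg * s z] lies at distance [s z + S] from [sg * S], which is not below
   [S]. *)
have sgn l z : l = s z \/ l = - s z -> `|l - sg * S| < S -> l = sg * s z.
  move=> /sign_exists[sg' sg'1 ->]; have [->//|->] := sign_eq sg1 sg'1.
  rewrite (_ : - sg * s z - sg * S = - (sg * (s z + S))); last by ring.
  rewrite normrN normrM nsg mul1r ger0_norm ?addr_ge0 ?sinus_ge0 ?(ltW S0) //.
  by rewrite gtrDr ltNge sinus_ge0.
have S2 : 0 < S / 2 by rewrite divr_gt0.
have xH : - H <= x < H by rewrite Hx (lt_le_trans xy yH).
have yH' : - H < y <= H by rewrite yH (le_lt_trans Hx xy).
have [l fl lE] := A0_rlim H0 uA0 xH.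
have [l' fl' lE'] := A0_llim H0 uA0 yH'.
have lx : l = sg * s x.
  apply: sgn => //; have [d d0 dP] := fl _ S2.
  have [t] : exists t, x < t < Num.min y (x + d).
    have : x < Num.min y (x + d) by rewrite lt_min xy ltrDl.
    by move=> h; exists ((x + Num.min y (x + d)) / 2); rewrite !midf_lt.
  rewrite lt_min => /and3P[xt ty td].
  have := dP t ltac:(by rewrite xt); have := fS t ltac:(by rewrite xt).
  rewrite -(distrC l) => h1 h2.
  rewrite (_ : l - _ = (l - f t) + (f t - sg * S)); last by ring.
  by rewrite [ltRHS]splitr; apply: le_lt_trans (ler_normD _ _) (ltrD h2 h1).
have ly : l' = sg * s y.
  apply: sgn => //; have [d d0 dP] := fl' _ S2.
  have [t] : exists t, Num.max x (y - d) < t < y.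
    have : Num.max x (y - d) < y by rewrite gt_max xy ltrBlDr ltrDl.
    by move=> h; exists ((Num.max x (y - d) + y) / 2); rewrite !midf_lt.
  rewrite gt_max -andbA => /and3P[xt td ty].
  have := dP t ltac:(by rewrite td); have := fS t ltac:(by rewrite xt).
  rewrite -(distrC l') => h1 h2.
  rewrite (_ : l' - _ = (l' - f t) + (f t - sg * S)); last by ring.
  by rewrite [ltRHS]splitr; apply: le_lt_trans (ler_normD _ _) (ltrD h2 h1).
exists (flip_cost al sg x + flip_cost sg be y).
  apply: reach_flat => //.
  have ends : {ae mu, forall t, x <= t <= y -> x < t < y} by exact: ae_segment.
  apply: ae_impl (ae_and (A0_sphere uA0) ends) => t [sph ins] xty.
  have /andP[xt ty] := ins xty.
  have tH : - H < t < H by rewrite (le_lt_trans Hx xt) (lt_le_trans ty yH).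
  have tH' : - H <= t <= H by case/andP: tH => /ltW -> /ltW.
  have ft : f t = sg * s t.
    apply: sgn; last by apply: lt_trans (fS t (ins xty)) _; rewrite ltr_pdivrMr // ltr_pMr // ltr1n.
    have /eqP : f t ^+ 2 = s t ^+ 2.
      by rewrite (sinus_sqr H0 uA0 tH') -(sph tH) addrK.
    by rewrite eqf_sqr => /orP[/eqP|/eqP]; [left|right].
  rewrite /gap /= ft mulrC subrr expr0n /= mulr_ge0 ?sqr_ge0 //.
rewrite (rlim_right_limit fl) (llim_left_limit fl') lx ly EFinD /flip_cost.
rewrite (distrC (be * s y)); apply: leeD2r; rewrite leeDl //.
Qed.

Lemma good_right x : 0 < dl -> - H <= x < H ->
  exists2 d, 0 < d & forall y, x < y -> y < x + d -> y <= H -> good x y.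
Proof.
move=> dl0 /andP[Hx xH]; have xH' : - H <= x <= H by rewrite Hx ltW.
have [s0|s0] := eqVneq (s x) 0.
  have [d d0 dP] := cont_on_sinus H0 uA0 xH' dl0.
  exists d => // y xy yd yH; apply: good_of_small_sinus => //; first by left.
  move=> t /andP[xt ty]; have tH : - H <= t <= H.
    by rewrite (le_trans Hx xt) (le_trans ty yH).
  have tx : `|t - x| < d.
    by rewrite ger0_norm ?subr_ge0 // ltrBlDl (le_lt_trans ty).
  by have := dP t tH tx; rewrite s0 subr0 => /(le_lt_trans (ler_norm _))/ltW.
have S0 : 0 < s x by rewrite lt_neqAle eq_sym s0 sinus_ge0.
have [l fl lE] := A0_rlim H0 uA0 (y := x) ltac:(by rewrite Hx).
have [sg sg1 lsg] := sign_exists lE.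
have [d d0 dP] := fl (s x / 2) ltac:(by rewrite divr_gt0).
exists d => // y xy yd yH; apply: (@good_of_constant_sign x y sg (s x)) => //.
by move=> t /andP[xt ty]; rewrite -lsg; apply: dP; rewrite xt (lt_trans ty).
Qed.

Lemma good_left x : 0 < dl -> - H < x <= H ->
  exists2 d, 0 < d & forall y, x - d < y -> y < x -> - H <= y -> good y x.
Proof.
move=> dl0 /andP[Hx xH]; have xH' : - H <= x <= H by rewrite xH ltW.
have [s0|s0] := eqVneq (s x) 0.
  have [d d0 dP] := cont_on_sinus H0 uA0 xH' dl0.
  exists d => // y yd yx Hy; apply: good_of_small_sinus => //; first by right.
  move=> t /andP[yt tx]; have tH : - H <= t <= H.
    by rewrite (le_trans Hy yt) (le_trans tx xH).
  have tx' : `|t - x| < d.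
    rewrite ler0_norm ?subr_le0 // opprB ltrBlDr -ltrBlDl.
    exact: lt_le_trans yt.
  by have := dP t tH tx'; rewrite s0 subr0 => /(le_lt_trans (ler_norm _))/ltW.
have S0 : 0 < s x by rewrite lt_neqAle eq_sym s0 sinus_ge0.
have [l fl lE] := A0_llim H0 uA0 (y := x) ltac:(by rewrite Hx).
have [sg sg1 lsg] := sign_exists lE.
have [d d0 dP] := fl (s x / 2) ltac:(by rewrite divr_gt0).
exists d => // y yd yx Hy; apply: (@good_of_constant_sign y x sg (s x)) => //.
by move=> t /andP[yt tx]; rewrite -lsg; apply: dP; rewrite tx (lt_trans yd).
Qed.

Lemma good_whole : 0 < dl -> good (- H) H.
Proof.
move=> dl0; apply: cousin_lemma.
- by rewrite gtrN.
- by move=> x y z; exact: good_cat.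
- by move=> x; exact: good_right.
- by move=> x; exact: good_left.
Qed.

End reachability.

(** * From a sign profile to an admissible field *)

Section recovery_fields.
Context {R : realType}.
Implicit Types (p q x y k c e r mu : R) (f g h : R -> R).

Lemma cont_on_inv p q f : (forall x, p <= x <= q -> f x != 0) ->
  cont_on p q f -> cont_on p q (fun x => (f x)^-1).
Proof.
move=> f0 /cont_onP/subspace_continuousP cf; apply/cont_onP/subspace_continuousP.
move=> x xpq; apply: cvgV; last exact: cf.
by apply: f0; move: xpq; rewrite /= in_itv.
Qed.

Lemma cont_on_sqrt p q f : cont_on p q f -> cont_on p q (fun x => Num.sqrt (f x)).
Proof.
move=> /cont_onP/subspace_continuousP cf; apply/cont_onP/subspace_continuousP.
by move=> x xpq; exact: (cvg_comp _ _ (cf x xpq) (@sqrt_continuous R _)).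
Qed.

(** With roots [A] at [x] and [B] at [y], the remainder is [-(B - A)^2 / (2 A)], and
    [(B - A)^2 <= (B^2 - A^2)^2 / A^2] explains the constant [1 / (2 A^3)]. *)
Lemma AC_sqrt p q f g : (forall x, p <= x <= q -> 0 < f x) -> ACon p q f g ->
  ACon p q (fun x => Num.sqrt (f x)) (fun x => (2 * Num.sqrt (f x))^-1 * g x).
Proof.
move=> f0 fg; have cr := cont_on_sqrt (AC_cont_on fg).
have r0 x : p <= x <= q -> 0 < Num.sqrt (f x) by move=> xpq; rewrite sqrtr_gt0 f0.
apply: AC_chain_quadratic fg _ _.
  apply: cont_on_inv; last exact: cont_onZ.
  by move=> x xpq; rewrite gt_eqF // mulr_gt0 ?r0.
move=> x xpq; exists ((2 * Num.sqrt (f x) ^+ 3)^-1).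
  by rewrite invr_gt0 mulr_gt0 ?exprn_gt0 ?r0.
move=> y ypq; rewrite -[X in _ * (X - _)]sqr_sqrtr ?(ltW (f0 _ ypq)) //.
rewrite -[X in _ * (_ - X)]sqr_sqrtr ?(ltW (f0 _ xpq)) //.
rewrite -{3}[f y]sqr_sqrtr ?(ltW (f0 _ ypq)) // -{5}[f x]sqr_sqrtr ?(ltW (f0 _ xpq)) //.
have := r0 x xpq; have := r0 y ypq.
move: (Num.sqrt (f x)) (Num.sqrt (f y)) => A B B0 A0.
have -> : B - A - (2 * A)^-1 * (B ^+ 2 - A ^+ 2) = - ((2 * A)^-1 * (B - A) ^+ 2).
  by field; rewrite gt_eqF.
rewrite normrN ger0_norm; last first.
  by rewrite mulr_ge0 ?sqr_ge0 // invr_ge0 mulr_ge0 // ltW.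
have -> : (2 * A ^+ 3)^-1 * (B ^+ 2 - A ^+ 2) ^+ 2 =
    (2 * A)^-1 * ((B - A) ^+ 2 * ((B + A) / A) ^+ 2).
  by field; rewrite gt_eqF.
rewrite ler_pM2l ?invr_gt0 ?mulr_gt0 // ler_peMr ?sqr_ge0 // exprn_ege1 //.
by rewrite ler_pdivlMr // mul1r lerDr ltW.
Qed.

Lemma young r x y : 0 < r ->
  (x + y) ^+ 2 <= (1 + r) * x ^+ 2 + (1 + r^-1) * y ^+ 2.
Proof.
move=> r0; rewrite -subr_ge0.
have -> : (1 + r) * x ^+ 2 + (1 + r^-1) * y ^+ 2 - (x + y) ^+ 2 =
    r^-1 * (r * x - y) ^+ 2 by field; rewrite gt_eqF.
by rewrite mulr_ge0 ?sqr_ge0 // invr_ge0 ltW.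
Qed.

(* The regularised |u_1| stays away from zero where |u_2| = 1, because there
   the added term is k (1 - a^2)^2. *)
Lemma regularised_ge b k X : 0 < b <= 1 -> 0 < k <= 1 -> 0 <= X ->
  k * b ^+ 2 / 4 <= X + k * (X - b) ^+ 2.
Proof.
move=> /andP[b0 b1] /andP[k0 k1] X0.
have b2 : b ^+ 2 <= b by rewrite expr2 ger_pMr.
have kb2 : k * b ^+ 2 <= b by apply: le_trans b2; rewrite ger_pMl ?exprn_gt0.
have kX : 0 <= k * (X - b) ^+ 2 by rewrite mulr_ge0 ?sqr_ge0 // ltW.
have [Xb|Xb] := leP (b / 2) X; first by lra.
have h : b / 2 <= b - X by lra.
have : (b / 2) ^+ 2 <= (b - X) ^+ 2.
  by rewrite lerXn2r ?nnegrE //; lra.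
rewrite -(ler_pM2l k0) (_ : (b - X) ^+ 2 = (X - b) ^+ 2); last by ring.
have -> : k * (b / 2) ^+ 2 = k * b ^+ 2 / 4 by field.
by move=> ?; apply: ler_wpDl.
Qed.

Context (H L a : R) (u : R -> R * R) (H0 : 0 < H) (L0 : 0 < L).
Context (a1 : `|a| < 1) (uA0 : A0 H a u).

Local Notation f := (comp1 u).
Local Notation v := (comp2 u).
Local Notation s := (sinus u).
Local Notation g := (weak_derivative H v).
Local Notation G := (Intg (- H) H (fun x => weak_derivative H v x ^+ 2)).
Local Notation b := (1 - a ^+ 2).

Let b01 : 0 < b <= 1.
Proof.
have : a ^+ 2 < 1 by rewrite -(real_normK (num_real a)) exprn_ilt1.
by rewrite lerBlDr lerDl sqr_ge0 andbT subr_gt0.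
Qed.

(** Young's inequality with a free [m] separates the cost [c] from the errors of [rho]. With
    [eps = r^4] and [k = r^3], [18 * r * G / b^2] is half of [eps * 36 / (k * b^2) * G], and
    [r^2 * H] is half of [k^2 / eps] over the length [2 * H]. *)
Lemma recovery_field r tau gt c e : 0 < r <= 1 ->
  ACon (- H) H tau gt -> L2on (- H) H gt -> tau (- H) = -1 -> tau H = 1 ->
  (forall x, - H <= x <= H -> `|tau x| <= 1) ->
  2^-1 * Intg (- H) H (cost_density u (r ^+ 4) (r ^+ 3) tau gt) <= c ->
  Intg (- H) H (gap u tau) <= e ->
  exists w : R -> R * R, [/\ A1 H a w, comp2 w = comp2 u,
    forall m, 0 < m -> (E1D H L (r ^+ 4) w <=
      ((1 + m) * c + (1 + m^-1) * (18 * r * G / b ^+ 2 + r ^+ 2 * H) +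
       r ^+ 4 * G / 2 + dirichlet H L u)%:E)%E,
    intble (- H) H (fun x => (comp1 w x - f x) ^+ 2) &
    Intg (- H) H (fun x => (comp1 w x - f x) ^+ 2) <= 4 * H * r ^+ 3 + 2 * e].
Proof.
move=> /andP[r0 r1] tA gtL tm tp t1 costc gape.
have [vA gL] := A0_AC2 H0 uA0; have cv := AC_cont_on vA.
pose k := r ^+ 3; have k0 : 0 < k by rewrite exprn_gt0.
have k1 : k <= 1 by rewrite exprn_ile1 // ltW.
have /andP[b0 b1] := b01.
pose P x := 1 - v x ^+ 2 + k * (1 - v x ^+ 2 - b) ^+ 2.
pose dP x := - (2 * v x * g x) +
  k * (2 * (1 - v x ^+ 2 - b) * - (2 * v x * g x)).
have PA : ACon (- H) H P dP.
  have vv : ACon (- H) H (fun x => 1 - v x ^+ 2) (fun x => - (2 * v x * g x)).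
    have := AC_B (AC_cst (- H) H 1) (AC_sqr vA).
    by apply: eq_AC => x _ //=; rewrite sub0r.
  apply: AC_D => //; apply: AC_Z; apply: AC_sqr.
  have := AC_B vv (AC_cst (- H) H b).
  by apply: eq_AC => x _ //=; rewrite subr0.
have Pge x : - H <= x <= H -> k * b ^+ 2 / 4 <= P x.
  move=> xH; apply: regularised_ge; rewrite ?b0 ?k0 //.
  by rewrite subr_ge0 (A0_le1 H0 uA0).
have kb0 : 0 < k * b ^+ 2 / 4 by rewrite divr_gt0 // mulr_gt0 // exprn_gt0.
have P0 x : - H <= x <= H -> 0 < P x by move=> /Pge; exact: lt_le_trans.
pose rho x := Num.sqrt (P x).
have rho2 x : - H <= x <= H -> rho x ^+ 2 = P x.
  by move=> xH; rewrite sqr_sqrtr // ltW // P0.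
pose r1' x := - v x * (1 + 2 * k * (1 - v x ^+ 2 - b)) / rho x.
have rhoA : ACon (- H) H rho (fun x => r1' x * g x).
  apply: eq_AC (AC_sqrt P0 PA) => x xH //.
  rewrite /r1' /dP -/(rho x); field.
  by rewrite gt_eqF // sqrtr_gt0 P0.
have crho := AC_cont_on rhoA.
have cr1 : cont_on (- H) H r1'.
  apply: cont_onM; last first.
    by apply: cont_on_inv => // x xH; rewrite gt_eqF // sqrtr_gt0 P0.
  apply: cont_onM; first exact: cont_onN.
  apply: cont_onD; first exact: cont_on_cst.
  apply: cont_onZ; apply: cont_onB; last exact: cont_on_cst.
  by apply: cont_onB; [exact: cont_on_cst|exact: cont_onX].
have ct := AC_cont_on tA.
pose w1 x := rho x * tau x; pose g1 x := rho x * gt x + tau x * (r1' x * g x).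
have w1A : ACon (- H) H w1 g1 by exact: AC_M.
have g1L : L2on (- H) H g1.
  apply: L2onD; first exact: L2onM_cont.
  by apply: L2onM_cont => //; exact: L2onM_cont.
have X01 x : - H <= x <= H -> 0 <= 1 - v x ^+ 2 <= 1.
  by move=> xH; rewrite subr_ge0 (A0_le1 H0 uA0) //= lerBlDr lerDl sqr_ge0.
have Xb x : - H <= x <= H -> (1 - v x ^+ 2 - b) ^+ 2 <= 1.
  move=> /X01 X; rewrite -(real_normK (num_real _)) exprn_ile1 // ler_norml.
  by move: X b0 b1; move: (1 - v x ^+ 2) b => X b'; lra.
have t2 x : - H <= x <= H -> 0 <= tau x ^+ 2 <= 1.
  move=> xH; rewrite sqr_ge0 /= -(real_normK (num_real _)) exprn_ile1 //.
  exact: t1.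
have Psk x : - H <= x <= H -> P x <= s x ^+ 2 + k.
  move=> xH; rewrite (sinus_sqr H0 uA0) // lerD2l ger_pMr //; exact: Xb.
(* [36 = 9 * 4]: the numerator of [r1'] has square at most 9, and [rho^2 >= k * b^2 / 4]. *)
have rhop x : - H <= x <= H -> (r1' x * g x) ^+ 2 <= 36 / (k * b ^+ 2) * g x ^+ 2.
  move=> xH; rewrite exprMn ler_wpM2r ?sqr_ge0 //.
  rewrite exprMn exprVn (rho2 x xH) ler_pdivrMr ?P0 //.
  apply: (@le_trans _ _ 9); last first.
    have -> : 9 = 36 / (k * b ^+ 2) * (k * b ^+ 2 / 4).
      by field; rewrite !gt_eqF.
    by rewrite ler_pM2l ?Pge // divr_gt0 // mulr_gt0 // exprn_gt0.
  rewrite exprMn sqrrN.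
  have v1 := A0_le1 H0 uA0 xH.
  have : (1 + 2 * k * (1 - v x ^+ 2 - b)) ^+ 2 <= 9.
    have : `|1 - v x ^+ 2 - b| <= 1.
      by rewrite -(@ler_pXn2r _ 2) ?nnegrE // expr1n real_normK ?num_real // Xb.
    rewrite ler_norml; move: (1 - v x ^+ 2 - b) => z /andP[z0 z1].
    have : k * z <= 1 by apply: le_trans (_ : k * 1 <= 1); rewrite ?ler_pM2l ?mulr1.
    have : -1 <= k * z.
      by apply: (@le_trans _ _ (k * -1)); rewrite ?ler_pM2l // mulrN1 lerN2.
    by rewrite -mulrA; move: (k * z) => y; nra.
  by move=> h; rewrite -[leRHS]mul1r; apply: ler_pM; rewrite ?sqr_ge0.
pose w x := (w1 x, v x).
have vH : v (- H) = a /\ v H = a by case: uA0.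
have rhoE x : v x = a -> rho x = Num.sqrt b.
  by move=> va; rewrite /rho /P va subrr expr0n mulr0 addr0.
have wA1 : A1 H a w.
  split; [exact: AC_H1 w1A g1L|by case: uA0| |].
    by rewrite /w /w1 vH.1 tm (rhoE _ vH.1) mulrN1.
  by rewrite /w /w1 vH.2 tp (rhoE _ vH.2) mulr1.
have rs x : - H <= x <= H -> (rho x - s x) ^+ 2 <= k.
  move=> xH; have s0 := sinus_ge0 u x; have rx0 : 0 <= rho x by exact: sqrtr_ge0.
  have s2 := sinus_sqr H0 uA0 xH.
  have : s x ^+ 2 <= rho x ^+ 2.
    by rewrite rho2 // s2 /P lerDl mulr_ge0 ?sqr_ge0 // ltW.
  have : rho x ^+ 2 <= s x ^+ 2 + k by rewrite rho2 // Psk.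
  move: (rho x) (s x) rx0 s0 => A B A0' B0 h1 h2.
  have AB : B <= A by rewrite -(@ler_pXn2r _ 2) ?nnegrE.
  have h3 : 0 <= B * (A - B) by rewrite mulr_ge0 ?subr_ge0.
  have -> : (A - B) ^+ 2 = A ^+ 2 - B ^+ 2 - 2 * (B * (A - B)) by ring.
  lra.
have gi : intble (- H) H (gap u tau) by exact: (gap_intble H0 uA0).
have wfi : intble (- H) H (fun x => (w1 x - f x) ^+ 2).
  have fL := A0_L2on1 H0 uA0.
  have := L2onD (cont_on_L2on (AC_cont_on w1A)) (L2onZ (-1) fL).
  by move=> [_]; apply: eq_intble => x _; rewrite mulN1r.
exists w; split => //; last first.
  (* [(rho - s)^2 <= k] and [(A + B)^2 <= 2 A^2 + 2 B^2] give [2 * k] per unit length plus twice the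
     gap. *)
  have -> : 4 * H * r ^+ 3 + 2 * e = 2 * k * (H - - H) + 2 * e by rewrite /k; ring.
  apply: (@le_trans _ _ (Intg (- H) H (fun x => 2 * k + 2 * gap u tau x))).
    apply: le_int => // [|x xH].
      by apply: intbleD; [exact: intble_cst|exact: intbleZ].
    have rsx := rs x xH; have /andP[t20 t21] := t2 x xH.
    have : ((rho x - s x) * tau x) ^+ 2 <= k.
      rewrite exprMn; apply: le_trans rsx; rewrite ler_piMr ?sqr_ge0 //.
    rewrite (_ : comp1 w x - f x = (rho x - s x) * tau x + (s x * tau x - f x));
      last by rewrite /comp1 /w /w1 /=; ring.
    rewrite /gap; move: ((rho x - s x) * tau x) (s x * tau x - f x) => A B h.
    have := sqr_ge0 (A - B); have -> : (A - B) ^+ 2 = A ^+ 2 - 2 * (A * B) + B ^+ 2.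
      by ring.
    have -> : (A + B) ^+ 2 = A ^+ 2 + 2 * (A * B) + B ^+ 2 by ring.
    move: (A ^+ 2) (B ^+ 2) (A * B) h => *; lra.
  rewrite intD; [|exact: intble_cst|exact: intbleZ].
  rewrite int_cst ?lerD2l ?intZ //; last by move: (H0); lra.
  by rewrite ler_pM2l.
move=> m m0.
rewrite (@E1D_AC _ H L (r ^+ 4) w g1 g H0 w1A g1L vA gL) lee_fin.
have eps0 : 0 < r ^+ 4 by rewrite exprn_gt0.
have ci := cost_density_intble H0 uA0 (r ^+ 4) k (lexx _) (lexx _) ct gtL.
(* [C1] collects the coefficients of the square of the derivative of [u_2]; [C0] is what the
   modified modulus leaves in the potential. *)
pose C1 := (1 + m^-1) * (r ^+ 4 * (36 / (k * b ^+ 2))) + r ^+ 4 + L.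
pose C0 := (1 + m^-1) * (r ^- 4 * k ^+ 2).
have bound x : - H <= x <= H -> density L (r ^+ 4) w1 g1 v g x <=
    (1 + m) * cost_density u (r ^+ 4) k tau gt x + C1 * g x ^+ 2 + C0.
  move=> xH; have s2 := sinus_sqr H0 uA0 xH; have /andP[t20 t21] := t2 x xH.
  have d1 : g1 x ^+ 2 <= (1 + m) * ((s x ^+ 2 + k) * gt x ^+ 2) +
      (1 + m^-1) * (36 / (k * b ^+ 2) * g x ^+ 2).
    apply: le_trans (young _ _ m0) _; apply: lerD.
      rewrite ler_pM2l ?addr_gt0 // exprMn rho2 // ler_wpM2r ?sqr_ge0 //.
      exact: Psk.
    rewrite ler_pM2l ?addr_gt0 ?invr_gt0 //; apply: le_trans (rhop x xH).
    by rewrite exprMn ler_piMl ?sqr_ge0.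
  have d2 : (w1 x ^+ 2 + v x ^+ 2 - 1) ^+ 2 <=
      (1 + m) * (s x ^+ 4 * (1 - tau x ^+ 2) ^+ 2) + (1 + m^-1) * k ^+ 2.
    have -> : w1 x ^+ 2 + v x ^+ 2 - 1 = - (s x ^+ 2 * (1 - tau x ^+ 2)) +
        k * (1 - v x ^+ 2 - b) ^+ 2 * tau x ^+ 2.
      by rewrite /w1 exprMn rho2 // s2 /P; ring.
    apply: le_trans (young _ _ m0) _; apply: lerD.
      by rewrite sqrrN exprMn -exprM.
    rewrite ler_pM2l ?addr_gt0 ?invr_gt0 // lerXn2r ?nnegrE ?(ltW k0) //.
      by apply: mulr_ge0; rewrite ?sqr_ge0 //; apply: mulr_ge0; rewrite ?sqr_ge0 ?(ltW k0).
    rewrite -mulrA ger_pMr //; apply: mulr_ile1; rewrite ?sqr_ge0 //.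
    exact: Xb.
  have -> : (1 + m) * cost_density u (r ^+ 4) k tau gt x + C1 * g x ^+ 2 + C0 =
    r ^+ 4 * ((1 + m) * ((s x ^+ 2 + k) * gt x ^+ 2) +
      (1 + m^-1) * (36 / (k * b ^+ 2) * g x ^+ 2) + g x ^+ 2) +
    r ^- 4 * ((1 + m) * (s x ^+ 4 * (1 - tau x ^+ 2) ^+ 2) + (1 + m^-1) * k ^+ 2) +
    L * g x ^+ 2.
    by rewrite /cost_density /C1 /C0; ring.
  rewrite /density lerD2r; apply: lerD.
    by rewrite ler_pM2l // lerD2r.
  by rewrite ler_pM2l ?invr_gt0.
have gi2 := gL.2.
have I1 : intble (- H) H (fun x => (1 + m) * cost_density u (r ^+ 4) k tau gt x).
  exact: intbleZ.
have I2 : intble (- H) H (fun x => C1 * g x ^+ 2) by exact: intbleZ.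
have : Intg (- H) H (density L (r ^+ 4) w1 g1 v g) <= Intg (- H) H (fun x =>
    (1 + m) * cost_density u (r ^+ 4) k tau gt x + C1 * g x ^+ 2 + C0).
  apply: le_int => //.
    by apply: density_intble => //; exact: AC_cont_on w1A.
  by apply: intbleD; [exact: intbleD|exact: intble_cst].
rewrite (intD (intbleD I1 I2) (intble_cst _ _ C0)) (intD I1 I2) (intZ _ ci) (intZ _ gi2).
rewrite int_cst; last by move: (H0); lra.
move=> le1; apply: (@le_trans _ _ (2^-1 * ((1 + m) *
    Intg (- H) H (cost_density u (r ^+ 4) k tau gt) + C1 * G + C0 * (H - - H)))).
  by rewrite ler_pM2l ?invr_gt0.
have -> : 2^-1 * ((1 + m) * Intg (- H) H (cost_density u (r ^+ 4) k tau gt) +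
    C1 * G + C0 * (H - - H)) = (1 + m) * (2^-1 *
    Intg (- H) H (cost_density u (r ^+ 4) k tau gt)) +
    ((1 + m^-1) * (18 * r * G / b ^+ 2 + r ^+ 2 * H) +
       r ^+ 4 * G / 2 + dirichlet H L u).
  have C1E : C1 = (1 + m^-1) * (36 * r / b ^+ 2) + r ^+ 4 + L.
    by rewrite /C1 /k; field; rewrite !gt_eqF.
  have C0E : C0 = (1 + m^-1) * r ^+ 2 by rewrite /C0 /k; field; rewrite !gt_eqF.
  rewrite C1E C0E /dirichlet.
  set A := Intg (- H) H (cost_density _ _ _ _ _); set B := Intg _ _ _.
  by move: A B (m^-1) => A B m'; field; rewrite gt_eqF.
by rewrite -!addrA lerD2r ler_pM2l // addr_gt0.
Qed.

End recovery_fields.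

(** * Diagonal choice and convergence of the energies *)

Section gamma_convergence.
Context {R : realType}.

(* Let the precision attained at parameter t be almost optimal among all
   precisions attainable at t. *)
Lemma diagonal (T : Type) (Q : R -> R -> T -> Prop) (w0 : T) :
  (forall e e' t w, e <= e' -> Q e t w -> Q e' t w) ->
  (forall e, 0 < e -> exists2 d, 0 < d &
    forall t, 0 < t < d -> exists w, Q e t w) ->
  exists W : R -> T,
    (forall t, W t = w0 \/ exists e, Q e t (W t)) /\
    (forall e, 0 < e -> exists2 d, 0 < d & forall t, 0 < t < d -> Q e t (W t)).
Proof.
move=> Qle Qex; pose S t := [set e : R | 0 < e /\ exists w, Q e t w].
have lbS t : has_lbound (S t) by exists 0 => e [/ltW].
(* The infimum may not be attained, and the slack [t] disappears in the limit; [w0] stands in where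
   no precision is attainable. *)
have /choice[W WP] : forall t, exists w,
    (w = w0 \/ exists e, Q e t w) /\ (0 < t -> S t !=set0 -> Q (inf (S t) + t) t w).
  move=> t; have [[t0 St]|nt] := pselect (0 < t /\ S t !=set0); last first.
    by exists w0; split; [left|move=> t0 St; case: nt].
  have [e [_ [w wQ]] elt] := inf_adherent t0 (conj St (lbS t)).
  exists w; split; first by right; exists e.
  by move=> _ _; exact: Qle (ltW elt) wQ.
exists W; split=> [t|e e0]; first by case: (WP t).
have e20 : 0 < e / 2 by rewrite divr_gt0.
have [d d0 dP] := Qex _ e20; exists (Num.min d (e / 2)); first by rewrite lt_min d0.
move=> t; rewrite lt_min => /and3P[t0 td te].
have Se : S t (e / 2) by split=> //; apply: dP; rewrite t0.
have [_ h] := WP t; apply: Qle (h t0 _); last by exists (e / 2).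
by rewrite [leRHS]splitr; apply: lerD; [exact: ge_inf|exact: ltW].
Qed.

Lemma near_right0 (P : R -> Prop) d : 0 < d -> (forall t, 0 < t < d -> P t) ->
  \forall t \near 0^'+, P t.
Proof.
move=> d0 dP; exists d => // t; rewrite /ball_ /= sub0r normrN => td t0.
by apply: dP; rewrite t0 (le_lt_trans (ler_norm _)).
Qed.

(** Infinite limits are covered: at [+oo] only the first hypothesis says something, at [-oo] only
    the second. *)
Lemma cvge_of_bounds (E : R -> \bar R) (l : \bar R) :
  (forall t : R, (t%:E < l)%E -> \forall eps \near 0^'+, (t%:E <= E eps)%E) ->
  (forall e : R, 0 < e -> \forall eps \near 0^'+, (E eps <= l + e%:E)%E) ->
  E eps @[eps --> 0^'+] --> l.
Proof.
case: l => [r| |] lo up.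
- apply/fine_cvgP; split.
    have h1 : \forall eps \near 0^'+, ((r - 1)%:E <= E eps)%E.
      by apply: lo; rewrite lte_fin gtrBl.
    apply: filterS2 h1 (up 1 ltr01) => eps; rewrite -EFinD.
    by case: (E eps).
  apply/cvgrPdist_le => e e0.
  have h1 : \forall eps \near 0^'+, ((r - e)%:E <= E eps)%E.
    by apply: lo; rewrite lte_fin gtrBl.
  apply: filterS2 h1 (up e e0) => eps; rewrite -EFinD /=.
  by case: (E eps) => [z| |] //=; rewrite !lee_fin ler_norml; lra.
- by apply/cvgeyPge => t; apply: lo; exact: ltry.
- apply/cvgeNyPle => t; apply: filterS (up 1 ltr01) => eps /=.
  by rewrite leeNy_eq => /eqP ->; exact: leNye.
Qed.

Lemma remainder_bound (r c d e m G b H D : R) :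
  0 < e -> 0 < r <= 1 -> 0 <= d <= 1 -> d <= e / 8 -> 0 < m <= 1 ->
  m * (`|c| + 1) <= e / 8 -> 0 <= G -> 0 <= H ->
  r * ((1 + m^-1) * (18 * G / b ^+ 2 + H) + G / 2) <= e / 4 ->
  (1 + m) * (c + d) + (1 + m^-1) * (18 * r * G / b ^+ 2 + r ^+ 2 * H) +
    r ^+ 4 * G / 2 + D <= c + D + e.
Proof.
move=> e0 /andP[r0 r1] /andP[d0 d1] de /andP[m0 m1] mc G0 H0 rM.
have T1 : (1 + m) * (c + d) <= c + e / 8 + e / 8.
  have : m * (c + d) <= m * (`|c| + 1).
    by rewrite ler_pM2l //; apply: lerD => //; exact: ler_norm.
  lra.
have r2 : r ^+ 2 <= r by rewrite expr2 ger_pMr.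
have r4 : r ^+ 4 <= r by rewrite exprS ger_pMr // exprn_ile1 // ltW.
have M0 : 0 < 1 + m^-1 by rewrite addr_gt0 ?invr_gt0.
have T2 : (1 + m^-1) * (18 * r * G / b ^+ 2 + r ^+ 2 * H) + r ^+ 4 * G / 2 <=
    r * ((1 + m^-1) * (18 * G / b ^+ 2 + H) + G / 2).
  have -> : r * ((1 + m^-1) * (18 * G / b ^+ 2 + H) + G / 2) =
    (1 + m^-1) * (18 * r * G / b ^+ 2 + r * H) + r * G / 2 by ring.
  apply: lerD; last by rewrite ler_pM2r ?invr_gt0 // ler_wpM2r.
  by rewrite ler_pM2l // lerD2l ler_wpM2r.
move: T1 T2 rM; move: ((1 + m) * (c + d)) (r * (_ + _)) (r ^+ 4 * G / 2)
  ((1 + m^-1) * (18 * r * G / b ^+ 2 + r ^+ 2 * H)) => A B C E; lra.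
Qed.

Context (H L a : R) (u : R -> R * R) (H0 : 0 < H) (L0 : 0 < L).
Context (a1 : `|a| < 1) (uA0 : A0 H a u).

Local Notation mu := (@lebesgue_measure R).
Local Notation f := (comp1 u).
Local Notation v := (comp2 u).

(** With the second component equal to [v], the divergence does not vary at all, and L^2 convergence
    concerns the first component only. *)
Definition recovery e eps (w : R -> R * R) := [/\ A1 H a w, comp2 w = v,
  (E1D H L eps w <= E1D0 H L a u + e%:E)%E &
  Intg (- H) H (fun x => (comp1 w x - f x) ^+ 2) <= e].

Lemma recovery_exists e : 0 < e -> exists2 e0, 0 < e0 &
  forall eps, 0 < eps < e0 -> exists w, recovery e eps w.
Proof.
move=> e0.
(* The conceded gap contributes [2 * (4 * dl^2 * (2 * H)) = 16 * H * dl^2], which becomes at most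
   [e / 4]. *)
pose dl := Num.min 1 (e / (64 * H)).
have dl0 : 0 < dl by rewrite lt_min ltr01 divr_gt0 // mulr_gt0.
have dl2 : dl ^+ 2 * (64 * H) <= e.
  rewrite -ler_pdivlMr ?mulr_gt0 //; apply: (@le_trans _ _ dl).
    by rewrite expr2 ger_pMr // ge_min lexx.
  by rewrite ge_min lexx orbT.
(* The signs are those of the prescribed boundary values, so [cE] carries the boundary terms of
   [E1D0]. *)
have [c rc cE] := good_whole H0 uA0 dl0 (al := -1) (be := 1)
  ltac:(by rewrite sqrrN expr1n) ltac:(by rewrite expr1n).
pose m := Num.min 1 (e / (8 * (`|c| + 1))).
have c10 : 0 < `|c| + 1 by rewrite ltr_wpDl.
have m0 : 0 < m by rewrite lt_min ltr01 divr_gt0 // mulr_gt0.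
have m1 : m <= 1 by rewrite ge_min lexx.
have mc : m * (`|c| + 1) <= e / 8.
  have : m <= e / (8 * (`|c| + 1)) by rewrite ge_min lexx orbT.
  by rewrite ler_pdivlMr ?mulr_gt0 // => h; rewrite ler_pdivlMr //; lra.
pose d := Num.min 1 (e / 8).
have d0 : 0 < d by rewrite lt_min ltr01 divr_gt0.
have d1 : d <= 1 by rewrite ge_min lexx.
have de : d <= e / 8 by rewrite ge_min lexx orbT.
pose G := Intg (- H) H (fun x => weak_derivative H v x ^+ 2).
have G0 : 0 <= G by apply: int_ge0 => x _; exact: sqr_ge0.
pose M := (1 + m^-1) * (18 * G / (1 - a ^+ 2) ^+ 2 + H) + G / 2.
have M0 : 0 <= M.
  rewrite addr_ge0 ?divr_ge0 // mulr_ge0 //.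
    by rewrite addr_ge0 // invr_ge0 ltW.
  by apply: addr_ge0; [apply: divr_ge0; [exact: mulr_ge0|exact: sqr_ge0]|exact: ltW].
have [e1 e10 eP] := rc d d0.
(* For the fourth root [r] of [eps], [r < Q] yields at once [r < 1], [r^3 < e1], [r * M <= e / 4]
   and [H * r^3 <= e / 8]. *)
pose Q := Num.min (Num.min 1 e1) (Num.min (e / (4 * (M + 1))) (e / (8 * H))).
have M1 : 0 < M + 1 by rewrite ltr_wpDl.
have Q0 : 0 < Q by rewrite !lt_min ltr01 e10 !divr_gt0 ?mulr_gt0.
exists (Num.min e1 (Q ^+ 4)); first by rewrite lt_min e10 exprn_gt0.
move=> eps; rewrite lt_min => /and3P[eps0 epse epsQ].
pose r := Num.sqrt (Num.sqrt eps).
have r0 : 0 < r by rewrite !sqrtr_gt0.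
have r4 : r ^+ 4 = eps.
  by rewrite (exprM r 2 2) sqr_sqrtr ?sqrtr_ge0 // sqr_sqrtr // ltW.
have rQ : r < Q.
  by rewrite -(@ltr_pXn2r _ 4) ?nnegrE ?(ltW r0) ?(ltW Q0) // r4.
move: (rQ); rewrite !lt_min -andbA => /and4P[r1 re1 rM rH].
have r3 : r ^+ 3 <= r by rewrite exprS ger_pMr // exprn_ile1 // ltW.
have rc1 : 0 < r ^+ 4 < e1 by rewrite r4 eps0.
have rc2 : 0 <= r ^+ 3 < e1 by rewrite exprn_ge0 ?(ltW r0) //= (le_lt_trans r3).
have [tau [gt [tA gtL [tm tp] tb [costc gape]]]] := eP _ _ rc1 rc2.
have r01 : 0 < r <= 1 by rewrite r0 ltW.
have [w [wA1 w2 wE _ wf]] := recovery_field L H0 a1 uA0 r01 tA gtL tm tp tb costc gape.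
exists w; split => //; last first.
  apply: le_trans wf _.
  have h1 : H * r ^+ 3 <= e / 8.
    apply: (@le_trans _ _ (H * r)); first by rewrite ler_pM2l.
    by rewrite ltW // mulrC -ltr_pdivlMr // -mulrA -invfM.
  have -> : 4 * H * r ^+ 3 + 2 * (4 * dl ^+ 2 * (H - - H) + d) =
    4 * (H * r ^+ 3) + (dl ^+ 2 * (64 * H)) / 4 + 2 * d by field.
  by move: (H * r ^+ 3) (dl ^+ 2 * (64 * H)) h1 dl2 => A B; lra.
rewrite -r4; apply: le_trans (wE m m0) _.
have rMe : r * M <= e / 4.
  apply: (@le_trans _ _ (r * (M + 1))); first by rewrite ler_pM2l // lerDl.
  by rewrite ltW // -ltr_pdivlMr // -mulrA -invfM.
have d01 : 0 <= d <= 1 by rewrite (ltW d0).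
have m01 : 0 < m <= 1 by rewrite m0.
have := remainder_bound (dirichlet H L u) e0 r01 d01 de m01 mc G0 (ltW H0) rMe.
rewrite -lee_fin => /le_trans; apply.
have [vm vp] : v (- H) = a /\ v H = a by case: uA0.
move: cE; rewrite /sinus vm vp mulN1r mul1r opprK (E1D0E L H0 uA0).
have -> : jump_set H f `&` `]- H, H[%classic = jump_set H f.
  by apply/seteqP; split => [x []//|x Jx]; split=> //; case: Jx.
move=> cE; rewrite (addrC c) !EFinD; apply: leeD2r; rewrite -addeA; apply: leeD2l.
apply: le_trans cE _.
by rewrite addeA; apply: leeD2r; rewrite addeC; exact: lexx.
Qed.

Lemma recovery_sequence : exists w : R -> R -> R * R,
  [/\ (forall eps, 0 < eps -> A1 H a (w eps)), hdiv_cvg H 0^'+ w u &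
      E1D H L eps (w eps) @[eps --> 0^'+] --> E1D0 H L a u].
Proof.
(* [w0] only has to be admissible with second component [v]; it serves the values of [eps] that are
   not small. *)
have [d0 d00 dP0] := recovery_exists ltr01.
have [w0 [w0A w02 _ _]] := dP0 (d0 / 2) ltac:(lra).
have mono e e' eps w : e <= e' -> recovery e eps w -> recovery e' eps w.
  move=> ee [h1 h2 h3 h4]; split => //; last exact: le_trans ee.
  by apply: le_trans h3 _; rewrite leeD2l // lee_fin.
have [W [W0 WP]] := diagonal w0 mono recovery_exists.
have WA t : A1 H a (W t) by have [->|[e []]] := W0 t.
have W2 t : comp2 (W t) = v by have [->|[e []]] := W0 t.
have strong : strong_L2_cvg H 0^'+ W u.
  have Wi t : intble (- H) H (fun x => (comp1 (W t) x - f x) ^+ 2).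
    have [w1H _ _ _] := WA t; have [w1A _] := H1_AC H0 w1H.
    have := L2onD (cont_on_L2on (AC_cont_on w1A)) (L2onZ (-1) (A0_L2on1 H0 uA0)).
    by move=> [_]; apply: eq_intble => x _; rewrite mulN1r.
  rewrite /strong_L2_cvg (_ : (fun t => _) = (fun t =>
      (Intg (- H) H (fun x => (comp1 (W t) x - f x) ^+ 2))%:E)); last first.
    apply/funext => t; rewrite -integral_itv_oo //; apply: eq_integral => x _.
    have := congr1 (fun h => h x) (W2 t); rewrite /comp2 enorm_sqr /= => ->.
    by rewrite subrr expr0n addr0.
  apply: cvge_of_bounds => [t|e e0].
    rewrite lte_fin => t0; apply: nearW => eps; rewrite lee_fin.
    by apply: le_trans (ltW t0) _; apply: int_ge0 => x _; exact: sqr_ge0.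
  have [d dd0 dP] := WP e e0; apply: near_right0 dd0 _ => t /dP[_ _ _ h].
  by rewrite add0e lee_fin.
have hd : hdiv_cvg H 0^'+ W u.
  split=> // h hL; under eq_fun do rewrite W2.
  exact: cvg_cst.
exists W; split => //.
apply: cvge_of_bounds => [t tE|e e0].
  (* The lower bound holds along every convergent admissible family, in particular along the one
     just built. *)
  apply: (E1D0_lower_bound (eps := id) H0 L0 uA0 _ hd tE).
  by apply: near_right0 ltr01 _ => eps /andP[eps0 _]; split.
have [d dd0 dP] := WP e e0; apply: near_right0 dd0 _ => t /dP[_ _ h _].
exact: h.
Qed.

End gamma_convergence.

Theorem theorem6p2 (R : realType) (H L a : R) (u : R -> R * R)
    (H_gt0 : 0 < H) (L_gt0 : 0 < L) (a_lt1 : 0 <= `|a| < 1)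
    (uA0 : A0 H a u) :
  (forall (eps : nat -> R) (u_ : nat -> R -> R * R),
     (forall n, 0 < eps n) -> eps n @[n --> \oo] --> 0 ->
     (forall n, A1 H a (u_ n)) ->
     hdiv_cvg H \oo u_ u ->
     (E1D0 H L a u <= limn_einf (fun n => E1D H L (eps n) (u_ n)))%E)
  /\
  (exists w : R -> R -> R * R,
     [/\ (forall eps, 0 < eps -> A1 H a (w eps)),
         hdiv_cvg H 0^'+ w u &
         E1D H L eps (w eps) @[eps --> 0^'+] --> E1D0 H L a u]).
Proof.
have a1 : `|a| < 1 by case/andP: a_lt1.
split=> [eps u_ eps0 _ uA1 ucv|]; first exact: E1D0_liminf.
exact: recovery_sequence.
Qed.
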